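(* Let $d\ge1$, let $\rho_0\in\mathcal{P}(\mathbb{T}^d)$, and let $\mu\in\mathcal{P}(\mathbb{T}^d)\cap L^\infty(\mathbb{T}^d)$ satisfy $\lambda:=\operatorname{ess\,inf}_{\mathbb{T}^d}\mu>0$. Let $\rho$ be any constructed solution (see context) of $\partial_t\rho-\operatorname{div}(\rho\nabla g*(\rho-\mu))=0$ on $\mathbb{T}^d$ with target $\mu$ and initial datum $\rho_0$. For every $\gamma\in(0,2\lambda/3)$ and every $s>0$, there is a constant $C_{s,\gamma}<\infty$ such that $$\forall t\ge s,\qquad \mathrm{MMD}^2(\rho_t,\mu)\le C_{s,\gamma}\,e^{-\gamma(t-s)}.$$
   Context: $\mathbb{T}^d$ is the flat torus, identified with $(-\frac12,\frac12)^d$ with periodic boundary conditions; $\mathcal{P}(\mathbb{T}^d)$ is the set of Borel probability measures, identified with densities when absolutely continuous. $g$ is the periodic Coulomb kernel, $-\Delta g=\delta_0-1$. $\mathrm{MMD}^2(\eta,\mu):=\frac12\int g*(\eta-\mu)\,d(\eta-\mu)=\frac12\|\eta-\mu\|_{\dot H^{-1}}^2$ (whenever finite). Global weak solution: a curve $\rho:[0,\infty)\to\mathcal{P}(\mathbb{T}^d)$ such that, with $v_t=-\nabla g*(\rho_t-\mu)$, for every $T>0$: $\rho\in L^q([0,T];L^p)$ for some $p,q\in(1,\infty)$ with $1/p+1/q>1$; $\rho_t\in L^\infty$ for a.e. $t\in(0,T)$; and $\int_0^T\int(\partial_t\varphi+v_t\cdot\nabla\varphi)\,d\rho_t\,dt+\int\varphi(0,x)\,d\rho_0(x)=0$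 for every $\varphi\in C_c^\infty([0,T)\times\mathbb{T}^d)$; if $\rho_0\in L^\infty$, also $\rho\in L^\infty_{\mathrm{loc}}([0,\infty);L^\infty)$. Constructed solution: fix a nonnegative $\varphi\in C_c^\infty(\mathbb{R}^d)$ with integral one, $\varepsilon_k\downarrow0$, $\varphi_k=\varepsilon_k^{-d}\varphi(\cdot/\varepsilon_k)$, $\rho_{0,k}=\rho_0*\varphi_k$, $\mu_k=\mu*\varphi_k$ (periodic convolution), and let $\rho_k$ be the unique global smooth solution of the same equation with target $\mu_k$ and initial datum $\rho_{0,k}$. A constructed solution is a global weak solution $\rho$, taken narrowly continuous on $[0,\infty)$, obtained as a limit of a subsequence of $(\rho_k)$, weak-$*$ in $L^\infty([\tau,T]\times\mathbb{T}^d)$ for all $0<\tau<T$. Such solutions exist and satisfy $\|\rho_t\|_{L^p}\le\big((1-e^{-t\|\mu\|_{L^\infty}})/\|\mu\|_{L^\infty}\big)^{-(p-1)/p}$ for all $t>0$, $1\le p\le\infty$. *)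

(* Defs.v *)
From HB Require Import structures.
From mathcomp Require Import all_boot all_order all_algebra.
From mathcomp Require Import all_classical all_reals all_analysis.
From mathcomp Require Import lra.
Import Order.TTheory GRing.Theory Num.Theory.
Import numFieldNormedType.Exports.

Set Implicit Arguments.
Unset Strict Implicit.
Unset Printing Implicit Defensive.

Local Open Scope classical_set_scope.
Local Open Scope ring_scope.

(* The Borel sigma-algebra, generated by the open sets. *)
HB.instance Definition _ (R : realType) (m n : nat) :=
  @isMeasurable.Build (sigma_display (@open 'M[R]_(m, n))) 'M[R]_(m, n)
    <<s @open 'M[R]_(m, n) >> (@sigma_algebra0 _ setT _)
    (@sigma_algebraC _ _) (@sigma_algebra_bigcup _ setT _).

Section borel.
Context {R : realType} {n : nat}.

Lemma measurable_coord (i : 'I_n) :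
  measurable_fun setT (fun v : 'rV[R]_n => v ord0 i).
Proof.
apply: (measurability _ (measurable_realfun.RGenOpens.measurableE R)).
move=> _ [_ [a [b ->]] <-].
rewrite setTI.
apply: sub_sigma_algebra.
have /continuousP := @coord_continuous R 1 n ord0 i; apply.
exact: interval_open.
Qed.

Lemma measurable_fun_rV d (T : measurableType d) (f : T -> 'rV[R]_n) :
  (forall i, measurable_fun setT (fun x => f x ord0 i)) ->
  measurable_fun setT f.
Proof.
move=> mf.
apply: (@measurability _ _ _ _ _ _ (@open 'rV[R]_n)) => //.
move=> _ [U oU <-]; rewrite setTI.
pose B (p : 'rV[rat]_n * nat) : set 'rV[R]_n :=
  [set v | forall i, v ord0 i \in
    `]ratr (p.1 ord0 i) - p.2.+1%:R^-1, ratr (p.1 ord0 i) + p.2.+1%:R^-1[].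
have mB p : measurable (f @^-1` B p).
  rewrite (_ : f @^-1` B p = \bigcap_i
      (setT `&` (fun x => f x ord0 i) @^-1` [set` `]ratr (p.1 ord0 i) - p.2.+1%:R^-1 : R, ratr (p.1 ord0 i) + p.2.+1%:R^-1[])).
    apply: fin_bigcap_measurable => // i _.
    by apply: mf => //; exact: measurable_itv.
  rewrite predeqE => x; split; first by move=> h i _; split => //=; exact: h.
  by move=> h i; have [] := h i I.
pose F p : set T := if pselect (B p `<=` U) then f @^-1` B p else set0.
rewrite (_ : f @^-1` U = \bigcup_p F p).
  apply: countable_bigcupT_measurable; first exact: countableP.
  by move=> p; rewrite /F; case: pselect => ?; [exact: mB|exact: measurable0].
rewrite predeqE => x; split; last first.
  by move=> [p _]; rewrite /F; case: pselect => // BU; exact: BU.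
move=> Ux; have := oU; rewrite openE => /(_ _ Ux).
rewrite /interior/= => /nbhs_ballP[e /= e0 eU].
have e20 : 0 < e / 2 by rewrite divr_gt0.
pose k := Num.truncn (e / 2)^-1.
have ke : k.+1%:R^-1 < e / 2.
  by rewrite invf_plt ?posrE ?ltr0n// truncnS_gt.
have k0 : 0 < k.+1%:R^-1 :> R by rewrite invr_gt0 ltr0n.
have [q qP] : exists q : 'rV[rat]_n, forall i,
    ratr (q ord0 i) \in `]f x ord0 i - k.+1%:R^-1, f x ord0 i + k.+1%:R^-1[.
  have h i : exists r : rat, ratr r \in `]f x ord0 i - k.+1%:R^-1, f x ord0 i + k.+1%:R^-1[.
    apply: rat_in_itvoo.
    by rewrite ltrBlDr -addrA ltrDl addr_gt0.
  have [r rP] := choice h.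
  by exists (\row_i r i) => i; rewrite mxE.
exists (q, k) => //; rewrite /F; case: pselect => [_ /=|[]].
  move=> i /=; move: (qP i); rewrite !in_itv/= => /andP[h1 h2].
  by rewrite ltrBlDr h2 -ltrBlDr h1.
move=> v vP; apply: eU; split => // i j; rewrite !ord1.
have := vP j; have := qP j; rewrite !in_itv/= => /andP[h1 h2] /andP[h3 h4].
rewrite /ball/= ltr_norml; move: h1 h2 h3 h4 ke.
set a := ratr _; set b := _^-1 => h1 h2 h3 h4 ke.
by apply/andP; split; lra.
Qed.
End borel.

Section lebesgue_rV.
Context {R : realType}.

(* lebesgue_rV n is the n-fold product of lebesgue_measure, transported to row
   vectors by cons_rV; see lebesgue_rV_box. *)
Definition cons_rV {n : nat} (p : measurableTypeR R * 'rV[R]_n) : 'rV[R]_n.+1 :=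
  \row_i oapp (p.2 ord0) p.1 (unlift ord0 i).

Lemma measurable_cons_rV n : measurable_fun setT (@cons_rV n).
Proof.
apply: measurable_fun_rV => i.
under eq_fun do rewrite mxE.
case: (unlift ord0 i) => [j|] /=; last exact: measurable_fst.
exact: (measurableT_comp (measurable_coord j) measurable_snd).
Qed.

Definition uncons_rV {n : nat} (v : 'rV[R]_n.+1) : measurableTypeR R * 'rV[R]_n :=
  (v ord0 ord0, \row_j v ord0 (lift ord0 j)).

Lemma cons_rVK n : cancel (@cons_rV n) uncons_rV.
Proof.
move=> [x v]; rewrite /uncons_rV mxE unlift_none /=; congr pair.
by apply/rowP => j; rewrite !mxE liftK.
Qed.

Lemma measurable_uncons_rV n : measurable_fun setT (@uncons_rV n).
Proof.
apply/measurable_fun_pairP; split; first exact: measurable_coord.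
apply: measurable_fun_rV => i /=.
under eq_fun do rewrite /= mxE.
exact: measurable_coord.
Qed.

Section step.
Variables (n : nat) (mu : {sigma_finite_measure set 'rV[R]_n -> \bar R}).

Definition lebesgue_cons : set 'rV[R]_n.+1 -> \bar R :=
  pushforward (lebesgue_measure \x mu)%E cons_rV.

Let mcons (A : set 'rV[R]_n.+1) : measurable A ->
  measurable (cons_rV @^-1` A).
Proof. by move=> mA; rewrite -[X in measurable X]setTI; exact: measurable_cons_rV. Qed.

Let lebesgue_cons0 : lebesgue_cons set0 = 0%E.
Proof. by rewrite /lebesgue_cons /pushforward preimage_set0 measure0. Qed.

Let lebesgue_cons_ge0 A : (0 <= lebesgue_cons A)%E.
Proof. by rewrite /lebesgue_cons /pushforward measure_ge0. Qed.

Let lebesgue_cons_sigma_additive : semi_sigma_additive lebesgue_cons.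
Proof.
move=> F mF tF mUF; rewrite /lebesgue_cons /pushforward preimage_bigcup.
apply: measure_semi_sigma_additive.
- by move=> k; exact: mcons.
- apply/trivIsetP => /= i j _ _ ij; rewrite -preimage_setI.
  by move/trivIsetP : tF => /(_ _ _ _ _ ij) ->//; rewrite preimage_set0.
- by rewrite -preimage_bigcup; exact: mcons.
Qed.

HB.instance Definition _ := isMeasure.Build _ _ _ lebesgue_cons
  lebesgue_cons0 lebesgue_cons_ge0 lebesgue_cons_sigma_additive.

Let lebesgue_cons_sigma_finite : sigma_finite setT lebesgue_cons.
Proof.
have /sigma_finiteP[F [FT ndF mF]] := sigma_finiteT (@lebesgue_measure R).
have /sigma_finiteP[G [GT ndG mG]] := sigma_finiteT mu.
exists (fun k => uncons_rV @^-1` (F k `*` G k)).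
  rewrite -preimage_bigcup (_ : \bigcup_k _ = setT) ?preimage_setT//.
  rewrite -setXTT FT GT predeqE => -[x y]; split.
    by move=> [k _ []/= ? ?]; split; exists k.
  move=> [/= [i _ Fix] [j _ Gjy]]; exists (maxn i j) => //; split.
    by move: x Fix; exact/subsetPset/ndF/leq_maxl.
  by move: y Gjy; exact/subsetPset/ndG/leq_maxr.
move=> k; have [mFk Fk] := mF k; have [mGk Gk] := mG k; split.
  rewrite -[X in measurable X]setTI.
  by apply: measurable_uncons_rV => //; exact: measurableX.
rewrite /lebesgue_cons /pushforward -comp_preimage.
rewrite (_ : uncons_rV \o cons_rV = id); last exact/funext/cons_rVK.
by rewrite preimage_id product_measure1E// lte_mul_pinfty// ge0_fin_numE.
Qed.

HB.instance Definition _ := Measure_isSigmaFinite.Build _ _ _ lebesgue_cons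
  lebesgue_cons_sigma_finite.

End step.

Fixpoint lebesgue_rV (n : nat) : {sigma_finite_measure set 'rV[R]_n -> \bar R} :=
  if n is k.+1 then lebesgue_cons (lebesgue_rV k) else \d_(0 : 'rV[R]_0).

Lemma measurable_box n (I : 'I_n -> interval R) :
  measurable [set v : 'rV[R]_n | forall i, v ord0 i \in I i].
Proof.
rewrite (_ : mkset _ = \bigcap_i
    (setT `&` (fun v : 'rV[R]_n => v ord0 i) @^-1` [set` I i])).
  apply: fin_bigcap_measurable => // i _.
  by apply: measurable_coord => //; exact: measurable_itv.
rewrite predeqE => x; split; first by move=> h i _; split => //=; exact: h.
by move=> h i; have [] := h i Logic.I.
Qed.

Lemma lebesgue_rV_box n (I : 'I_n -> interval R) :
  lebesgue_rV n [set v | forall i, v ord0 i \in I i] =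
  (\prod_(i < n) lebesgue_measure [set` I i])%E.
Proof.
elim: n I => [|n IH] I.
  by rewrite big_ord0 /= diracE mem_set// => -[].
rewrite big_ord_recl -IH.
transitivity ((lebesgue_measure \x lebesgue_rV n)%E
    (cons_rV @^-1` [set v | forall i, v ord0 i \in I i])) => //.
rewrite -product_measure1E//; last exact: measurable_box.
congr (product_measure1 _ _ _); rewrite predeqE => -[x v]; split => /=.
  move=> h; split; first by have := h ord0; rewrite mxE unlift_none.
  by move=> i; have := h (lift ord0 i); rewrite mxE liftK.
by move=> [h0 h] i; rewrite mxE; case: unliftP => [j|] -> //=; exact: h.
Qed.

(* Fundamental domain of T^d = R^d / Z^d. *)
Definition unit_cube {n : nat} : set 'rV[R]_n :=
  [set x | forall i, x ord0 i \in `[- 2^-1, 2^-1[].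

Lemma measurable_unit_cube n : measurable (@unit_cube n).
Proof. exact: measurable_box. Qed.

Definition lebesgue_torus (n : nat) : set 'rV[R]_n -> \bar R :=
  mrestr (lebesgue_rV n) (@measurable_unit_cube n).

HB.instance Definition _ n := Measure.on (@lebesgue_torus n).

Let lebesgue_torus_setT n : @lebesgue_torus n setT = 1%E.
Proof.
rewrite /lebesgue_torus /mrestr setTI [LHS](lebesgue_rV_box (fun=> _)).
rewrite big1// => i _; rewrite lebesgue_measure_itv/= lte_fin.
by rewrite gtrN ?invr_gt0// -EFinB opprK; congr EFin; lra.
Qed.

HB.instance Definition _ n := Measure_isProbability.Build _ _ _
  (@lebesgue_torus n) (@lebesgue_torus_setT n).

End lebesgue_rV.
Arguments lebesgue_torus R n : clear implicits.

Section smooth.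
Context {R : realType} {V : normedModType R}.

(* C^infinity: every iterated directional derivative is (Frechet) differentiable
   everywhere, hence continuous. *)
Definition iter_derive (vs : seq V) (f : V -> R) : V -> R :=
  foldr (fun v h => derive h ^~ v) f vs.

Definition smooth (f : V -> R) : Prop :=
  forall (vs : seq V) (x : V), differentiable (iter_derive vs f) x.

End smooth.

Section torus.
Context {R : realType} {d : nat}.
Local Notation V := 'rV[R]_d.
Local Notation dx := (lebesgue_torus R d).
Local Notation dt := (@lebesgue_measure R).

Definition lattice (n : 'rV[int]_d) : V := map_mx intr n.

(* Functions on T^d are encoded as Z^d-periodic functions on R^d. *)
Definition lattice_periodic (T : Type) (f : V -> T) : Prop :=
  forall (n : 'rV[int]_d) (x : V), f (x + lattice n) = f x.

Definition basis_vec (i : 'I_d) : V := delta_mx ord0 i.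

Definition pderiv (i : 'I_d) (f : V -> R) (x : V) : R := 'D_(basis_vec i) f x.

Definition laplacian (f : V -> R) (x : V) : R := \sum_i pderiv i (pderiv i f) x.

Definition time_deriv (f : R * V -> R) (z : R * V) : R := 'D_(1, 0) f z.

(* P(T^d): Borel probability measures on R^d carried by the fundamental domain
   unit_cube.  Integrating a periodic function against such a measure is
   integrating over the torus. *)
Record torus_prob := TorusProb {
  torus_measure :> probability V R;
  torus_measure_cube : torus_measure unit_cube = 1%E }.

Record is_density (f : V -> R) (eta : torus_prob) : Prop := {
  density_measurable : measurable_fun setT f;
  density_ge0 : forall x, 0 <= f x;
  densityE : forall A, measurable A -> eta A = (\int[dx]_(x in A) (f x)%:E)%E }.

(* Equals +oo when eta is not absolutely continuous (infimum of the empty set). *)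
Definition Lp_norm (p : \bar R) (eta : torus_prob) : \bar R :=
  ereal_inf [set 'N[dx]_p[EFin \o f]%E | f in is_density^~ eta].

(* - Delta g = delta_0 - 1 in the sense of distributions.  Continuity into \bar R
   selects the canonical pointwise representative: it forces g 0 = +oo when
   d >= 2, and a finite value when d = 1.  These conditions determine g up to an
   additive constant, which cancels in everything below since only differences
   of probability measures are convolved with g. *)
Record coulomb_kernel (g : V -> \bar R) : Prop := {
  coulomb_periodic : lattice_periodic g;
  coulomb_continuous : continuous g;
  coulomb_fin_num : forall x, g x \isn't a fin_num -> exists n, x = lattice n;
  coulomb_integrable : dx.-integrable setT g;
  coulomb_eq : forall f : V -> R, smooth f -> lattice_periodic f ->
    (- (\int[dx]_x (g x * (laplacian f x)%:E))
     = (f 0)%:E - \int[dx]_x (f x)%:E)%E }.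

Definition potential (g : V -> \bar R) (eta : torus_prob) (x : V) : \bar R :=
  (\int[eta]_y g (x - y)%R)%E.

(* 1/2 \int g * (eta - mu) d(eta - mu). *)
Definition mmd2 (g : V -> \bar R) (eta mu : torus_prob) : \bar R :=
  let h x := (potential g eta x - potential g mu x)%E in
  ((2^-1)%:E * (\int[eta]_x h x - \int[mu]_x h x))%E.

(* i-th component of (nabla g) * eta.  The kernel is not differentiable on the
   lattice, which is negligible for the absolutely continuous measures to which
   this is applied. *)
Definition force (g : V -> \bar R) (eta : torus_prob) (i : 'I_d) (x : V) : R :=
  \int[eta]_y pderiv i (fine \o g) (x - y).

Definition velocity (g : V -> \bar R) (mu eta : torus_prob) (i : 'I_d) (x : V) : R :=
  - (force g eta i x - force g mu i x).

(* Elements of C_c^infinity([0, T) x T^d), as restrictions to t >= 0 of smooth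
   functions on R x R^d; the values at t < 0 are never used. *)
Definition test_function (T : R) (phi : R * V -> R) : Prop :=
  [/\ smooth phi, forall t, lattice_periodic (fun x => phi (t, x)) &
      exists2 T', T' < T & forall t x, T' <= t -> phi (t, x) = 0].

Definition transport (phi : R * V -> R) (v : 'I_d -> V -> R) (t : R) (x : V) : R :=
  time_deriv phi (t, x) + \sum_i v i x * pderiv i (fun y => phi (t, y)) x.

(* weak_measurable is the (weak) measurability implicit in membership in
   L^q([0, T]; L^p).  In weak_eq the integrals are extended-real valued, so that
   the equation with 0 includes their finiteness. *)
Record weak_solution (g : V -> \bar R) (mu : torus_prob) (rho : R -> torus_prob) :
    Prop := {
  weak_measurable : forall f : V -> R, continuous f -> lattice_periodic f ->
    measurable_fun (`[0, +oo[ : set R) (fun t => \int[rho t]_x f x);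
  weak_LqLp : forall T : R, 0 < T -> exists p q : R,
    [/\ 1 < p, 1 < q, 1 < p^-1 + q^-1 &
        (\int[dt]_(t in `[0%R, T]) (Lp_norm p%:E (rho t) `^ q) < +oo)%E];
  weak_bounded : forall T : R, 0 < T ->
    {ae dt, forall t : R, t \in `]0, T[ -> (Lp_norm +oo (rho t) < +oo)%E};
  weak_eq : forall T : R, 0 < T -> forall phi : R * V -> R, test_function T phi ->
    ((\int[dt]_(t in `[0%R, T])
        (\int[rho t]_x (transport phi (velocity g mu (rho t)) t x)%:E))
     + (\int[rho 0%R]_x (phi (0%R, x))%:E) = 0)%E;
  weak_bounded0 : (Lp_norm +oo (rho 0%R) < +oo)%E -> forall T : R, 0 < T ->
    exists M : R,
    {ae dt, forall t : R, t \in `[0, T] -> (Lp_norm +oo (rho t) <= M%:E)%E} }.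

Definition narrowly_continuous (rho : R -> torus_prob) : Prop :=
  forall f : V -> R, continuous f -> lattice_periodic f ->
    {within `[0, +oo[, continuous (fun t => \int[rho t]_x f x)}.

(* Classical solution with density u; smoothness on [0, +oo) x T^d, up to t = 0,
   is expressed by a smooth extension to negative times, which is otherwise
   unconstrained. *)
Record smooth_solution (g : V -> \bar R) (mu : torus_prob) (u : R * V -> R)
    (rho : R -> torus_prob) : Prop := {
  smooth_solution_smooth : smooth u;
  smooth_solution_periodic : forall t, lattice_periodic (fun x => u (t, x));
  smooth_solution_density : forall t : R, 0 <= t -> is_density (fun x => u (t, x)) (rho t);
  smooth_solution_eq : forall (t : R) x, 0 < t ->
    time_deriv u (t, x) +
      \sum_i pderiv i (fun y => u (t, y) * velocity g mu (rho t) i y) x = 0 }.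

Record mollifier (phi : V -> R) : Prop := {
  mollifier_smooth : smooth phi;
  mollifier_compact : compact (closure [set x | phi x != 0]);
  mollifier_ge0 : forall x, 0 <= phi x;
  mollifier_int : (\int[lebesgue_rV d]_x (phi x)%:E = 1)%E }.

Definition rescale (phi : V -> R) (eps : R) (x : V) : R :=
  eps ^- d * phi (eps^-1 *: x).

(* Density of the convolution on the torus of eta with the periodization of phi;
   the sum is finite for compactly supported phi. *)
Definition periodic_conv (eta : torus_prob) (phi : V -> R) (x : V) : R :=
  \int[eta]_y (\sum_(n \in [set: 'rV[int]_d]) phi (x - y + lattice n)).

(* Convergence of u j to (a joint density of) rho, weak-* in
   L^infinity([tau, T] x T^d) = L^1([tau, T] x T^d)^*, for all 0 < tau < T. *)
Definition weak_star_limit (u : nat -> R * V -> R) (rho : R -> torus_prob) : Prop :=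
  exists r : R * V -> R,
  [/\ measurable_fun setT r,
      {ae dt, forall t : R, 0 < t -> is_density (fun x => r (t, x)) (rho t)} &
      forall tau T : R, 0 < tau -> tau < T ->
      let D : set (R * V) := `[tau, T] `*` setT in
      (exists M : R, {ae (dt \x dx)%E, forall z, D z -> `|r z| <= M}) /\
      (forall psi : R * V -> R, (dt \x dx)%E.-integrable D (EFin \o psi) ->
        (fun j => \int[(dt \x dx)%E]_(z in D) (psi z * u j z)) @ \oo -->
        \int[(dt \x dx)%E]_(z in D) (psi z * r z))].

Definition constructed_solution (g : V -> \bar R) (rho0 mu : torus_prob)
    (rho : R -> torus_prob) : Prop :=
  [/\ weak_solution g mu rho,
      narrowly_continuous rho,
      forall A, measurable A -> rho 0 A = rho0 A &
      exists phi : V -> R, exists eps : nat -> R,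
      exists mu_ : nat -> torus_prob, exists rho_ : nat -> R -> torus_prob,
      exists u : nat -> R * V -> R, exists sigma : nat -> nat,
      [/\ mollifier phi,
          [/\ forall k, 0 < eps k, {homo eps : j k / (j <= k)%N >-> k <= j}
              & eps @ \oo --> 0],
          forall k, [/\ is_density (periodic_conv mu (rescale phi (eps k))) (mu_ k),
                        smooth_solution g (mu_ k) (u k) (rho_ k) &
                        forall x, u k (0, x) = periodic_conv rho0 (rescale phi (eps k)) x],
          {homo sigma : j k / (j < k)%N} &
          weak_star_limit (u \o sigma) rho]].

End torus.
Arguments torus_prob R d : clear implicits.

(* Main.v *)
Require Import Defs.
From HB Require Import structures.
From mathcomp Require Import all_boot all_order all_algebra.
From mathcomp Require Import all_classical all_reals all_analysis.
From mathcomp Require Import measurable_realfun ess_sup_inf.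
From mathcomp Require Import ring lra.
Import Order.TTheory GRing.Theory Num.Theory.
Import numFieldNormedType.Exports.

(** The limit inherits the decay from the smooth approximations, for which it is a
    Lyapunov argument with constants that depend only on the kernel, on the bounds
    [lambda <= mu <= M] of the target and on the starting time [s]; it works for every
    rate [gamma < lambda].

    Smooth solutions.  Let [u] be the density, [h = g * (u - mu)] the potential, so
    that the velocity is [- grad h] and [- laplacian h = u - mu]; the equation reads
    [du/dt = grad u . grad h - u (u - mu)].  At a spatial maximum the first term
    vanishes, whence [u <= M + 1 / t] ([density_le]); then [laplacian h] is bounded and
    so is [grad h], by an elementary interior estimate ([gradient_estimate]).  The
    energy [E = 1/2 \int h (u - mu) = 1/2 \int |grad h|^2] is dissipated:
    [E' = - \int u |grad h|^2].  The density may be small, so this is not directly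
    coercive; but the squared deficit [D = \int ((lambda - u)_+)^2] satisfies
    [D' <= - lambda D], because the reaction term pushes the density upwards where it
    lies below the target, and [u >= lambda / 2 - ((lambda - u)_+)^2 / (2 lambda)].
    Hence [E' <= - lambda E + A D], and for [K (lambda - gamma) >= A] the functional
    [(E + K D) exp (gamma t)] does not increase ([flow_decay]).  Here [E + K D] is
    bounded at time [s], uniformly in the approximation.

    Velocities.  The velocity of the approximations is defined with the pointwise
    gradient of the kernel.  That this gradient is integrable and is the
    distributional one is obtained by mollification.  Off the lattice the gradients
    of the mollified kernels converge by the gradient estimate.  Paired with a bounded
    function [F] they are gradients of potentials with bounded Laplacian, which the
    same estimate shows to be small when the integral of [|F|] is: the mollified
    gradients are uniformly integrable, and Vitali's theorem identifies the limit
    ([kernel_gradient_conv]).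

    The limit.  For a smooth function [f] the moments [\int f u_k(t)] are Lipschitz in
    time uniformly in [k].  Together with weak-* convergence and the narrow continuity
    of the limit this gives convergence at every time [t > 0] ([flow_cvg_at_time]).  The
    bound [u_k(t) <= M + 1 / s] survives as domination of [rho_t] by a multiple of
    Lebesgue measure against continuous functions, which controls the singular part
    of the kernel uniformly: the discrepancy is a uniform limit of narrowly
    continuous functionals ([mmd2_limit_le]). *)

Set Implicit Arguments.
Unset Strict Implicit.
Unset Printing Implicit Defensive.

Local Open Scope classical_set_scope.
Local Open Scope ring_scope.

(** * Affine changes of variables for Lebesgue measure *)

Section lebesgue_change.
Context {R : realType}.
Local Notation leb := (@lebesgue_measure R).
Local Open Scope ereal_scope.

Lemma ge0_integral_lebesgueN (F : R -> \bar R) : measurable_fun setT F ->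
  (forall r, 0 <= F r) -> \int[leb]_r F (- r)%R = \int[leb]_r F r.
Proof.
move=> mF F0.
have mo : measurable_fun setT (-%R : R -> measurableTypeR R) by exact: oppr_measurable.
transitivity (\int[pushforward leb (-%R : R -> measurableTypeR R)]_r F r).
  by rewrite ge0_integral_pushforward// preimage_setT.
by apply: eq_measure_integral => A mA _; exact: lebesgue_measureN.
Qed.

Lemma ge0_integral_lebesgueD (b : R) (F : R -> \bar R) : measurable_fun setT F ->
  (forall r, 0 <= F r) -> \int[leb]_r F (r + b)%R = \int[leb]_r F r.
Proof.
move=> mF F0.
have mo : measurable_fun setT ((fun r => r + b)%R : R -> measurableTypeR R).
  exact: measurable_funD.
transitivity (\int[pushforward leb ((fun r => r + b)%R : R -> measurableTypeR R)]_r F r).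
  by rewrite ge0_integral_pushforward// preimage_setT.
apply: eq_measure_integral => A mA _.
apply/esym/lebesgue_measure_unique => //= _ [[p q]] _ <-.
rewrite /pushforward/=.
rewrite (_ : _ @^-1` _ = `]p - b, q - b]%classic)%R; last first.
  by rewrite predeqE => r /=; rewrite !in_itv/= ltrBlDr lerBrDr.
rewrite !lebesgue_measure_itv/= !lte_fin ltrD2r -!EFinB.
by rewrite (_ : q - b - (p - b) = q - p)%R//; ring.
Qed.

Lemma ge0_integral_lebesgueZ (a : R) (F : R -> \bar R) : (0 < a)%R ->
  measurable_fun setT F ->
  (forall r, 0 <= F r) -> \int[leb]_r F (a * r)%R = (a^-1)%:E * \int[leb]_r F r.
Proof.
move=> a0 mF F0.
have mo : measurable_fun setT ((fun r => a * r)%R : R -> measurableTypeR R).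
  exact: measurable_funM.
have a1 : (0 <= a^-1)%R by rewrite invr_ge0 ltW.
rewrite -[a^-1%R]/(NngNum a1)%:num -ge0_integral_mscale//.
transitivity (\int[pushforward leb ((fun r => a * r)%R : R -> measurableTypeR R)]_r F r).
  by rewrite ge0_integral_pushforward// preimage_setT.
apply: eq_measure_integral => A mA _.
rewrite /mscale/=.
have lA : leb A = mscale (NngNum (ltW a0)) (pushforward leb
    ((fun r => a * r)%R : R -> measurableTypeR R)) A.
  move=> mo'; apply: lebesgue_measure_unique => // _ [[p q]] _ <-.
  rewrite [RHS](_ : _ = a%:E * leb ((fun r => a * r)%R @^-1` `]p, q]%classic))//.
  rewrite (_ : _ @^-1` _ = `]a^-1 * p, a^-1 * q]%classic)%R; last first.
    rewrite predeqE => r /=; rewrite !in_itv/= .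
    by rewrite ltr_pdivrMl// ler_pdivlMl.
  rewrite !lebesgue_measure_itv/= !lte_fin ltr_pM2l ?invr_gt0//.
  case: ifP => _; last by rewrite mule0.
  by rewrite -EFinD -EFinM; congr EFin; field; rewrite gt_eqF.
rewrite [X in _ = (_ * X)%E](_ : _ = leb A)// (lA mo).
by rewrite /mscale/= muleA -EFinM mulVf ?gt_eqF// mul1e.
Qed.

(** Fubini reduces a change of variables acting separately on each coordinate
    to dimension one. *)
Lemma ge0_integral_lebesgue_rV_coord n (tau : 'I_n -> R -> R) (c : R) :
  (0 <= c)%R -> (forall i, measurable_fun setT (tau i)) ->
  (forall i (F : R -> \bar R), measurable_fun setT F -> (forall r, 0 <= F r) ->
     \int[leb]_r F (tau i r) = c%:E * \int[leb]_r F r) ->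
  forall F : 'rV[R]_n -> \bar R, measurable_fun setT F -> (forall x, 0 <= F x) ->
  \int[lebesgue_rV n]_x F (\row_i tau i (x ord0 i)) =
  (c ^+ n)%:E * \int[lebesgue_rV n]_x F x.
Proof.
elim: n tau => [|n IH] tau c0 mtau Htau F mF F0.
  rewrite expr0 mul1e; apply: eq_integral => x _; congr F.
  by apply/rowP => -[].
have mrow k (t : 'I_k -> R -> R) : (forall i, measurable_fun setT (t i)) ->
    measurable_fun setT (fun x : 'rV[R]_k => \row_i t i (x ord0 i) : 'rV[R]_k).
  move=> mt; apply: measurable_fun_rV => i; under eq_fun do rewrite mxE.
  exact: (measurableT_comp (mt i) (measurable_coord i)).
have hstep (G : 'rV[R]_n.+1 -> \bar R) : measurable_fun setT G ->
    (forall x, 0 <= G x) ->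
    \int[lebesgue_rV n.+1]_x G x =
    \int[leb]_r \int[lebesgue_rV n]_x G (cons_rV (r, x)).
  move=> mG G0.
  have mGc : measurable_fun setT (G \o cons_rV).
    exact: (measurableT_comp mG (@measurable_cons_rV R n)).
  transitivity (\int[(leb \x lebesgue_rV n)%E]_z (G \o cons_rV) z).
    rewrite [LHS](ge0_integral_pushforward (@measurable_cons_rV R n))//.
  by rewrite fubini_tonelli1 => [//|//|z]; exact: G0.
rewrite hstep//; last exact: (measurableT_comp mF (mrow _ _ mtau)).
rewrite hstep//.
transitivity (\int[leb]_r \int[lebesgue_rV n]_x
    F (cons_rV (tau ord0 r, \row_i tau (lift ord0 i) (x ord0 i)))).
  apply: eq_integral => r _; apply: eq_integral => x _; congr F.
  apply/rowP => i; rewrite !mxE; case: unliftP => [j|] ->//=.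
  by rewrite mxE.
have mFc r : measurable_fun setT (fun x => F (cons_rV (r, x))).
  apply: (measurableT_comp mF).
  apply: (measurableT_comp (@measurable_cons_rV R n)).
  exact: measurable_pair1.
transitivity (\int[leb]_r ((c ^+ n)%:E *
     \int[lebesgue_rV n]_x F (cons_rV (tau ord0 r, x)))).
  apply: eq_integral => r _.
  have mt i : measurable_fun setT (tau (lift ord0 i)) by exact: mtau.
  apply: (IH (fun i => tau (lift ord0 i)) c0 mt) => // i G mG G0.
  exact: Htau.
have mI : measurable_fun setT (fun r => \int[lebesgue_rV n]_x F (cons_rV (r, x))).
  apply: (measurable_fun_fubini_tonelli_F (F \o cons_rV)) => //=.
  exact: (measurableT_comp mF (@measurable_cons_rV R n)).
have I0 r : 0 <= \int[lebesgue_rV n]_x F (cons_rV (r, x)) by exact: integral_ge0.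
rewrite (@ge0_integralZl_EFin _ _ _ leb setT measurableT
  (fun r => \int[lebesgue_rV n]_x F (cons_rV (tau ord0 r, x))))//;
  [|exact: (measurableT_comp mI (mtau ord0))|exact: exprn_ge0].
rewrite (Htau ord0 (fun r => \int[lebesgue_rV n]_x F (cons_rV (r, x))))//.
by rewrite muleA -EFinM exprSr.
Qed.

Context {n : nat}.
Implicit Types (F : 'rV[R]_n -> \bar R).

Lemma ge0_integral_lebesgue_rVN F : measurable_fun setT F -> (forall x, 0 <= F x) ->
  \int[lebesgue_rV n]_x F (- x)%R = \int[lebesgue_rV n]_x F x.
Proof.
move=> mF F0.
have := @ge0_integral_lebesgue_rV_coord n (fun _ r => - r)%R 1%R ler01 _ _ F mF F0.
rewrite expr1n mul1e => <-.
- by apply: eq_integral => x _; congr F; apply/rowP => i; rewrite !mxE.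
- by move=> _; exact: oppr_measurable.
- by move=> _ G mG G0; rewrite mul1e; exact: ge0_integral_lebesgueN.
Qed.

Lemma ge0_integral_lebesgue_rVD (b : 'rV[R]_n) F : measurable_fun setT F ->
  (forall x, 0 <= F x) ->
  \int[lebesgue_rV n]_x F (x + b)%R = \int[lebesgue_rV n]_x F x.
Proof.
move=> mF F0.
have := @ge0_integral_lebesgue_rV_coord n (fun i r => r + b ord0 i)%R 1%R ler01 _ _ F mF F0.
rewrite expr1n mul1e => <-.
- by apply: eq_integral => x _; congr F; apply/rowP => i; rewrite !mxE.
- by move=> i; exact: measurable_funD.
- by move=> i G mG G0; rewrite mul1e; exact: ge0_integral_lebesgueD.
Qed.

Lemma ge0_integral_lebesgue_rVZ (a : R) F : (0 < a)%R -> measurable_fun setT F ->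
  (forall x, 0 <= F x) ->
  \int[lebesgue_rV n]_x F (a *: x)%R = (a ^- n)%:E * \int[lebesgue_rV n]_x F x.
Proof.
move=> a0 mF F0.
have := @ge0_integral_lebesgue_rV_coord n (fun i r => a * r)%R a^-1%R _ _ _ F mF F0.
rewrite exprVn => <-.
- by apply: eq_integral => x _; congr F; apply/rowP => i; rewrite !mxE.
- by rewrite invr_ge0 ltW.
- by move=> _; exact: measurable_funM.
- by move=> i G mG G0; exact: ge0_integral_lebesgueZ.
Qed.

End lebesgue_change.

(** * Integration over the torus and densities *)

Section torus_integral.
Context {R : realType} {d : nat}.
Local Notation V := 'rV[R]_d.
Local Notation dx := (lebesgue_torus R d).
Local Notation L := (@lebesgue_rV R d).
Local Open Scope ereal_scope.
Implicit Types (F : V -> \bar R) (P : set V).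

Definition fundamental_domain P :=
  (forall x, exists n, P (x + lattice n)%R) /\
  (forall x n m, P (x + lattice n)%R -> P (x + lattice m)%R -> n = m).

Lemma latticeN (n : 'rV[int]_d) : lattice (- n)%R = (- lattice n)%R :> V.
Proof. by apply/rowP => i; rewrite !mxE rmorphN. Qed.

Lemma latticeD (n m : 'rV[int]_d) : lattice (n + m)%R = (lattice n + lattice m)%R :> V.
Proof. by apply/rowP => i; rewrite !mxE rmorphD. Qed.

Lemma fundamental_cube : fundamental_domain (@unit_cube R d).
Proof.
split=> [x|x n m hn hm].
  exists (\row_i (- Num.floor (x ord0 i + 2^-1)))%R => i.
  rewrite !mxE in_itv/= rmorphN/=.
  have /andP[h1 h2] := floor_itv (x ord0 i + 2^-1)%R.
  move: h1 h2; rewrite rmorphD/=; set f := (_%:~R)%R => h1 h2.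
  by apply/andP; split; lra.
apply/rowP => i; move: (hn i) (hm i); rewrite !mxE !in_itv/=.
move=> /andP[h1 h2] /andP[h3 h4].
have h5 : (`|(n ord0 i - m ord0 i)%:~R| < 1 :> R)%R.
  by rewrite rmorphB/= ltr_norml; apply/andP; split; lra.
rewrite -intr_norm -[1%R]/(1%:~R)%R ltr_int in h5.
by apply/eqP; rewrite -subr_eq0 -normr_le0 -ltzD1 add0r.
Qed.

Lemma fundamentalD (a : V) P : fundamental_domain P ->
  fundamental_domain [set x | P (x + a)%R].
Proof.
move=> [h1 h2]; split=> [x|x n m /=].
  by have [n hn] := h1 (x + a)%R; exists n => /=; rewrite addrAC.
by rewrite !(addrAC _ _ a) => /h2; exact.
Qed.

Lemma fundamentalN P : fundamental_domain P ->
  fundamental_domain [set x | P (- x)%R].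
Proof.
move=> [h1 h2]; split=> [x|x n m /=].
  by have [n hn] := h1 (- x)%R; exists (- n)%R => /=; rewrite opprD latticeN opprK.
rewrite !opprD -!latticeN => /h2 /[apply] h; exact: oppr_inj.
Qed.

Lemma measurable_shift (a : V) : measurable_fun setT (fun x : V => x + a)%R.
Proof.
apply: measurable_fun_rV => i; under eq_fun do rewrite mxE.
by apply: measurable_funD => //; exact: measurable_coord.
Qed.

Lemma measurable_oppV : measurable_fun setT (fun x : V => - x)%R.
Proof.
apply: measurable_fun_rV => i; under eq_fun do rewrite mxE.
by apply: measurableT_comp => //; exact: measurable_coord.
Qed.

Let piece P (k : nat) : set V :=
  if @pickle_inv 'rV[int]_d k is Some n then [set x | P (x + lattice n)%R] else set0.

Let piece_cover P : fundamental_domain P -> \bigcup_k piece P k = setT.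
Proof.
move=> [h1 _]; rewrite predeqE => x; split => // _.
have [n hn] := h1 x; exists (pickle n) => //.
by rewrite /piece pickleK_inv.
Qed.

Let piece_trivI P : fundamental_domain P -> trivIset setT (piece P).
Proof.
move=> [_ h2]; apply/trivIsetP => i j _ _ ij.
rewrite -subset0 => x []; rewrite /piece.
case Ei : pickle_inv => [n|//] /= hn; case Ej : pickle_inv => [m|//] /= hm.
move: ij; rewrite -(@pickle_invK 'rV[int]_d i) -(@pickle_invK 'rV[int]_d j).
by rewrite Ei Ej /= (h2 _ _ _ hn hm) eqxx.
Qed.

Let piece_meas P k : measurable P -> measurable (piece P k).
Proof.
move=> mP; rewrite /piece; case: pickle_inv => [n|//].
by rewrite -[X in measurable X]setTI; exact: measurable_shift.
Qed.

(** Cutting a fundamental domain along the translates of another one and moving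
    each piece back by a lattice vector reassembles the other one. *)
Lemma ge0_integral_fundamental P Q F : fundamental_domain P ->
  fundamental_domain Q -> measurable P -> measurable Q ->
  measurable_fun setT F -> lattice_periodic F ->
  (forall x, 0 <= F x) -> \int[L]_(x in P) F x = \int[L]_(x in Q) F x.
Proof.
move=> fP fQ mP mQ mF pF F0.
pose piece' k : set V :=
  if @pickle_inv 'rV[int]_d k is Some n then [set x | P (x - lattice n)%R] else set0.
have E A (G : nat -> set V) : \bigcup_k G k = setT -> A = \bigcup_k (A `&` G k).
  by move=> h; rewrite -setI_bigcupr h setIT.
have fQN := fundamentalN fQ.
pose qN k := piece [set x | Q (- x)%R] k.
pose Qk k : set V := [set x | qN k (- x)%R].
have QkE k : Qk k = if @pickle_inv 'rV[int]_d k is Some n then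
   [set x | Q (x - lattice n)%R] else set0.
  rewrite /Qk /qN /piece; case: pickle_inv => [n|//].
  by rewrite predeqE => x /=; rewrite opprD opprK.
have mQk k : measurable (Qk k).
  rewrite QkE; case: pickle_inv => [n|//].
  by rewrite -[X in measurable X]setTI -latticeN; exact: measurable_shift.
rewrite {1}(E P Qk); last first.
  rewrite predeqE => x; split=> // _.
  have : setT (- x)%R by [].
  by rewrite -(piece_cover fQN) => -[k _ hk]; exists k.
rewrite ge0_integral_bigcup//=; last 3 first.
- by move=> k; exact: measurableI.
- exact: measurable_funTS.
- apply/trivIsetP => i j _ _ ij.
  rewrite -subset0 => x [[_ h1] [_ h2]].
  have /trivIsetP/(_ i j I I ij) := piece_trivI fQN.
  by rewrite -subset0 => /(_ (- x)%R); apply; split; [exact: h1|exact: h2].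
rewrite {1}(E Q (piece P)); last exact: piece_cover.
rewrite ge0_integral_bigcup//=; last 3 first.
- by move=> k; apply: measurableI => //; exact: piece_meas.
- exact: measurable_funTS.
- apply/trivIsetP => i j _ _ ij.
  rewrite -subset0 => x [[_ h1] [_ h2]].
  have /trivIsetP/(_ i j I I ij) := piece_trivI fP.
  by rewrite -subset0 => /(_ x); apply; split; [exact: h1|exact: h2].
apply: eq_eseriesr => k _; rewrite QkE /piece.
case: pickle_inv => [n|]; last by rewrite !setI0.
rewrite integral_mkcond [RHS]integral_mkcond.
have mPQ : measurable (P `&` [set x | Q (x - lattice n)%R]).
  apply: measurableI => //.
  by rewrite -[X in measurable X]setTI -latticeN; exact: measurable_shift.
rewrite -(ge0_integral_lebesgue_rVD (lattice n)); last 2 first.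
- by apply/(measurable_restrictT _ _).1 => //; exact: measurable_funTS.
- by move=> x; rewrite patchE; case: ifP.
apply: eq_integral => x _; rewrite !patchE pF.
congr (if _ then _ else _); apply/idP/idP => /set_mem /= [h1 h2];
  apply/mem_set; split => //=; first by rewrite addrK in h2.
by rewrite addrK.
Qed.

Lemma ge0_integral_carried (mu : {measure set V -> \bar R}) F :
  mu (~` unit_cube) = 0 -> measurable_fun setT F -> (forall x, 0 <= F x) ->
  \int[mu]_x F x = \int[mu]_(x in unit_cube) F x.
Proof.
move=> mu0 mF F0; have mc := @measurable_unit_cube R d.
rewrite -(setvU unit_cube) ge0_integral_setU//; last 3 first.
- exact: measurableC.
- by rewrite setvU.
- by apply/disj_setPS => x [].
rewrite null_set_integral ?add0e//; [exact: measurableC|exact: measurable_funTS].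
Qed.

Lemma torus_cubeC : dx (~` unit_cube) = 0.
Proof. by rewrite /lebesgue_torus/= /mrestr setICl measure0. Qed.

Lemma ge0_integral_torusE F : measurable_fun setT F -> (forall x, 0 <= F x) ->
  \int[dx]_x F x = \int[L]_(x in unit_cube) F x.
Proof.
move=> mF F0; rewrite ge0_integral_carried//; last exact: torus_cubeC.
apply: eq_measure_integral => A mA Ac.
by rewrite /lebesgue_torus/= /mrestr; congr (L _); apply/setIidPl.
Qed.

Lemma ge0_integral_torusD (a : V) F : measurable_fun setT F -> lattice_periodic F ->
  (forall x, 0 <= F x) -> \int[dx]_x F (x + a)%R = \int[dx]_x F x.
Proof.
move=> mF pF F0; have mFa := measurableT_comp mF (measurable_shift a).
rewrite ge0_integral_torusE// ge0_integral_torusE//.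
have mc := @measurable_unit_cube R d.
have mP : measurable [set x : V | unit_cube (x - a)%R].
  by rewrite -[X in measurable X]setTI; exact: measurable_shift.
rewrite (@ge0_integral_fundamental unit_cube [set x | unit_cube (x - a)%R] F)//;
  [|exact: fundamental_cube|exact/fundamentalD/fundamental_cube].
rewrite integral_mkcond [RHS]integral_mkcond.
rewrite -[RHS](ge0_integral_lebesgue_rVD a); last 2 first.
- by apply/(measurable_restrictT _ _).1 => //; exact: measurable_funTS.
- by move=> x; rewrite patchE; case: ifP.
apply: eq_integral => x _; rewrite !patchE.
by congr (if _ then _ else _); apply/idP/idP => /set_mem /= h;
  apply/mem_set => /=; move: h; rewrite addrK.
Qed.

Lemma ge0_integral_torusN F : measurable_fun setT F -> lattice_periodic F ->
  (forall x, 0 <= F x) -> \int[dx]_x F (- x)%R = \int[dx]_x F x.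
Proof.
move=> mF pF F0; have mFa := measurableT_comp mF measurable_oppV.
rewrite ge0_integral_torusE// ge0_integral_torusE//.
have mc := @measurable_unit_cube R d.
have mP : measurable [set x : V | unit_cube (- x)%R].
  by rewrite -[X in measurable X]setTI; exact: measurable_oppV.
rewrite (@ge0_integral_fundamental unit_cube [set x | unit_cube (- x)%R] F)//;
  [|exact: fundamental_cube|exact/fundamentalN/fundamental_cube].
rewrite integral_mkcond [RHS]integral_mkcond.
rewrite -[RHS]ge0_integral_lebesgue_rVN; last 2 first.
- by apply/(measurable_restrictT _ _).1 => //; exact: measurable_funTS.
- by move=> x; rewrite patchE; case: ifP.
apply: eq_integral => x _; rewrite !patchE.
by congr (if _ then _ else _); apply/idP/idP => /set_mem /= h;
  apply/mem_set => /=; move: h; rewrite opprK.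
Qed.

Lemma integral_torusD (a : V) F : measurable_fun setT F -> lattice_periodic F ->
  \int[dx]_x F (x + a)%R = \int[dx]_x F x.
Proof.
move=> mF pF; rewrite integralE [RHS]integralE.
congr (_ - _).
  rewrite -(@ge0_integral_torusD a (F^\+))//; last 2 first.
  - exact: measurable_funepos.
  - by move=> n x; rewrite !funeposE pF.
  by apply: eq_integral => x _; rewrite ?funeposE ?funenegE.
rewrite -(@ge0_integral_torusD a (F^\-))//; last 2 first.
  - exact: measurable_funeneg.
  - by move=> n x; rewrite !funenegE pF.
  by apply: eq_integral => x _; rewrite ?funeposE ?funenegE.
Qed.

Lemma integral_torusN F : measurable_fun setT F -> lattice_periodic F ->
  \int[dx]_x F (- x)%R = \int[dx]_x F x.
Proof.
move=> mF pF; rewrite integralE [RHS]integralE.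
congr (_ - _).
  rewrite -(@ge0_integral_torusN (F^\+))//; last 2 first.
  - exact: measurable_funepos.
  - by move=> n x; rewrite !funeposE pF.
  by apply: eq_integral => x _; rewrite ?funeposE ?funenegE.
rewrite -(@ge0_integral_torusN (F^\-))//; last 2 first.
  - exact: measurable_funeneg.
  - by move=> n x; rewrite !funenegE pF.
  by apply: eq_integral => x _; rewrite ?funeposE ?funenegE.
Qed.

Lemma integral_torus_sub (a : V) F : measurable_fun setT F -> lattice_periodic F ->
  \int[dx]_x F (a - x)%R = \int[dx]_x F x.
Proof.
move=> mF pF; rewrite -(@integral_torusD a F)//.
have <- := @integral_torusN (fun x => F (x + a)%R).
- by apply: eq_integral => x _; rewrite addrC.
- exact: (measurableT_comp mF (measurable_shift a)).
- by move=> n x; rewrite addrAC pF.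
Qed.

End torus_integral.

Section density.
Context {disp} {T : measurableType disp} {R : realType}.
Variables (mu nu : {measure set T -> \bar R}) (f : T -> R).
Hypotheses (mf : measurable_fun setT f) (f0 : forall x, 0 <= f x).
Hypothesis nuE : forall A, measurable A -> nu A = (\int[mu]_(x in A) (f x)%:E)%E.
Local Open Scope ereal_scope.
Import HBNNSimple.

Lemma ge0_integral_density (F : T -> \bar R) : measurable_fun setT F ->
  (forall x, 0 <= F x) -> \int[nu]_x F x = \int[mu]_x (F x * (f x)%:E).
Proof.
move=> mF F0; pose g := nnsfun_approx measurableT mF.
have mEf : measurable_fun setT (EFin \o f) by exact/measurable_EFinP.
have Fg x : F x = limn (EFin \o g ^~ x).
  by apply/esym/cvg_lim => //; exact: cvg_nnsfun_approx.
transitivity (limn (fun n => \int[nu]_x (g n x)%:E)).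
  rewrite -monotone_convergence//; last 3 first.
  - by move=> n; exact/measurable_EFinP.
  - by move=> n x _; rewrite lee_fin.
  - by move=> x _ a b ab; rewrite lee_fin; exact/lefP/nd_nnsfun_approx.
  by apply: eq_integral => x _; rewrite Fg.
transitivity (limn (fun n => \int[mu]_x ((g n x)%:E * (f x)%:E))).
  congr (limn _); apply/funext => n.
  transitivity (\int[nu]_x (\sum_(r \in range (g n)) r * \1_(g n @^-1` [set r]) x)%:E).
    by apply: eq_integral => x _; rewrite fimfunE.
  under eq_integral do rewrite -fsumEFin//.
  rewrite ge0_integral_fsum//; last 2 first.
  - by move=> r; exact/measurable_EFinP/measurable_funM.
  - by move=> r x _; rewrite EFinM nnfun_muleindic_ge0.
  transitivity (\int[mu]_x (\sum_(r \in range (g n))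
      (r * \1_(g n @^-1` [set r]) x)%:E * (f x)%:E)); last first.
    apply: eq_integral => x _; rewrite -ge0_mule_fsuml//; last first.
      by move=> r; rewrite EFinM nnfun_muleindic_ge0.
    by rewrite [in RHS]fimfunE -fsumEFin.
  rewrite ge0_integral_fsum//; last 2 first.
  - move=> r; apply: emeasurable_funM => //.
    exact/measurable_EFinP/measurable_funM.
  - by move=> r x _; rewrite mule_ge0 ?lee_fin// -lee_fin EFinM nnfun_muleindic_ge0.
  apply: eq_fsbigr => r /set_mem [x0 _ rE].
  have r0 : (0 <= r)%R by rewrite -rE.
  under eq_integral do rewrite EFinM.
  rewrite ge0_integralZl_EFin//; last exact/measurable_EFinP.
  under [RHS]eq_integral do rewrite EFinM -muleA.
  rewrite ge0_integralZl_EFin//; last 2 first.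
  - by move=> x _; rewrite mule_ge0// lee_fin.
  - by apply: emeasurable_funM => //; exact/measurable_EFinP.
  congr (_ * _); rewrite integral_indic// setIT nuE//.
  rewrite integral_mkcond; apply: eq_integral => x _.
  by rewrite patchE indicE; case: (x \in _); rewrite ?mul1e ?mul0e.
rewrite -monotone_convergence//; last 3 first.
- by move=> n; apply: emeasurable_funM => //; exact/measurable_EFinP.
- by move=> n x _; rewrite mule_ge0// lee_fin.
- move=> x _ a b ab; apply: lee_wpmul2r; rewrite lee_fin//.
  exact/lefP/nd_nnsfun_approx.
apply: eq_integral => x _; apply/cvg_lim => //.
rewrite [X in _ --> X]muleC; under eq_fun do rewrite muleC.
by apply: cvgeZl => //; exact: cvg_nnsfun_approx.
Qed.

Lemma integral_density (F : T -> \bar R) : measurable_fun setT F ->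
  \int[nu]_x F x = \int[mu]_x (F x * (f x)%:E).
Proof.
move=> mF; rewrite integralE [RHS]integralE.
rewrite !ge0_integral_density//; [|exact: measurable_funeneg|exact: measurable_funepos].
congr (_ - _); apply: eq_integral => x _.
  by rewrite !funeposE -[in RHS](mul0e (f x)%:E) maxe_pMl// lee_fin.
by rewrite !funenegE -[in RHS](mul0e (f x)%:E) -mulNe maxe_pMl// lee_fin.
Qed.

End density.

(** * Derivatives along lines *)

Section continuous_operations.
Context {R : realType} {T : topologicalType}.
Implicit Types f g : T -> R.

Lemma contD f g : continuous f -> continuous g -> continuous (fun x => f x + g x).
Proof. by move=> cf cg x; exact: continuousD (cf x) (cg x). Qed.

Lemma contN f : continuous f -> continuous (fun x => - f x).
Proof. by move=> cf x; exact: continuousN (cf x). Qed.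

Lemma contB f g : continuous f -> continuous g -> continuous (fun x => f x - g x).
Proof. by move=> cf cg x; exact: continuousB (cf x) (cg x). Qed.

Lemma contM f g : continuous f -> continuous g -> continuous (fun x => f x * g x).
Proof. by move=> cf cg x; exact: continuousM (cf x) (cg x). Qed.

Lemma contZ (a : R) f : continuous f -> continuous (fun x => a * f x).
Proof. by move=> cf; apply: contM => // x; exact: cst_continuous. Qed.

Lemma cont_sum (I : Type) (r : seq I) (P : pred I) (f : I -> T -> R) :
  (forall i, P i -> continuous (f i)) ->
  continuous (fun x => \sum_(i <- r | P i) f i x).
Proof.
move=> cf; elim: r => [|i r IH].
  by under eq_fun do rewrite big_nil; move=> x; exact: cst_continuous.
under eq_fun do rewrite big_cons; case: (boolP (P i)) => // Pi.
exact: contD (cf _ Pi) IH.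
Qed.

End continuous_operations.

Section lines.
Context {R : realType} {W : normedModType R}.
Implicit Types (f : W -> R) (x v : W).

Lemma is_derive_line f x v (s : R) : derivable f (x + s *: v) v ->
  is_derive s 1 (fun r => f (x + r *: v)) ('D_v f (x + s *: v)).
Proof.
move=> df; have e : (fun h : R => h^-1 *: (((fun r => f (x + r *: v)) \o shift s) (h *: 1) -
      f (x + s *: v))) =
    (fun h : R => h^-1 *: ((f \o shift (x + s *: v)) (h *: v) - f (x + s *: v))).
  apply/funext => h /=; congr (_ *: (f _ - _)).
  by rewrite scalerDl [h%:A]mulr1 addrCA addrC -!addrA addrCA.
by split; rewrite /derivable /derive e.
Qed.

Lemma mean_value_line f x v : (forall s : R, derivable f (x + s *: v) v) ->
  exists2 s : R, s \in `]0, 1[ & f (x + v) - f x = 'D_v f (x + s *: v).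
Proof.
move=> df; have dl (s : R) : is_derive s 1 (fun r => f (x + r *: v)) ('D_v f (x + s *: v)).
  exact: is_derive_line.
have [|s s01] := @MVT R (fun r => f (x + r *: v)) _ 0 1 ltr01 (fun s _ => dl s).
  apply: derivable_within_continuous => s _; exact: ex_derive.
by rewrite scale1r scale0r addr0 subr0 mulr1 => ?; exists s.
Qed.

Lemma smooth_differentiable f x : smooth f -> differentiable f x.
Proof. by move=> /(_ [::]); exact. Qed.

Lemma smooth_derivable f x v : smooth f -> derivable f x v.
Proof. by move=> sf; exact/diff_derivable/smooth_differentiable. Qed.

Lemma smooth_continuous f : smooth f -> continuous f.
Proof. by move=> sf x; exact/differentiable_continuous/smooth_differentiable. Qed.

Lemma smooth_derive f v : smooth f -> smooth ('D_v f).
Proof. by move=> sf vs x; have := sf (rcons vs v) x; rewrite /iter_derive foldr_rcons. Qed.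

Lemma smooth_iter_derive f vs : smooth f -> smooth (iter_derive vs f).
Proof. by elim: vs => [//|v vs IH] sf; exact/smooth_derive/IH. Qed.

Lemma second_order_bound f x v (M : R) : smooth f ->
  (forall s : R, s \in `[0, 1] -> `|'D_v ('D_v f) (x + s *: v)| <= M) ->
  `|f (x + v) - f x - 'D_v f x| <= M.
Proof.
move=> sf hM; have [s s01 ->] := @mean_value_line f x v (fun s => @smooth_derivable f _ v sf).
have dl (r : R) : is_derive r 1 (fun r => 'D_v f (x + r *: v)) ('D_v ('D_v f) (x + r *: v)).
  exact/is_derive_line/smooth_derivable/smooth_derive.
move: (s01); rewrite in_itv/= => /andP[s0 s1].
have [|r rs] := @MVT R (fun r => 'D_v f (x + r *: v)) _ 0 s s0 (fun r _ => dl r).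
  apply: derivable_within_continuous => r _; exact: ex_derive.
rewrite scale0r addr0 subr0 => ->; rewrite normrM (gtr0_norm s0).
move: rs; rewrite in_itv/= => /andP[r0 rs].
rewrite -[leRHS]mulr1; apply: ler_pM => //; [exact: ltW| |exact: ltW].
apply: hM.
by rewrite in_itv/= ltW//= ltW// (lt_trans rs).
Qed.

(** Once a candidate linear part has been subtracted, this turns a quadratic Taylor
    remainder into differentiability. *)
Lemma differentiable_quadratic f x (C : R) :
  (\forall h \near (0 : W), `|f (x + h) - f x| <= C * `|h| ^+ 2) -> differentiable f x.
Proof.
move=> hf.
have dc : f \o shift x = cst (f x) + (\0 : {linear W -> R}) +o_ (0 : W) id.
  apply/eqaddoP => _/posnumP[e]; rewrite near_simpl.
  have C1 : 0 < `|C| + 1 by rewrite ltr_wpDl.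
  near=> h => /=.
  rewrite /= !fctE /= addr0 addrC.
  apply: (@le_trans _ _ (C * `|h| ^+ 2)); first by rewrite addrC (addrC h); near: h.
  rewrite expr2 mulrA ler_wpM2r//.
  apply: (@le_trans _ _ ((`|C| + 1) * `|h|)).
    by rewrite ler_wpM2r// (le_trans (ler_norm C))// lerDl.
  rewrite mulrC -ler_pdivlMr//.
have c0 : continuous (\0 : {linear W -> R}) by move=> ?; exact: cvg_cst.
have dE := diff_unique c0 dc.
by apply/diff_locallyP; split; rewrite dE.
Unshelve. all: by end_near. Qed.

End lines.

(** * Differentiation of parameter integrals *)

Section bounded_integrals.
Context {disp} {T : measurableType disp} {R : realType}.
Variable nu : {measure set T -> \bar R}.
Implicit Types (k F : T -> R).

Lemma integrableM_bounded k F (M : R) : nu.-integrable setT (EFin \o k) ->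
  measurable_fun setT F -> (forall z, `|F z| <= M) ->
  nu.-integrable setT (fun z => (k z * F z)%:E).
Proof.
move=> ik mF FM.
have mk : measurable_fun setT k by exact/measurable_EFinP/(measurable_int _ ik).
apply: (@le_integrable _ _ _ nu setT measurableT _ (fun z => M%:E * (k z)%:E)%E).
- exact/measurable_EFinP/measurable_funM.
- move=> z _ /=; rewrite lee_fin !normrM mulrC ler_wpM2r//.
  exact: le_trans (FM z) (ler_norm _).
- exact: integrableZl.
Qed.

Lemma normr_RintegralM_le k F (M : R) : nu.-integrable setT (EFin \o k) ->
  measurable_fun setT F -> (forall z, `|F z| <= M) ->
  `|\int[nu]_z (k z * F z)| <= M * \int[nu]_z `|k z|.
Proof.
move=> ik mF FM; have ikF := integrableM_bounded ik mF FM.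
have iak : nu.-integrable setT (EFin \o (fun z => `|k z|)) by exact: integrable_norm.
apply: le_trans (le_normr_Rintegral _ ikF) _ => //.
rewrite -RintegralZl//; apply: le_Rintegral => //.
- exact: (@integrable_norm _ _ _ nu setT (fun z => k z * F z) ikF).
- exact: (integrableZl measurableT M iak).
- by move=> z _; rewrite normrM mulrC ler_wpM2r.
Qed.

End bounded_integrals.

Section coordinates.
Context {R : realType}.

(** The Taylor argument below expands second derivatives in coordinates; this
    interface lets it serve space and space-time alike. *)
Record finite_coords (W : normedModType R) := FiniteCoords {
  fc_dim : nat;
  fc_vec : 'I_fc_dim -> W;
  fc_coord : 'I_fc_dim -> W -> R;
  fc_sum : forall w, w = \sum_i fc_coord i w *: fc_vec i;
  fc_le : forall i w, `|fc_coord i w| <= `|w|;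
  fc_add : forall i w w', fc_coord i (w + w') = fc_coord i w + fc_coord i w';
  fc_diff : forall i w, differentiable (fc_coord i) w }.

Lemma rV_coords_sum d (x : 'rV[R]_d) : x = \sum_i x ord0 i *: basis_vec i.
Proof. exact: row_sum_delta. Qed.

Lemma rV_coord_le d (x : 'rV[R]_d) i : `|x ord0 i| <= `|x|.
Proof.
rewrite [leRHS]/Num.norm/= mx_normrE; apply/bigmax_geP; right => /=.
by exists (ord0, i).
Qed.

Lemma rV_norm_le d (x : 'rV[R]_d) (r : R) : 0 <= r ->
  (forall i, `|x ord0 i| <= r) -> `|x| <= r.
Proof.
move=> r0 h; rewrite [leLHS]/Num.norm/= mx_normrE; apply/bigmax_leP; split => //.
by move=> [i j] _ /=; rewrite ord1.
Qed.

Definition rV_coords d : finite_coords 'rV[R]_d.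
Proof.
apply: (@FiniteCoords _ d (@basis_vec R d) (fun i x => x ord0 i)).
- exact: rV_coords_sum.
- by move=> i w; exact: rV_coord_le.
- by move=> i w w'; rewrite mxE.
- by move=> i w; exact: differentiable_coord.
Defined.

Definition time_coords d : finite_coords (R * 'rV[R]_d)%type.
Proof.
apply: (@FiniteCoords _ d.+1
  (fun i => oapp (fun j => (0 : R, @basis_vec R d j)) (1 : R, 0 : 'rV[R]_d) (unlift ord0 i))
  (fun i (z : R * 'rV[R]_d) => oapp (fun j => z.2 ord0 j) z.1 (unlift ord0 i))).
- move=> [t x] /=; rewrite big_ord_recl unlift_none /=.
  under eq_bigr do rewrite liftK /=.
  rewrite {1}(rV_coords_sum x); apply: injective_projections => /=.
    rewrite [t%:A]mulr1 (big_morph fst (id1 := 0) (op1 := +%R))//.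
    by rewrite big1 ?addr0// => i _ /=; rewrite scaler0.
  by rewrite scaler0 add0r (big_morph snd (id1 := 0) (op1 := +%R)).
- move=> i [t x]; rewrite prod_normE le_max.
  case: unliftP => [j|] _ /=; last by rewrite lexx.
  by rewrite rV_coord_le orbT.
- by move=> i w w'; case: unliftP => [j|] _ //=; rewrite mxE.
- move=> i w; case: unliftP => [j|] _ /=.
    apply: (@differentiable_comp _ _ _ _ snd (fun x : 'rV[R]_d => x ord0 j)).
      by apply: linear_differentiable => z; exact: cvg_snd.
    exact: differentiable_coord.
  by apply: linear_differentiable => z; exact: cvg_fst.
Defined.

End coordinates.
Arguments fc_dim {R W} _.
Arguments fc_vec {R W} _ _.
Arguments fc_coord {R W} _ _ _.
Arguments fc_sum {R W} _ _.
Arguments fc_le {R W} _ _ _.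
Arguments fc_add {R W} _ _ _ _.
Arguments fc_diff {R W} _ _ _.

Section param_integral.
Context {disp} {T : measurableType disp} {R : realType} {W : normedModType R}.
Variables (C : finite_coords W) (nu : {measure set T -> \bar R}) (k : T -> R).
Variable theta : T -> W.
Hypothesis ik : nu.-integrable setT (EFin \o k).
Hypothesis mtheta : forall f : W -> R, continuous f -> forall w,
  measurable_fun setT (fun z => f (w - theta z)).
Implicit Types (f : W -> R) (w v : W).

(** What differentiation under the integral requires of [f], at all orders. *)
Definition tame f := forall (vs : seq W) w, exists M : R,
  \forall w' \near w, forall z, `|iter_derive vs f (w' - theta z)| <= M.

(** With [theta] the identity this is a convolution, with [theta z = (0, z)] a
    convolution in space of a function of space-time, with [theta] the opposite a
    correlation. *)
Definition param_integral f w := \int[nu]_z (k z * f (w - theta z)).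

Lemma tame_derive f v : tame f -> tame ('D_v f).
Proof. by move=> tf vs w; have := tf (rcons vs v) w; rewrite /iter_derive foldr_rcons. Qed.

Lemma tame_bounded f w : tame f -> exists M : R, forall z, `|f (w - theta z)| <= M.
Proof. by move=> /(_ [::] w)[M /nbhs_singleton hM]; exists M. Qed.

Lemma param_integrable f w : tame f -> smooth f ->
  nu.-integrable setT (fun z => (k z * f (w - theta z))%:E).
Proof.
move=> tf /smooth_continuous cf; have [M hM] := tame_bounded w tf.
by apply: (integrableM_bounded ik _ hM); exact: mtheta.
Qed.

Lemma derive_coords f w v : smooth f ->
  'D_v f w = \sum_i fc_coord C i v * 'D_(fc_vec C i) f w.
Proof.
move=> sf; rewrite deriveE; last exact: smooth_differentiable.
rewrite {1}(fc_sum C v) linear_sum; apply: eq_bigr => i _.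
by rewrite linearZ/= deriveE//; exact: smooth_differentiable.
Qed.

Lemma derive2_coords f w v : smooth f -> 'D_v ('D_v f) w =
  \sum_i \sum_j fc_coord C i v * fc_coord C j v * 'D_(fc_vec C i) ('D_(fc_vec C j) f) w.
Proof.
move=> sf; rewrite derive_coords; last exact: smooth_derive.
apply: eq_bigr => i _.
have -> : 'D_v f = \sum_j (fun w => fc_coord C j v * 'D_(fc_vec C j) f w).
  by apply/funext => y; rewrite derive_coords// fct_sumE.
rewrite derive_sum; last first.
  by move=> j; apply: derivableM => //; exact/smooth_derivable/smooth_derive.
rewrite mulr_sumr; apply: eq_bigr => j _.
rewrite -mulrA; congr (_ * _).
rewrite (_ : (fun _ => _) = fc_coord C j v \*: 'D_(fc_vec C j) f)//.
by rewrite deriveZ//; exact/smooth_derivable/smooth_derive.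
Qed.

(** The Taylor remainder of [f] is quadratic uniformly in the parameter, hence so
    is that of the integral. *)
Lemma param_integral_taylor f w : tame f -> smooth f -> exists M : R,
  \forall h \near (0 : W),
  `|param_integral f (w + h) - param_integral f w - param_integral ('D_h f) w|
    <= M * `|h| ^+ 2.
Proof.
move=> tf sf; pose n := fc_dim C.
have /choice[M0 hM0] (p : 'I_n * 'I_n) : exists M : R, \forall w' \near w, forall z,
    `|'D_(fc_vec C p.1) ('D_(fc_vec C p.2) f) (w' - theta z)| <= M.
  exact: (tf [:: fc_vec C p.1; fc_vec C p.2] w).
have hM : \forall w' \near w, forall p z,
    `|'D_(fc_vec C p.1) ('D_(fc_vec C p.2) f) (w' - theta z)| <= M0 p.
  exact: filter_forall.
pose M := \sum_i \sum_j M0 (i, j).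
have /nbhs_ballP[e /= e0 he] := hM.
exists (M * \int[nu]_z `|k z|).
near=> h.
have hh : `|h| < e.
  by near: h; apply/nbhs0_lt.
have bnd z : `|f (w + h - theta z) - f (w - theta z) - 'D_h f (w - theta z)| <=
    M * `|h| ^+ 2.
  rewrite (_ : w + h - theta z = w - theta z + h); last by rewrite addrAC.
  apply: second_order_bound => // s; rewrite in_itv/= => /andP[s0 s1].
  rewrite derive2_coords// /M mulr_suml.
  apply: le_trans (ler_norm_sum _ _ _) _; apply: ler_sum => i _.
  rewrite mulr_suml.
  apply: le_trans (ler_norm_sum _ _ _) _; apply: ler_sum => j _.
  rewrite normrM mulrC; apply: ler_pM => //.
    rewrite addrAC; apply: (he _ _ (i, j)) => //.
    rewrite -ball_normE /ball_/= opprD addNKr normrN normrZ ger0_norm//.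
    by apply: le_lt_trans hh; rewrite -[leRHS]mul1r ler_wpM2r.
  by rewrite normrM expr2 ler_pM// fc_le.
have td := tame_derive h tf; have sd := smooth_derive h sf.
have i1 := param_integrable (w + h) tf sf.
have i2 := param_integrable w tf sf.
have i3 := param_integrable w td sd.
have iB := integrableB measurableT i1 i2.
rewrite /param_integral -RintegralB// -RintegralB//.
rewrite (_ : (fun z => _) = (fun z => k z *
   (f (w + h - theta z) - f (w - theta z) - 'D_h f (w - theta z)))); last first.
  by apply/funext => z; rewrite !mulrBr.
rewrite mulrAC; apply: (@normr_RintegralM_le _ _ _ nu k (fun z =>
  f (w + h - theta z) - f (w - theta z) - 'D_h f (w - theta z))) => //.
have mt g u : smooth g -> measurable_fun setT (fun z => g (u - theta z)).
  by move=> /smooth_continuous/mtheta.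
exact: (measurable_funB (measurable_funB (mt _ (w + h) sf) (mt _ w sf)) (mt _ w sd)).
Unshelve. all: by end_near. Qed.

Lemma param_integral_derive_sum f w v : tame f -> smooth f ->
  param_integral ('D_v f) w =
  \sum_i fc_coord C i v * param_integral ('D_(fc_vec C i) f) w.
Proof.
move=> tf sf; rewrite /param_integral.
have ii i : nu.-integrable setT (fun z =>
    (k z * 'D_(fc_vec C i) f (w - theta z))%:E).
  exact: (param_integrable w (tame_derive _ tf) (smooth_derive _ sf)).
transitivity (\int[nu]_z \sum_i (fc_coord C i v * (k z * 'D_(fc_vec C i) f (w - theta z)))).
  apply: eq_Rintegral => z _; rewrite derive_coords// mulr_sumr.
  by apply: eq_bigr => i _; rewrite mulrCA.
rewrite /Rintegral; under eq_integral do rewrite -sumEFin.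
rewrite integral_sum//; last by move=> i; exact: (integrableZl measurableT (fc_coord C i v) (ii i)).
rewrite -sum_fine; last first.
  by move=> i _; apply: integrable_fin_num => //; exact: (integrableZl measurableT (fc_coord C i v) (ii i)).
by apply: eq_bigr => i _; exact: (RintegralZl (fc_coord C i v) measurableT (ii i)).
Qed.

Lemma param_integral_differentiable f w : tame f -> smooth f ->
  differentiable (param_integral f) w.
Proof.
move=> tf sf; have [M hM] := param_integral_taylor w tf sf.
pose p w' := \sum_i fc_coord C i w' * param_integral ('D_(fc_vec C i) f) w.
have dp : differentiable p w.
  rewrite (_ : p = \sum_i (fun w' => fc_coord C i w' *
      param_integral ('D_(fc_vec C i) f) w)); last first.
    by apply/funext => y; rewrite fct_sumE.
  apply: differentiable_sum => i.
  by apply: differentiableM => //; exact: fc_diff.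
rewrite (_ : param_integral f = (param_integral f - p) + p); last by rewrite subrK.
apply: differentiableD => //.
apply: (@differentiable_quadratic _ _ _ _ M).
apply: filterS hM => h; congr (_ <= _); congr (`|_|).
rewrite !fctE (param_integral_derive_sum _ h tf sf).
have -> : p (w + h) = p w + \sum_i fc_coord C i h * param_integral ('D_(fc_vec C i) f) w.
  by rewrite /p -big_split/=; apply: eq_bigr => i _; rewrite fc_add mulrDl.
by ring.
Qed.

Lemma param_integral_derive f w v : tame f -> smooth f ->
  'D_v (param_integral f) w = param_integral ('D_v f) w.
Proof.
move=> tf sf; have [M hM] := param_integral_taylor w tf sf.
have linI (s : R) : param_integral ('D_(s *: v) f) w = s * param_integral ('D_v f) w.
  rewrite /param_integral -RintegralZl//; last first.
    exact: (param_integrable w (tame_derive _ tf) (smooth_derive _ sf)).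
  apply: eq_Rintegral => z _; rewrite !deriveE ?linearZ/=; first by rewrite mulrCA.
    exact: smooth_differentiable.
  exact: smooth_differentiable.
have hs : \forall s \near (0 : R), `|param_integral f (w + s *: v) -
    param_integral f w - s * param_integral ('D_v f) w| <= M * `|s *: v| ^+ 2.
  have c0 : (s *: v @[s --> (0 : R)] --> (0 : W)).
    by rewrite -[X in _ --> X](scale0r v); exact: scalel_continuous.
  have := c0 _ hM; rewrite nbhs_simpl/=; apply: filterS => s /=.
  by rewrite linI.
apply/cvg_lim => //; apply/cvgrPdist_le => e e0.
have M1 : 0 < `|M| * `|v| ^+ 2 + 1 by rewrite ltr_wpDl.
near=> s.
have s0 : s != 0 by near: s; exact: nbhs_dnbhs_neq.
have hb : `|param_integral f (w + s *: v) -
    param_integral f w - s * param_integral ('D_v f) w| <= M * `|s *: v| ^+ 2.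
  by near: s; exact: nbhs_dnbhs.
rewrite /= distrC [s *: v + w]addrC.
rewrite (_ : _ - _ = s^-1 * (param_integral f (w + s *: v) -
    param_integral f w - s * param_integral ('D_v f) w)); last first.
  by rewrite mulrBr mulKf.
rewrite normrM normfV ler_pdivrMl ?normr_gt0//; apply: (le_trans hb).
rewrite normrZ (_ : M * _ = `|s| * (M * `|v| ^+ 2 * `|s|)); last by ring.
rewrite ler_wpM2l//.
apply: (@le_trans _ _ ((`|M| * `|v| ^+ 2 + 1) * `|s|)).
  rewrite ler_wpM2r// (@le_trans _ _ (`|M| * `|v| ^+ 2)) ?lerDl//.
  by rewrite ler_wpM2r ?exprn_ge0// ler_norm.
rewrite mulrC -ler_pdivlMr//.
near: s; apply: dnbhs0_le; exact: divr_gt0.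
Unshelve. all: by end_near. Qed.

Lemma param_integral_iter_derive f vs : tame f -> smooth f ->
  iter_derive vs (param_integral f) = param_integral (iter_derive vs f).
Proof.
move=> tf sf; elim: vs => [//|v vs IH] /=; rewrite IH; apply/funext => w.
rewrite param_integral_derive//; last exact: smooth_iter_derive.
by move=> vs' w'; have := tf (vs' ++ vs) w'; rewrite /iter_derive foldr_cat.
Qed.

Lemma smooth_param_integral f : tame f -> smooth f -> smooth (param_integral f).
Proof.
move=> tf sf vs w; rewrite param_integral_iter_derive//.
apply: param_integral_differentiable; last exact: smooth_iter_derive.
by move=> vs' w'; have := tf (vs' ++ vs) w'; rewrite /iter_derive foldr_cat.
Qed.

End param_integral.

(** * An interior gradient estimate *)

Section one_dim.
Context {R : realType}.
Implicit Types (F G : R -> R).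

Lemma derive_gt0_right G (x L : R) : is_derive x 1 G L -> 0 < L ->
  exists2 e : R, 0 < e & forall s, 0 < s -> s < e -> G x < G (x + s).
Proof.
move=> [dG GL] L0; move: dG; rewrite /derivable => /cvg_ex[l hl].
have lE : l = L by rewrite -GL; apply/esym/cvg_lim.
have : \forall h \near 0^', 0 < h^-1 *: ((G \o shift x) (h *: 1) - G x).
  by apply: (cvgr_gt l) => //; rewrite lE.
move=> [e /= e0 he]; exists e => // s s0 se.
have := he s; rewrite /= sub0r normrN gtr0_norm// => /(_ se (lt0r_neq0 s0)).
by rewrite [s%:A]mulr1 pmulr_rgt0 ?invr_gt0// subr_gt0 addrC.
Qed.

Lemma second_derive_at_max F G (L e : R) : 0 < e ->
  (forall s : R, is_derive s 1 F (G s)) -> is_derive (0 : R) 1 G L ->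
  (forall s : R, `|s| < e -> F s <= F 0) -> L <= 0.
Proof.
move=> e0 dF dG hmax; rewrite leNgt; apply/negP => L0.
have G0 : G 0 = 0.
  have h : is_derive (0 : R) (1 : R) F 0.
    apply: (@derive1_at_max _ F (- e) e 0).
    - lra.
    - by move=> t _; exact: ex_derive.
    - by rewrite in_itv/= oppr_lt0 e0.
    - by move=> t; rewrite in_itv/= -ltr_norml => /hmax.
  by rewrite -(@derive_val _ _ _ _ _ _ _ (dF 0)) (@derive_val _ _ _ _ _ _ _ h).
have [r r0 hr] := derive_gt0_right dG L0.
pose s := Num.min r e / 2.
have m0 : 0 < Num.min r e by rewrite lt_min r0.
have s0 : 0 < s by rewrite divr_gt0.
have sm : s < Num.min r e by rewrite /s; lra.
move: sm; rewrite lt_min => /andP[sr se].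
have [|c] := @MVT R F G 0 s s0 (fun s _ => dF s).
  by apply: derivable_within_continuous => t _; exact: ex_derive.
rewrite in_itv/= => /andP[c0 cs] FE.
have Gc : 0 < G c by rewrite -G0 -[c]add0r; apply: hr => //; exact: lt_trans sr.
have Fs : F s <= F 0 by apply: hmax; rewrite gtr0_norm.
have : 0 < F s - F 0 by rewrite FE subr0 mulr_gt0.
by rewrite subr_gt0 ltNge Fs.
Qed.

Lemma quadratic_is_derive (al be ka s : R) :
  is_derive s 1 (fun r : R => al + be * r + ka * (r * r)) (be + 2 * ka * s).
Proof.
apply: is_derive_eq; rewrite /GRing.scale/=; ring.
Qed.

Lemma affine_is_derive (al be s : R) : is_derive s 1 (fun r : R => al + be * r) be.
Proof. by apply: is_derive_eq; rewrite /GRing.scale/=; ring. Qed.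

Lemma laplacian_contradiction (N A B : R) : `|A| < N -> `|B| < N ->
  2^-1 * (A - B) - 2 * - (N / 2) <= 0 -> False.
Proof. by rewrite !ltr_norml => /andP[h1 h2] /andP[h3 h4] h; lra. Qed.

End one_dim.

Section gradient_estimate.
Context {R : realType} {d : nat}.
Local Notation V := 'rV[R]_d.

Definition sup_ball (c : V) (a : R) : set V := [set x | forall j, `|x ord0 j - c ord0 j| <= a].

Lemma smooth_line_derive (U : V -> R) i x (s : R) : smooth U ->
  is_derive s 1 (fun r : R => U (x + r *: basis_vec i)) (pderiv i U (x + s *: basis_vec i)).
Proof. by move=> sU; exact/is_derive_line/smooth_derivable. Qed.

Lemma smooth_scaled_line_derive (U : V -> R) i e x (s : R) : smooth U ->
  is_derive s 1 (fun r : R => U (x + r *: (e *: basis_vec i)))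
    (e * pderiv i U (x + s *: (e *: basis_vec i))).
Proof.
move=> sU; have := is_derive_line (@smooth_derivable _ _ U (x + s *: (e *: basis_vec i)) (e *: basis_vec i) sU).
by rewrite deriveE ?linearZ -?deriveE//; exact: smooth_differentiable.
Qed.

Lemma continuous_coordB (c : V) j : continuous (fun x : V => x ord0 j - c ord0 j).
Proof.
by move=> x; exact: (continuousB (@coord_continuous R 1 d ord0 j x) (@cst_continuous _ _ (c ord0 j) _)).
Qed.

Section comparison.
Variables (U : V -> R) (c : V) (a M N : R) (i : 'I_d).
Hypotheses (sU : smooth U) (a0 : 0 < a).
Hypothesis UM : forall x, sup_ball c a x -> `|U x| <= M.
Hypothesis UN : forall x, sup_ball c a x -> `|laplacian U x| < N.

Let y (x : V) := x ord0 i - c ord0 i.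
Let mirror (x : V) : V := x - (2 * y x) *: basis_vec i.
(** Nonnegative on the half cube [0 <= y], at least [M] where a coordinate reaches
    [a] in absolute value, and of constant Laplacian [- N]: the contributions of the
    two terms in [M] cancel.  Its slope at [c] is the bound to be proved. *)
Let barrier (x : V) : R := M / a ^+ 2 *
  (\sum_j (x ord0 j - c ord0 j) ^+ 2 + d%:R * (y x * (a - y x)))
  + N / 2 * (y x * (a - y x)).
Let w x := 2^-1 * (U x - U (mirror x)) - barrier x.
Let box : set V := [set x | sup_ball c a x /\ 0 <= y x].

Let mirror_coord x j : mirror x ord0 j - c ord0 j =
  (if j == i then -1 else 1) * (x ord0 j - c ord0 j).
Proof.
by rewrite /mirror !mxE eqxx/= /y; case: eqP => [->|_] /=; ring.
Qed.

Let sup_ball_mirror x : sup_ball c a x -> sup_ball c a (mirror x).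
Proof.
move=> h j; rewrite mirror_coord normrM.
by case: ifP => _; rewrite ?normrN normr1 mul1r.
Qed.

Let M0 : 0 <= M.
Proof.
apply: le_trans (UM (x := c) _) => // j.
by rewrite subrr normr0 ltW.
Qed.

Let N0 : 0 <= N.
Proof.
apply: le_trans (ltW (UN (x := c) _)) => // j.
by rewrite subrr normr0 ltW.
Qed.

Let y_le x : sup_ball c a x -> `|y x| <= a. Proof. exact. Qed.

Let barrier_step x j s : barrier (x + s *: basis_vec j) =
  barrier x + (M / a ^+ 2 * (2 * (x ord0 j - c ord0 j) + (if j == i then d%:R * (a - 2 * y x) else 0))
               + (if j == i then N / 2 * (a - 2 * y x) else 0)) * s
  + (M / a ^+ 2 * (1 - (if j == i then d%:R else 0)) - (if j == i then N / 2 else 0)) * (s * s).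
Proof.
have yE : y (x + s *: basis_vec j) = y x + (if j == i then s else 0).
  by rewrite /y !mxE eqxx/= eq_sym; case: eqP => _ /=; ring.
have sE : \sum_k ((x + s *: basis_vec j) ord0 k - c ord0 k) ^+ 2 =
    \sum_k (x ord0 k - c ord0 k) ^+ 2 + 2 * (x ord0 j - c ord0 j) * s + s * s.
  rewrite (bigD1 j)//= [in RHS](bigD1 j)//= !mxE !eqxx/=.
  rewrite (eq_bigr (fun k => (x ord0 k - c ord0 k) ^+ 2)); last first.
    by move=> k kj; rewrite !mxE eqxx/= (negbTE kj) mulr0 addr0.
  by ring.
rewrite /barrier sE yE; case: (j == i); ring.
Qed.

Let box_compact : compact box.
Proof.
apply: bounded_closed_compact.
  exists (`|c| + a); split; first by rewrite num_real.
  move=> r hr x [hx _]; apply: rV_norm_le.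
    by apply: ltW; apply: le_lt_trans hr; rewrite addr_ge0// ltW.
  move=> j; rewrite -[x ord0 j](subrK (c ord0 j)); apply: le_trans (ler_normD _ _) _.
  by apply: ltW; apply: le_lt_trans hr; rewrite addrC lerD// ?hx// rV_coord_le.
have cy := @continuous_coordB c.
rewrite (_ : box = \bigcap_(j in [set: 'I_d])
    ((fun x : V => x ord0 j - c ord0 j) @^-1` `[- a, a]%classic)
    `&` ((fun x : V => x ord0 i - c ord0 i) @^-1` `[0, +oo[%classic)); last first.
  rewrite predeqE => x; split=> [[h1 h2]|[h1 h2]]; split.
  - by move=> j _ /=; rewrite in_itv/= -ler_norml h1.
  - by rewrite /= in_itv/= h2.
  - by move=> j; have := h1 j I; rewrite /= in_itv/= -ler_norml.
  - by move: h2; rewrite /= in_itv/= andbT.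
apply: closedI; last by apply: closed_comp => [x _|]; [exact: cy|exact: interval_closed].
apply: closed_bigI => j _.
by apply: closed_comp => [x _|]; [exact: cy|exact: interval_closed].
Qed.

Let w_continuous : continuous w.
Proof.
have cU := smooth_continuous sU.
have cy := @continuous_coordB c.
have cm : continuous mirror.
  move=> x; apply: (@continuousB _ _ _ id (fun x => (2 * y x) *: basis_vec i)).
    exact: cvg_id.
  by apply: continuousZr_tmp; exact: contZ (cy i) x.
have cyy : continuous (fun x => y x * (a - y x)).
  by apply: contM; [exact: cy|apply: contB; [move=> ?; exact: cst_continuous|exact: cy]].
have cs : continuous (fun x : V => \sum_j (x ord0 j - c ord0 j) ^+ 2).
  by apply: cont_sum => j _; exact: contM (cy j) (cy j).
apply: contB.
  apply: contZ; apply: contB => // x.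
  by apply: continuous_comp; [exact: cm|exact: cU].
apply: contD; last exact: contZ.
by apply: contZ; apply: contD => //; exact: contZ.
Qed.

Let w_le0_boundary x : box x -> (y x = 0 \/ exists j, `|x ord0 j - c ord0 j| = a) ->
  w x <= 0.
Proof.
move=> [hx y0] hb; have ya : y x <= a by have := y_le hx; rewrite ger0_norm.
have yy0 : 0 <= y x * (a - y x) by rewrite mulr_ge0// subr_ge0.
have s0 : 0 <= \sum_j (x ord0 j - c ord0 j) ^+ 2 by rewrite sumr_ge0// => j _; rewrite sqr_ge0.
have Ma : 0 <= M / a ^+ 2 by rewrite divr_ge0// exprn_ge0// ltW.
have N2 : 0 <= N / 2 by rewrite divr_ge0.
have b0 : 0 <= N / 2 * (y x * (a - y x)) by rewrite mulr_ge0.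
have dn : 0 <= d%:R * (y x * (a - y x)) by rewrite mulr_ge0.
case: hb => [yx|[j hj]].
  have -> : w x = - barrier x.
    by rewrite /w /mirror yx mulr0 scale0r subr0 subrr mulr0 sub0r.
  by rewrite oppr_le0 /barrier addr_ge0// mulr_ge0// addr_ge0.
have hU : 2^-1 * (U x - U (mirror x)) <= M.
  have := UM hx; have := UM (sup_ball_mirror hx).
  by rewrite !ler_norml => /andP[h1 h2] /andP[h3 h4]; lra.
rewrite /w subr_le0; apply: (le_trans hU).
rewrite /barrier -[leLHS]addr0; apply: lerD => //.
rewrite -[leLHS](@divfK _ (a ^+ 2)); last by rewrite expf_neq0// gt_eqF.
rewrite ler_wpM2l// -[leLHS]addr0; apply: lerD => //.
rewrite (bigD1 j)//= -[leLHS]addr0; apply: lerD.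
  by rewrite -[leRHS]real_normK ?num_real// hj.
by rewrite sumr_ge0// => k _; rewrite sqr_ge0.
Qed.

Let w_interior x : box x -> 0 < y x -> (forall j, `|x ord0 j - c ord0 j| < a) ->
  (forall x', box x' -> w x' <= w x) -> False.
Proof.
move=> [hx y0] yp xin xmax.
pose Y j := x ord0 j - c ord0 j.
pose ka j := M / a ^+ 2 * (1 - (if j == i then d%:R else 0)) - (if j == i then N / 2 else 0).
have second j : 2^-1 * (pderiv j (pderiv j U) x - pderiv j (pderiv j U) (mirror x)) -
    2 * ka j <= 0.
  pose b := @basis_vec R d j; pose e : R := if j == i then -1 else 1.
  have ee : e * e = 1 by rewrite /e; case: ifP => _; ring.
  pose be := M / a ^+ 2 * (2 * Y j + (if j == i then d%:R * (a - 2 * y x) else 0))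
    + (if j == i then N / 2 * (a - 2 * y x) else 0).
  pose F s := 2^-1 * (U (x + s *: b) - U (mirror x + s *: (e *: b))) -
    (barrier x + be * s + ka j * (s * s)).
  pose G s := 2^-1 * (pderiv j U (x + s *: b) - e * pderiv j U (mirror x + s *: (e *: b)))
    - (be + 2 * ka j * s).
  have wF s : w (x + s *: b) = F s.
    rewrite /w /F barrier_step; congr (_ * (_ - U _) - _).
    apply/rowP => k; have := mirror_coord (x + s *: b) k; have := mirror_coord x k.
    rewrite !mxE eqxx/= /b /basis_vec /e [k == j]eq_sym; case: (eqVneq j k) => [<-|_] /=.
      by case: ifP => _; lra.
    by case: ifP => _; lra.
  have dF (s : R) : is_derive s 1 F (G s).
    have dA := @smooth_line_derive U j x s sU.
    have dB := @smooth_scaled_line_derive U j e (mirror x) s sU.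
    have dQ := @quadratic_is_derive R (barrier x) be (ka j) s.
    exact: (is_deriveB (is_deriveZ (2^-1) (is_deriveB dA dB)) dQ).
  have dG : is_derive (0 : R) 1 G (2^-1 * (pderiv j (pderiv j U) x -
      pderiv j (pderiv j U) (mirror x)) - 2 * ka j).
    have sdU : smooth (pderiv j U) by exact: smooth_derive.
    have dA := @smooth_line_derive (pderiv j U) j x 0 sdU.
    have dB := @smooth_scaled_line_derive (pderiv j U) j e (mirror x) 0 sdU.
    have dQ := @affine_is_derive R be (2 * ka j) 0.
    have := is_deriveB (is_deriveZ (2^-1) (is_deriveB dA (is_deriveZ e dB))) dQ.
    by rewrite !scale0r !addr0 /GRing.scale/= mulrA ee mul1r.
  have e0 : 0 < Num.min (a - `|Y j|) (y x) by rewrite lt_min yp subr_gt0 xin.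
  apply: (second_derive_at_max e0 dF dG) => s; rewrite lt_min => /andP[s1 s2].
  rewrite -!wF scale0r addr0; apply: xmax; split.
    move=> k; rewrite !mxE eqxx/=; case: (eqVneq k j) => [->|_] /=.
      rewrite mulr1 addrAC; apply: le_trans (ler_normD _ _) _.
      by rewrite -/(Y j); lra.
    by rewrite mulr0 addr0; exact: hx.
  rewrite /y !mxE eqxx/=; case: (eqVneq i j) => [_|_] /=; last by rewrite mulr0 addr0.
  move: s2; rewrite ltr_norml => /andP[s2 s3].
  by rewrite mulr1 addrAC -/(y x); lra.
have : \sum_j (2^-1 * (pderiv j (pderiv j U) x - pderiv j (pderiv j U) (mirror x)) -
    2 * ka j) <= 0.
  by rewrite sumr_le0.
rewrite sumrB -mulr_sumr sumrB -mulr_sumr.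
have -> : \sum_j ka j = - (N / 2).
  rewrite /ka sumrB -mulr_sumr sumrB -!big_mkcond !big_pred1_eq sumr_const card_ord.
  by ring.
exact: (laplacian_contradiction (UN hx) (UN (sup_ball_mirror hx))).
Qed.

Let w_le0 x : box x -> w x <= 0.
Proof.
move=> bx.
have box0 : box !=set0 by exists x.
have [p pbox pmax] := EVT_max_rV box0 box_compact (continuous_subspaceT w_continuous).
move: pbox => /set_mem pbox.
apply: (@le_trans _ _ (w p)); first by apply: pmax; exact/mem_set.
have pmax' x' : box x' -> w x' <= w p by move=> bx'; apply: pmax; exact/mem_set.
have [y0|y0] := eqVneq (y p) 0; first by apply: w_le0_boundary => //; left.
have [[j hj]|hn] := pselect (exists j, `|p ord0 j - c ord0 j| = a).
  by apply: w_le0_boundary => //; right; exists j.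
have yp : 0 < y p by rewrite lt_def y0 pbox.2.
case: (@w_interior p) => // j; rewrite lt_neqAle pbox.1 andbT.
by apply/eqP => h; apply: hn; exists j.
Qed.

Lemma pderiv_le_comparison : pderiv i U c <= d%:R * M / a + N * a / 2.
Proof.
rewrite leNgt; apply/negP => hlt.
pose b := @basis_vec R d i.
pose H (s : R) := 2^-1 * (U (c + s *: b) - U (c + s *: ((-1) *: b))) -
  (0 + (d%:R * M / a + N * a / 2) * s + (M / a ^+ 2 * (1 - d%:R) - N / 2) * (s * s)).
have wH s : w (c + s *: b) = H s.
  rewrite /w /H barrier_step eqxx; congr (_ * (_ - U _) - _).
    apply/rowP => k; have := mirror_coord (c + s *: b) k.
    by rewrite !mxE eqxx/= /b /basis_vec; case: (eqVneq k i) => [->|_] /=; lra.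
  have -> : barrier c = 0.
    rewrite /barrier /y subrr mul0r !mulr0 addr0 addr0 big1 ?mulr0// => k _.
    by rewrite subrr expr0n.
  by rewrite /y subrr; field; rewrite gt_eqF.
have dH : is_derive (0 : R) 1 H (pderiv i U c - (d%:R * M / a + N * a / 2)).
  have dA := @smooth_line_derive U i c 0 sU.
  have dB := @smooth_scaled_line_derive U i (-1) c 0 sU.
  have dQ := @quadratic_is_derive R 0 (d%:R * M / a + N * a / 2) (M / a ^+ 2 * (1 - d%:R) - N / 2) 0.
  have := is_deriveB (is_deriveZ (2^-1) (is_deriveB dA dB)) dQ.
  rewrite !scale0r !addr0 /GRing.scale/= mulr0 addr0.
  by rewrite (_ : 2^-1 * _ = pderiv i U c)//; lra.
have [|e e0 he] := derive_gt0_right dH; first by rewrite subr_gt0.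
pose s := Num.min e a / 2.
have m0 : 0 < Num.min e a by rewrite lt_min e0.
have s0 : 0 < s by rewrite divr_gt0.
have sm : s < Num.min e a by rewrite /s; lra.
move: sm; rewrite lt_min => /andP[se sa].
have := he s s0 se; rewrite add0r -wH -wH scale0r addr0.
have -> : w c = 0.
  have := wH 0; rewrite scale0r addr0 => ->; rewrite /H !scale0r subrr.
  by rewrite !mulr0 !addr0 subrr.
apply/negP; rewrite -leNgt; apply: w_le0; split.
  move=> k; rewrite !mxE eqxx/= [c _ _ + _]addrC addrK normrM gtr0_norm//.
  by case: (k == i); rewrite /= ?normr1 ?normr0 ?mulr1 ?mulr0 ltW.
by rewrite /y !mxE !eqxx/= mulr1 [c _ _ + _]addrC addrK ltW.
Qed.

End comparison.

Lemma pderivN (U : V -> R) j x : smooth U -> pderiv j (fun z => - U z) x = - pderiv j U x.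
Proof. by move=> sU; rewrite /pderiv (_ : (fun z => - U z) = - U)// deriveN//; exact: smooth_derivable. Qed.

Lemma smoothN (U : V -> R) : smooth U -> smooth (fun x => - U x).
Proof.
move=> sU; have e vs : iter_derive vs (fun x => - U x) = (fun x => - iter_derive vs U x).
  elim: vs => [//|v vs IH] /=; rewrite IH; apply/funext => x.
  rewrite (_ : (fun z => - iter_derive vs U z) = - iter_derive vs U)// deriveN//.
  exact/smooth_derivable/smooth_iter_derive.
by move=> vs x; rewrite e; apply: differentiableN; exact: sU.
Qed.

(** Interior gradient bound: compare the odd part of [U] under reflection of the
    [i]-th coordinate with an explicit quadratic barrier on a half cube.  The
    maximum principle is the only ingredient. *)
Lemma gradient_estimate (U : V -> R) (c : V) (a M N : R) i : smooth U -> 0 < a ->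
  (forall x, sup_ball c a x -> `|U x| <= M) ->
  (forall x, sup_ball c a x -> `|laplacian U x| <= N) ->
  `|pderiv i U c| <= d%:R * M / a + N * a / 2.
Proof.
move=> sU a0 UM UN; apply/ler_addgt0Pr => e e0.
(* The comparison requires a strict bound on the Laplacian. *)
pose N' := N + 2 * e / a.
have NN x : sup_ball c a x -> `|laplacian U x| < N'.
  move=> /UN h; apply: (le_lt_trans h); rewrite ltrDl.
  by rewrite divr_gt0// mulr_gt0.
have -> : d%:R * M / a + N * a / 2 + e = d%:R * M / a + N' * a / 2.
  by rewrite /N'; field; rewrite gt_eqF.
rewrite ler_norml; apply/andP; split; last exact: pderiv_le_comparison.
rewrite lerNl; have <- := @pderivN U i c sU.
apply: (@pderiv_le_comparison _ c a M N' i (smoothN sU) a0) => x.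
  by move=> /UM; rewrite normrN.
move=> /NN; have -> // : laplacian (fun z => - U z) x = - laplacian U x.
  rewrite /laplacian -sumrN; apply: eq_bigr => j _.
  rewrite (_ : pderiv j (fun z => - U z) = fun z => - pderiv j U z).
    by rewrite pderivN//; exact: smooth_derive.
  by apply/funext => z; rewrite pderivN.
by rewrite normrN.
Qed.

End gradient_estimate.

(** * Continuous periodic functions *)

Section periodic_functions.
Context {R : realType} {d : nat}.
Local Notation V := 'rV[R]_d.
Local Notation dx := (lebesgue_torus R d).
Implicit Types (f h : V -> R).

Lemma continuous_measurable_rV f : continuous f -> measurable_fun setT f.
Proof.
move=> /continuousP cf.
apply: (measurability _ (measurable_realfun.RGenOpens.measurableE R)).
move=> _ [_ [a [b ->]] <-]; rewrite setTI.
by apply: sub_sigma_algebra; apply: cf; exact: interval_open.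
Qed.

Definition closed_cube : set V := [set x | forall i, x ord0 i \in `[- 2^-1, 2^-1]].

Lemma compact_closed_cube : compact closed_cube.
Proof. by exact: (@rV_compact R d (fun=> `[- 2^-1, 2^-1]%classic) (fun=> @segment_compact R _ _)). Qed.

Lemma sub_closed_cube : unit_cube `<=` closed_cube.
Proof.
move=> x hx i; have := hx i; rewrite !in_itv/= => /andP[-> h] /=; exact: ltW.
Qed.

Lemma lattice_translate (x : V) : exists n, unit_cube (x + lattice n).
Proof. exact: (fundamental_cube.1 x). Qed.

Lemma periodic_time_bounded (phi : R * V -> R) (a b : R) : continuous phi ->
  (forall t, lattice_periodic (fun x => phi (t, x))) ->
  exists M : R, forall t x, t \in `[a, b] -> `|phi (t, x)| <= M.
Proof.
move=> cphi pphi.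
have cK : compact (`[a, b]%classic `*` closed_cube).
  by apply: compact_setX; [exact: segment_compact|exact: compact_closed_cube].
have /compact_bounded[M [Mr hM]] : compact (phi @` (`[a, b]%classic `*` closed_cube)).
  by apply: continuous_compact => //; exact: continuous_subspaceT.
exists (M + 1) => t x tab.
have [n hn] := lattice_translate x; rewrite -(pphi t n).
apply: (hM (M + 1)); first by rewrite ltrDl.
by exists (t, x + lattice n) => //; split => //=; exact: sub_closed_cube.
Qed.

Lemma periodic_bounded f : continuous f -> lattice_periodic f ->
  exists M : R, forall x, `|f x| <= M.
Proof.
move=> cf pf; have [||M hM] := @periodic_time_bounded (fun z => f z.2) 0 0.
- by move=> z; apply: continuous_comp; [exact: cvg_snd|exact: cf].
- by move=> t n x /=; exact: pf.
by exists M => x; apply: (hM 0); rewrite in_itv/= lexx.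
Qed.

Lemma periodic_integrable (nu : probability V R) f : continuous f ->
  lattice_periodic f -> nu.-integrable setT (EFin \o f).
Proof.
move=> cf pf; have [M hM] := periodic_bounded cf pf.
apply: measurable_bounded_integrable => //.
- by rewrite (le_lt_trans (probability_le1 _ _)) ?ltry.
- exact: continuous_measurable_rV.
- exists M; split; first by rewrite num_real.
  by move=> r Mr x _ /=; apply: le_trans (hM x) (ltW Mr).
Qed.

Lemma lattice_periodic_comp (T : Type) (op : R -> T) f : lattice_periodic f ->
  lattice_periodic (fun x => op (f x)).
Proof. by move=> pf n x; rewrite pf. Qed.

Lemma lattice_periodic2 (T : Type) (op : R -> R -> T) f h : lattice_periodic f ->
  lattice_periodic h -> lattice_periodic (fun x => op (f x) (h x)).
Proof. by move=> pf ph n x; rewrite pf ph. Qed.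

Lemma lattice_periodic_shift (T : Type) (F : V -> T) a : lattice_periodic F ->
  lattice_periodic (fun x => F (x + a)).
Proof. by move=> pF n x; rewrite addrAC pF. Qed.

Lemma lattice_periodic_sub (T : Type) (F : V -> T) a : lattice_periodic F ->
  lattice_periodic (fun x => F (a - x)).
Proof. by move=> pF n x; rewrite opprD addrA -latticeN pF. Qed.

Lemma lattice_periodic_derive f v : lattice_periodic f -> lattice_periodic ('D_v f).
Proof.
move=> pf n x; rewrite /derive; congr (lim (_ @ 0^')).
by apply/funext => h /=; rewrite addrA !pf.
Qed.

Lemma lattice_periodic_iter_derive f vs : lattice_periodic f ->
  lattice_periodic (iter_derive vs f).
Proof. by move=> pf; elim: vs => [//|v vs IH] /=; exact: lattice_periodic_derive. Qed.

Lemma Rintegral_torusD a f : continuous f -> lattice_periodic f ->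
  \int[dx]_x f (x + a) = \int[dx]_x f x.
Proof.
move=> cf pf; congr fine; apply: (@integral_torusD _ _ a (EFin \o f)).
- by apply/measurable_EFinP; exact: continuous_measurable_rV.
- by move=> n x /=; rewrite pf.
Qed.

Lemma Rintegral_torus_sub a f : continuous f -> lattice_periodic f ->
  \int[dx]_x f (a - x) = \int[dx]_x f x.
Proof.
move=> cf pf; congr fine; apply: (@integral_torus_sub _ _ a (EFin \o f)).
- by apply/measurable_EFinP; exact: continuous_measurable_rV.
- by move=> n x /=; rewrite pf.
Qed.

Lemma continuous_shift_rV a f : continuous f -> continuous (fun x : V => f (x + a)).
Proof.
move=> cf x; apply: continuous_comp; last exact: cf.
exact: (continuousD (@cvg_id _ _) (@cst_continuous _ _ a x)).
Qed.

Lemma continuous_sub_rV a f : continuous f -> continuous (fun x : V => f (a - x)).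
Proof.
move=> cf x; apply: continuous_comp; last exact: cf.
exact: (continuousB (@cst_continuous _ _ a x) (@cvg_id _ _)).
Qed.

(** By translation invariance [\int f (x + s e_i) dx] does not depend on [s]. *)
Lemma Rintegral_pderiv0 i f : continuous f -> lattice_periodic f ->
  (forall x, derivable f x (basis_vec i)) -> continuous (pderiv i f) ->
  \int[dx]_x pderiv i f x = 0.
Proof.
move=> cf pf df cdf.
pose F (s : R) x := f (x + s *: basis_vec i).
have dF (s : R) x : is_derive s 1 (F ^~ x) (pderiv i f (x + s *: basis_vec i)).
  exact: is_derive_line.
have pdf : lattice_periodic (pderiv i f) by exact: lattice_periodic_derive.
have [M hM] := periodic_bounded cdf pdf.
have M0 : 0 <= M by exact: le_trans (hM 0).
have h := @differentiation_under_integral R _ _ dx F setT measurableT 0 (-1) 1.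
have : derive1 (fun s : R => \int[dx]_y F s y) 0 = \int[dx]_y partial1of2 F 0 y.
  apply: (h _ _ _ (cst M)).
  - by rewrite /= in_itv/= oppr_lt0 ltr01.
  - move=> s _; apply: periodic_integrable; first exact: continuous_shift_rV.
    exact: lattice_periodic_shift.
  - by move=> s x _ _; exact: ex_derive.
  - by [].
  - by apply: finite_measure_integrable_cst.
  - by move=> s x _ _; rewrite partial1of2E (@derive_val _ _ _ _ _ _ _ (dF s x)).
have -> : (fun s : R => \int[dx]_y F s y) = cst (\int[dx]_y f y).
  by apply/funext => s; rewrite Rintegral_torusD.
rewrite derive1_cst => h0; apply: etrans (esym h0); apply: eq_Rintegral => x _.
by rewrite partial1of2E (@derive_val _ _ _ _ _ _ _ (dF 0 x)) scale0r addr0.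
Qed.

Lemma smooth_pderiv i f : smooth f -> smooth (pderiv i f).
Proof. exact: smooth_derive. Qed.

Lemma lattice_periodic_pderiv i f : lattice_periodic f -> lattice_periodic (pderiv i f).
Proof. exact: lattice_periodic_derive. Qed.

Lemma lattice_periodic_laplacian f : lattice_periodic f -> lattice_periodic (laplacian f).
Proof.
by move=> pf n x; apply: eq_bigr => i _; rewrite !lattice_periodic_pderiv//;
  exact: lattice_periodic_pderiv.
Qed.

Lemma continuous_laplacian f : smooth f -> continuous (laplacian f).
Proof.
by move=> sf; apply: cont_sum => i _; exact/smooth_continuous/smooth_pderiv/smooth_pderiv.
Qed.

Lemma pderivM i f h x : derivable f x (basis_vec i) -> derivable h x (basis_vec i) ->
  pderiv i (fun y => f y * h y) x = f x * pderiv i h x + h x * pderiv i f x.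
Proof. move=> df dh; exact: (deriveM df dh). Qed.

Lemma Rintegral_by_parts i f h : continuous f -> lattice_periodic f ->
  (forall x, derivable f x (basis_vec i)) -> continuous (pderiv i f) ->
  continuous h -> lattice_periodic h ->
  (forall x, derivable h x (basis_vec i)) -> continuous (pderiv i h) ->
  \int[dx]_x (f x * pderiv i h x) = - \int[dx]_x (h x * pderiv i f x).
Proof.
move=> cf pf df cdf ch ph dh cdh.
have e : pderiv i (fun y => f y * h y) = (fun x => f x * pderiv i h x + h x * pderiv i f x).
  by apply/funext => x; exact: pderivM.
have p1 := lattice_periodic2 *%R pf (lattice_periodic_pderiv i ph).
have p2 := lattice_periodic2 *%R ph (lattice_periodic_pderiv i pf).
have i1 := periodic_integrable dx (contM cf cdh) p1.
have i2 := periodic_integrable dx (contM ch cdf) p2.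
apply/eqP; rewrite -addr_eq0 -(RintegralD measurableT i1 i2) -e; apply/eqP.
apply: Rintegral_pderiv0; [exact: (contM cf ch)|exact: (lattice_periodic2 *%R pf ph)| |].
  by move=> x; exact: (derivableM (df x) (dh x)).
by rewrite e; exact: (contD (contM cf cdh) (contM ch cdf)).
Qed.

End periodic_functions.

Section smooth_reflection.
Context {R : realType} {d : nat}.
Local Notation V := 'rV[R]_d.

Lemma differentiable_sub_rV (f : V -> R) a x : differentiable f (a - x) ->
  differentiable (fun z => f (a - z)) x.
Proof.
by move=> df; apply: (@differentiable_comp _ _ _ _ (fun z : V => a - z) f) => //.
Qed.

Lemma derive_sub_rV (f : V -> R) a x v : differentiable f (a - x) ->
  'D_v (fun z => f (a - z)) x = - 'D_v f (a - x).
Proof.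
move=> df; transitivity ('D_(- v) f (a - x)); last by rewrite !deriveE// linearN.
rewrite /derive; congr (lim (_ @ 0^')); apply/funext => h /=; congr (_ *: (f _ - _)).
by rewrite scalerN opprD addrCA.
Qed.

Lemma iter_derive_sub_rV (f : V -> R) a vs : smooth f ->
  iter_derive vs (fun z => f (a - z)) = (fun z => (-1) ^+ size vs * iter_derive vs f (a - z)).
Proof.
move=> sf; elim: vs => [|v vs IH] /=; first by apply/funext => z; rewrite expr0 mul1r.
rewrite IH; apply/funext => z.
have di : differentiable (iter_derive vs f) (a - z) by exact: sf.
rewrite (_ : (fun z => (-1) ^+ size vs * _) = (-1) ^+ size vs \*: (fun z => iter_derive vs f (a - z)))//.
rewrite deriveZ; last exact/diff_derivable/differentiable_sub_rV.
by rewrite derive_sub_rV// exprS mulN1r mulNr scalerN.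
Qed.

Lemma smooth_sub_rV (f : V -> R) a : smooth f -> smooth (fun z => f (a - z)).
Proof.
move=> sf vs x; rewrite iter_derive_sub_rV//.
apply: (@differentiableM _ _ (cst ((-1) ^+ size vs)) (fun z => iter_derive vs f (a - z))) => //.
by apply: differentiable_sub_rV; exact: sf.
Qed.

Lemma laplacian_sub_rV (f : V -> R) a x : smooth f ->
  laplacian (fun z => f (a - z)) x = laplacian f (a - x).
Proof.
move=> sf; apply: eq_bigr => i _.
have h y : pderiv i (fun z => f (a - z)) y = - pderiv i f (a - y).
  by apply: derive_sub_rV; exact: smooth_differentiable.
rewrite (_ : pderiv i (fun z => f (a - z)) = fun y => - pderiv i f (a - y)); last exact/funext.
have sd : smooth (pderiv i f) by exact: smooth_derive.
rewrite pderivN; last exact: smooth_sub_rV.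
by rewrite {1}/pderiv derive_sub_rV ?opprK//; exact: smooth_differentiable.
Qed.

End smooth_reflection.

(** * Convolution with the kernel *)

Section convolution.
Context {R : realType} {d : nat}.
Local Notation V := 'rV[R]_d.
Local Notation dx := (lebesgue_torus R d).
Variables (nu : {measure set V -> \bar R}) (k : V -> R).
Hypothesis ik : nu.-integrable setT (EFin \o k).
Implicit Types (f : V -> R) (x : V).

Definition convolve f : V -> R := param_integral nu k (id : V -> V) f.

Lemma convE f (x : V) : convolve f x = \int[nu]_z (k z * f (x - z)).
Proof. by []. Qed.

Lemma measurable_sub_id f : continuous f -> forall w : V,
  measurable_fun setT (fun z : V => f (w - id z)).
Proof. by move=> cf w; apply: continuous_measurable_rV; exact: continuous_sub_rV. Qed.

Lemma tame_id f : smooth f -> lattice_periodic f -> tame (id : V -> V) f.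
Proof.
move=> sf pf vs w; have [||M hM] := @periodic_bounded _ _ (iter_derive vs f).
- exact/smooth_continuous/smooth_iter_derive.
- exact: lattice_periodic_iter_derive.
by exists M; near=> w' => z; exact: hM.
Unshelve. all: by end_near. Qed.

Lemma smooth_conv f : smooth f -> lattice_periodic f -> smooth (convolve f).
Proof.
move=> sf pf; exact: (smooth_param_integral (rV_coords d) ik measurable_sub_id (tame_id sf pf) sf).
Qed.

Lemma lattice_periodic_conv f : lattice_periodic f -> lattice_periodic (convolve f).
Proof.
move=> pf n x; rewrite !convE; apply: eq_Rintegral => z _.
by rewrite addrAC pf.
Qed.

Lemma pderiv_conv i f x : smooth f -> lattice_periodic f ->
  pderiv i (convolve f) x = convolve (pderiv i f) x.
Proof.
move=> sf pf.
exact: (param_integral_derive (rV_coords d) ik measurable_sub_id x (basis_vec i) (tame_id sf pf) sf).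
Qed.

Lemma conv_integrable f (x : V) : continuous f -> lattice_periodic f ->
  nu.-integrable setT (fun z => (k z * f (x - z))%:E).
Proof.
move=> cf pf; have [M hM] := periodic_bounded cf pf.
by apply: (integrableM_bounded ik (measurable_sub_id cf x) (fun z => hM (x - z))).
Qed.

Lemma laplacian_conv f x : smooth f -> lattice_periodic f ->
  laplacian (convolve f) x = convolve (laplacian f) x.
Proof.
move=> sf pf; rewrite /laplacian convE.
transitivity (\sum_i convolve (pderiv i (pderiv i f)) x).
  apply: eq_bigr => i _.
  rewrite (_ : pderiv i (convolve f) = convolve (pderiv i f)); last first.
    by apply/funext => y; rewrite pderiv_conv.
  by apply: pderiv_conv; [exact: smooth_pderiv|exact: lattice_periodic_pderiv].
have ii i : nu.-integrable setT (fun z => (k z * pderiv i (pderiv i f) (x - z))%:E).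
  apply: conv_integrable; first exact/smooth_continuous/smooth_pderiv/smooth_pderiv.
  exact/lattice_periodic_pderiv/lattice_periodic_pderiv.
transitivity (\int[nu]_z \sum_i (k z * pderiv i (pderiv i f) (x - z))); last first.
  by apply: eq_Rintegral => z _; rewrite mulr_sumr.
rewrite /Rintegral; under eq_integral do rewrite -sumEFin.
rewrite integral_sum// -sum_fine// => i _.
by apply: integrable_fin_num => //; exact: ii.
Qed.

Lemma conv_bound f x (M : R) : continuous f -> (forall y, `|f y| <= M) ->
  `|convolve f x| <= M * \int[nu]_z `|k z|.
Proof.
by move=> cf hM; exact: (normr_RintegralM_le ik (measurable_sub_id cf x) (fun z => hM (x - z))).
Qed.

End convolution.

Section time_convolution.
Context {R : realType} {d : nat}.
Local Notation V := 'rV[R]_d.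
Variables (nu : {measure set V -> \bar R}) (k : V -> R).
Hypothesis ik : nu.-integrable setT (EFin \o k).
Implicit Types (u : R * V -> R).

Definition at_time0 (z : V) : R * V := (0, z).

(** Convolution in the space variable only. *)
Definition tconv u : R * V -> R := param_integral nu k at_time0 u.

Lemma tconvE u t x : tconv u (t, x) = convolve nu k (fun y => u (t, y)) x.
Proof.
rewrite /tconv /convolve /param_integral; apply: eq_Rintegral => z _; congr (_ * u _).
by apply: injective_projections => //=; rewrite subr0.
Qed.

Lemma continuous_slice u t : continuous u -> continuous (fun x => u (t, x)).
Proof.
move=> cu x; apply: continuous_comp; last exact: cu.
exact: (@cvg_pair _ _ _ (nbhs x) (nbhs t) (nbhs x) _ _ _ (cst t) id (cvg_cst t) cvg_id).
Qed.

Lemma measurable_sub_at_time0 u : continuous u -> forall w : R * V,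
  measurable_fun setT (fun z => u (w - at_time0 z)).
Proof.
move=> cu [t x].
rewrite (_ : (fun z => u ((t, x) - at_time0 z)) = (fun z => u (t, x - z))).
  by apply: continuous_measurable_rV; exact: (@continuous_sub_rV R d x _ (@continuous_slice u t cu)).
apply/funext => z; congr u.
by apply: injective_projections => //=; rewrite subr0.
Qed.

Definition space_periodic u := forall t : R, lattice_periodic (fun x => u (t, x)).

Lemma space_periodic_derive u v : space_periodic u -> space_periodic ('D_v u).
Proof.
move=> pu t n x; rewrite /derive; congr (lim (_ @ 0^')).
apply/funext => h /=; congr (_ *: (_ - _)); last exact: pu.
have e y : h *: v + (t, y) = (h *: v.1 + t, h *: v.2 + y) by [].
by rewrite !e addrA; exact: pu.
Qed.

Lemma space_periodic_iter_derive u vs : space_periodic u -> space_periodic (iter_derive vs u).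
Proof. by move=> pu; elim: vs => [//|v vs IH]; exact: space_periodic_derive. Qed.

Lemma tame_time u : smooth u -> space_periodic u -> tame at_time0 u.
Proof.
move=> su pu vs [t x].
have [||M hM] := @periodic_time_bounded _ _ (iter_derive vs u) (t - 1) (t + 1).
- exact/smooth_continuous/smooth_iter_derive.
- exact: space_periodic_iter_derive.
have h1 : \forall w' \near ((t, x) : R * V), `|t - w'.1| <= 1.
  have : w'.1 @[w' --> ((t, x) : R * V)] --> t by exact: cvg_fst.
  by move/cvgrPdist_le => /(_ 1 ltr01).
exists M; apply: filterS h1 => -[t' x'] /= h1 z.
have -> : (t', x') - at_time0 z = (t', x' - z).
  by apply: injective_projections => //=; rewrite subr0.
by apply: hM; move: h1; rewrite in_itv/= ler_distlC.
Qed.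

Lemma smooth_tconv u : smooth u -> space_periodic u -> smooth (tconv u).
Proof.
move=> su pu.
exact: (smooth_param_integral (time_coords d) ik measurable_sub_at_time0 (tame_time su pu) su).
Qed.

Lemma time_deriv_tconv u z : smooth u -> space_periodic u ->
  time_deriv (tconv u) z = tconv (time_deriv u) z.
Proof.
move=> su pu.
exact: (param_integral_derive (time_coords d) ik measurable_sub_at_time0 z (1, 0) (tame_time su pu) su).
Qed.

End time_convolution.

Section slices.
Context {R : realType} {d : nat}.
Local Notation V := 'rV[R]_d.
Implicit Types (u : R * V -> R).

Lemma derive_slice u t v x : 'D_v (fun y => u (t, y)) x = 'D_(0, v) u (t, x).
Proof.
rewrite /derive; congr (lim (_ @ 0^')); apply/funext => h /=; congr (_ *: (u _ - _)).
by apply: injective_projections => //=; rewrite scaler0 add0r.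
Qed.

Lemma iter_derive_slice u t vs : iter_derive vs (fun y => u (t, y)) =
  (fun x => iter_derive [seq (0 : R, v) | v <- vs] u (t, x)).
Proof.
elim: vs => [//|v vs IH] /=; rewrite IH; apply/funext => x; exact: derive_slice.
Qed.

Lemma smooth_slice u t : smooth u -> smooth (fun x => u (t, x)).
Proof.
move=> su vs x; rewrite iter_derive_slice.
apply: (@differentiable_comp _ _ _ _ (fun y : V => (t, y)) (iter_derive _ u)); last exact: su.
exact: (@differentiable_pair _ _ _ _ (cst t) id).
Qed.

End slices.

Section coulomb.
Context {R : realType} {d : nat}.
Local Notation V := 'rV[R]_d.
Local Notation dx := (lebesgue_torus R d).
Variables (g : V -> \bar R).
Hypothesis hg : coulomb_kernel g.
Local Notation gam := (fine \o g).

Lemma measurable_fine_kernel : measurable_fun setT gam.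
Proof.
by apply: measurableT_comp => //; exact: (measurable_int _ (coulomb_integrable hg)).
Qed.

Lemma kernel_integrable : dx.-integrable setT (EFin \o gam).
Proof.
apply: (le_integrable measurableT _ _ (coulomb_integrable hg)).
  by apply/measurable_EFinP; exact: measurable_fine_kernel.
move=> x _ /=; case: (g x) => [r| |] //=; by rewrite normr0 ?leey.
Qed.

Lemma kernel_periodic : lattice_periodic gam.
Proof. by move=> n x /=; rewrite (coulomb_periodic hg). Qed.

Lemma kernel_fine_integral (f : V -> R) : measurable_fun setT f ->
  (\int[dx]_x (g x * (f x)%:E) = \int[dx]_x ((gam x * f x)%:E))%E.
Proof.
move=> mf; apply: ae_eq_integral => //.
- apply: emeasurable_funM; first exact: (measurable_int _ (coulomb_integrable hg)).
  exact/measurable_EFinP.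
- by apply/measurable_EFinP/measurable_funM => //; exact: measurable_fine_kernel.
- have := integrable_ae measurableT (coulomb_integrable hg).
  by apply: filterS => x /(_ I) gx _ /=; rewrite EFinM fineK.
Qed.

(** The equation of the kernel, tested against the reflected translates of [f]. *)
Lemma laplacian_conv_kernel (f : V -> R) x : smooth f -> lattice_periodic f ->
  laplacian (convolve dx gam f) x = \int[dx]_y f y - f x.
Proof.
move=> sf pf; rewrite laplacian_conv//; last exact: kernel_integrable.
have := coulomb_eq hg (smooth_sub_rV x sf) (lattice_periodic_sub x pf).
have cl : continuous (fun z : V => laplacian f (x - z)).
  by apply: continuous_sub_rV; exact: continuous_laplacian.
rewrite (_ : (fun z : V => (g z * (laplacian (fun y => f (x - y)) z)%:E)%E) =
   (fun z : V => (g z * (laplacian f (x - z))%:E)%E)); last first.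
  by apply/funext => z; rewrite laplacian_sub_rV.
rewrite kernel_fine_integral; last exact: continuous_measurable_rV.
move=> /(congr1 fine); rewrite subr0.
have i1 : dx.-integrable setT (fun z => (gam z * laplacian f (x - z))%:E).
  apply: (conv_integrable kernel_integrable); first exact: continuous_laplacian.
  exact: lattice_periodic_laplacian.
have i2 : dx.-integrable setT (EFin \o (fun z => f (x - z))).
  apply: periodic_integrable; last exact: lattice_periodic_sub.
  by apply: continuous_sub_rV; exact: smooth_continuous.
rewrite fineN (fineB _ (integrable_fin_num measurableT i2))//.
rewrite -/(Rintegral dx setT _) -/(Rintegral dx setT _).
rewrite Rintegral_torus_sub//; last exact: smooth_continuous.
rewrite convE => h; rewrite -[LHS]opprK h.
by rewrite opprB.
Qed.

End coulomb.

(** * Truncation and uniform integrability *)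

Section uniform_continuity.
Context {R : realType} {W : normedModType R}.

Lemma compact_uniform_continuity (K : set W) (f : W -> R) (tau : R) :
  compact K -> (forall x, K x -> {for x, continuous f}) -> 0 < tau ->
  exists2 dl : R, 0 < dl & forall x z, K x -> `|x - z| < dl -> `|f z - f x| <= tau.
Proof.
move=> /compact_near_coveringP cK cf tau0.
have := @cK R (0^'+) (fun dl x => forall z, `|x - z| < dl -> `|f z - f x| <= tau) _.
case.
  move=> x Kx; have t2 : 0 < tau / 2 by rewrite divr_gt0.
  have /cvgrPdist_le/(_ _ t2)/nbhs_ballP[r /= r0 hr] := cf x Kx.
  have r2 : 0 < r / 2 by rewrite divr_gt0.
  exists (ball x (r / 2), [set dl | dl < r / 2]) => /=.
    by split; [exact: nbhsx_ballx|exact: nbhs_right_lt].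
  move=> [x' dl] /= [xx' dlr] z zx.
  rewrite -ball_normE /ball_/= in xx'.
  have h1 : `|f x - f x'| <= tau / 2.
    by apply: hr; rewrite -ball_normE /ball_/=; apply: lt_trans xx' _; lra.
  have h2 : `|f x - f z| <= tau / 2.
    apply: hr; rewrite -ball_normE /ball_/= -(subrK x' x) -addrA.
    by apply: le_lt_trans (ler_normD _ _) _; lra.
  have -> : f z - f x' = (f x - f x') - (f x - f z) by ring.
  by apply: le_trans (ler_normB _ _) _; lra.
move=> e /= e0 he; exists (e / 2); first by rewrite divr_gt0.
move=> x z Kx xz; apply: (he (e / 2)) => //=.
- by rewrite sub0r normrN gtr0_norm; lra.
- lra.
Qed.

End uniform_continuity.

Section clamp.
Context {R : realType}.

Definition clamp (N r : R) : R := Num.max (- N) (Num.min r N).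

Lemma clamp_le N r : 0 <= N -> `|clamp N r| <= N.
Proof.
move=> N0; rewrite ler_norml /clamp le_max lexx/= ge_max.
by rewrite (le_trans _ N0) ?oppr_le0//= ge_min lexx orbT.
Qed.

Lemma clamp_id N r : `|r| <= N -> clamp N r = r.
Proof. by rewrite ler_norml => /andP[h1 h2]; rewrite /clamp min_l// max_r. Qed.

Lemma sub_clamp_le N r : 0 <= N -> `|r - clamp N r| <= `|r|.
Proof.
move=> N0; have [h|h] := leP `|r| N; first by rewrite clamp_id// subrr normr0.
rewrite /clamp; have [rN|Nr] := leP r N; last first.
  by rewrite max_r ?(le_trans _ N0) ?oppr_le0// !gtr0_norm; lra.
have r0 : r < 0 by rewrite ltNge; apply/negP => r0; rewrite ger0_norm// ltNge rN in h.
by rewrite ltr0_norm// in h; rewrite max_l; [rewrite !ltr0_norm; lra|lra].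
Qed.

Lemma continuous_clamp N : continuous (clamp N).
Proof.
move=> r; apply: (@continuous_max _ _ (cst (- N)) (fun r => Num.min r N)); first exact: cst_continuous.
apply: (@continuous_min _ _ id (cst N)); [exact: cvg_id|exact: cst_continuous].
Qed.

Lemma measurable_clamp N : measurable_fun setT (clamp N).
Proof. exact: continuous_measurable_fun (@continuous_clamp N). Qed.

End clamp.

Section convergence.
Context {disp} {T : measurableType disp} {R : realType}.
Variable mu : {measure set T -> \bar R}.
Implicit Types (f : T -> R).

Lemma fatou_bound (f_ : nat -> T -> R) (f : T -> \bar R) (B : \bar R) :
  (forall k, measurable_fun setT (f_ k)) -> (forall k x, 0 <= f_ k x) ->
  (forall x, (f_ k x)%:E @[k --> \oo] --> f x) ->
  (forall k, (\int[mu]_x (f_ k x)%:E <= B)%E) -> (\int[mu]_x f x <= B)%E.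
Proof.
move=> mf_ f0 ff hB.
have h := @fatou _ _ _ mu setT measurableT (fun k x => (f_ k x)%:E).
apply: le_trans (le_trans (h _ _) _).
- rewrite le_eqVlt; apply/orP; left; apply/eqP; apply: eq_integral => x _.
  have c := ff x; rewrite is_cvg_limn_einfE; first by apply/esym/cvg_lim.
  by apply/cvg_ex; exists (f x).
- by move=> k; exact/measurable_EFinP.
- by move=> k x _; rewrite lee_fin.
- rewrite limn_einf_lim; apply: lime_le; first exact: is_cvg_einfs.
  apply: nearW => n; apply: le_trans (hB n); apply: ereal_inf_lbound.
  by exists n => /=.
Qed.

Lemma sub_clamp_integrable f N : 0 <= N -> mu.-integrable setT (EFin \o f) ->
  mu.-integrable setT (EFin \o (fun x => f x - clamp N (f x))).
Proof.
move=> N0 if_; have mf : measurable_fun setT f by exact/measurable_EFinP/(measurable_int _ if_).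
apply: (le_integrable measurableT _ _ if_).
  apply/measurable_EFinP; apply: measurable_funB => //.
  exact: (measurableT_comp (measurable_clamp N) mf).
by move=> x _ /=; rewrite lee_fin sub_clamp_le.
Qed.

Lemma sub_clamp_small f (tau : R) : mu.-integrable setT (EFin \o f) -> 0 < tau ->
  exists2 N : R, 0 <= N & \int[mu]_x `|f x - clamp N (f x)| <= tau.
Proof.
move=> if_ tau0; have mf : measurable_fun setT f by exact/measurable_EFinP/(measurable_int _ if_).
pose h (n : nat) x := `|f x - clamp n%:R (f x)|.
have hc : \int[mu]_x h n x @[n --> \oo] --> (0 : R).
  have [|||||_ _ hh] := @dominated_convergence _ _ _ mu setT measurableT
    (fun n x => (h n x)%:E) (cst 0%E) (fun x => `|(f x)%:E|)%E.
  - move=> n; apply/measurable_EFinP/measurableT_comp => //.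
    apply: measurable_funB => //.
    exact: (measurableT_comp (measurable_clamp _) mf).
  - by [].
  - apply: aeW => x _; apply: cvg_near_cst; near=> n.
    rewrite /h clamp_id ?subrr ?normr0//.
    by near: n; exact: nbhs_infty_ger.
  - exact: integrable_abse.
  - by apply: aeW => x n _; rewrite /h/= normr_id lee_fin sub_clamp_le.
  by apply: fine_cvg; rewrite integral0 in hh; exact: hh.
move: hc => /cvgrPdist_le /(_ _ tau0)[n _ hn].
exists n%:R => //; have := hn n (leqnn _).
by rewrite /= sub0r normrN ger0_norm//; apply: Rintegral_ge0 => x _; rewrite /h.
Unshelve. all: by end_near. Qed.


Lemma integral_norm_fin_num f : mu.-integrable setT (EFin \o f) ->
  (\int[mu]_x (`|f x|)%:E)%E \is a fin_num.
Proof.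
move=> if_; have h : mu.-integrable setT (EFin \o (fun x => `|f x|)).
  exact: integrable_norm.
exact: (@integrable_fin_num _ _ _ mu setT measurableT (EFin \o (fun x => `|f x|)) h).
Qed.

(** Vitali's theorem, with uniform integrability expressed by truncation. *)
Lemma vitali (f_ : nat -> T -> R) f : (mu setT < +oo)%E ->
  (forall k, mu.-integrable setT (EFin \o f_ k)) -> (forall x, f_ ^~ x @ \oo --> f x) ->
  (forall tau : R, 0 < tau -> exists2 N : R, 0 <= N &
     forall k, \int[mu]_x `|f_ k x - clamp N (f_ k x)| <= tau) ->
  mu.-integrable setT (EFin \o f) /\
  forall phi : T -> R, measurable_fun setT phi -> (exists M, forall x, `|phi x| <= M) ->
    \int[mu]_x (f_ k x * phi x) @[k --> \oo] --> \int[mu]_x (f x * phi x).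
Proof.
move=> muT if_ ff ui.
have mf_ k : measurable_fun setT (f_ k) by exact/measurable_EFinP/(measurable_int _ (if_ k)).
have mf : measurable_fun setT f by apply: (measurable_fun_cvg mf_) => x _; exact: ff.
have mcl N (h : T -> R) : measurable_fun setT h -> measurable_fun setT (fun x => clamp N (h x)).
  by move=> mh; exact: (measurableT_comp (measurable_clamp N) mh).
have cB N : 0 <= N -> forall h : T -> R, measurable_fun setT h ->
    mu.-integrable setT (EFin \o (fun x => clamp N (h x))).
  move=> N0 h mh; apply: measurable_bounded_integrable => //; first exact: mcl.
  exists N; split; first by rewrite num_real.
  by move=> r Nr x _; apply: le_trans (ltW Nr); exact: clamp_le.
have tail (tau N : R) : 0 <= N ->
    (forall k, \int[mu]_x `|f_ k x - clamp N (f_ k x)| <= tau) ->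
    (\int[mu]_x (`|f x - clamp N (f x)|)%:E <= tau%:E)%E.
  move=> N0 hN; apply: (@fatou_bound (fun k x => `|f_ k x - clamp N (f_ k x)|)) => //.
  - move=> k; apply: measurableT_comp => //; apply: measurable_funB => //; exact: mcl.
  - move=> x; apply/cvg_EFin; first exact: nearW.
    apply: cvg_norm; apply: cvgB; first exact: ff.
    exact: (cvg_comp _ _ (ff x) (@continuous_clamp R N (f x))).
  - move=> k; have ik := sub_clamp_integrable N0 (if_ k).
    have := hN k; rewrite -lee_fin /Rintegral fineK//.
    exact: integral_norm_fin_num ik.
have iff : mu.-integrable setT (EFin \o f).
  have [N N0 hN] := ui 1 ltr01.
  have hi : mu.-integrable setT (EFin \o (fun x => f x - clamp N (f x))).
    apply/integrableP; split.
      by apply/measurable_EFinP/measurable_funB => //; exact: mcl.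
    by apply: le_lt_trans (tail 1 N N0 hN) _; rewrite ltry.
  have := integrableD measurableT hi (cB N N0 f mf).
  by apply: eq_integrable => // x _ /=; rewrite -EFinD subrK.
split=> // phi mphi [M hM].
have M0 : 0 <= `|M| by [].
have {}hM x : `|phi x| <= `|M| by exact: le_trans (hM x) (ler_norm _).
have ifphi (h : T -> R) : mu.-integrable setT (EFin \o h) -> mu.-integrable setT (EFin \o (fun x => h x * phi x)).
  by move=> ih; exact: (integrableM_bounded ih mphi hM).
apply/cvgrPdist_le => e e0.
pose tau := e / (3 * (`|M| + 1)).
have M1 : 0 < `|M| + 1 by rewrite ltr_wpDl.
have tau0 : 0 < tau by rewrite divr_gt0// mulr_gt0.
have Mtau : `|M| * tau <= e / 3.
  have -> : e / 3 = (`|M| + 1) * tau by rewrite /tau; field; rewrite gt_eqF.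
  by rewrite ler_wpM2r ?lerDl// ltW.
have [N N0 hN] := ui tau tau0.
have hc : \int[mu]_x (clamp N (f_ k x) * phi x) @[k --> \oo] -->
    \int[mu]_x (clamp N (f x) * phi x).
  have iN : mu.-integrable setT (EFin \o (cst (N * `|M|) : T -> R)).
    apply: measurable_bounded_integrable => //.
    exists (N * `|M|); split; first by rewrite num_real.
    move=> r Nr x _; apply: le_trans (ltW Nr).
    by rewrite /= ger0_norm// mulr_ge0.
  have [|||||_ _ hh] := @dominated_convergence _ _ _ mu setT measurableT
    (fun k x => (clamp N (f_ k x) * phi x)%:E) (fun x => (clamp N (f x) * phi x)%:E)
    (EFin \o (cst (N * `|M|) : T -> R)).
  - by move=> k; apply/measurable_EFinP/measurable_funM => //; exact: mcl.
  - by apply/measurable_EFinP/measurable_funM => //; exact: mcl.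
  - apply: aeW => x _; apply/cvg_EFin; first exact: nearW.
    apply: cvgM; last exact: cvg_cst.
    exact: (cvg_comp _ _ (ff x) (@continuous_clamp R N (f x))).
  - exact: iN.
  - by apply: aeW => x k _; rewrite /= lee_fin normrM ler_pM// clamp_le.
  apply: fine_cvg; rewrite /Rintegral fineK//.
  apply: (integrable_fin_num measurableT); exact: (ifphi _ (cB N N0 f mf)).
have e3 : 0 < e / 3 by rewrite divr_gt0.
have /cvgrPdist_le/(_ _ e3) := hc; apply: filterS => k hk.
have split (h : T -> R) : mu.-integrable setT (EFin \o h) ->
    \int[mu]_x (`|h x - clamp N (h x)|) <= tau ->
    `|\int[mu]_x (h x * phi x) - \int[mu]_x (clamp N (h x) * phi x)| <= e / 3.
  move=> ih hle; have mh : measurable_fun setT h by exact/measurable_EFinP/(measurable_int _ ih).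
  rewrite -(RintegralB measurableT (ifphi _ ih) (ifphi _ (cB N N0 h mh))).
  have := normr_RintegralM_le (sub_clamp_integrable N0 ih) mphi hM.
  rewrite (_ : (fun z => (h z - clamp N (h z)) * phi z) =
    (fun z => h z * phi z - clamp N (h z) * phi z)); last first.
    by apply/funext => z; rewrite mulrBl.
  move=> /le_trans; apply; apply: le_trans Mtau.
  by rewrite ler_wpM2l.
have h1 := split _ (if_ k) (hN k).
have h2 : `|\int[mu]_x (f x * phi x) - \int[mu]_x (clamp N (f x) * phi x)| <= e / 3.
  apply: split => //; rewrite -lee_fin /Rintegral fineK; first exact: tail.
  exact: integral_norm_fin_num (sub_clamp_integrable N0 iff).
move: h1 h2 hk; set a := Rintegral _ _ _; set b := Rintegral _ _ _.
set c := Rintegral _ _ _; set q := Rintegral _ _ _.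
clear; rewrite !ler_norml => /andP[h1 h2] /andP[h3 h4] /andP[h5 h6].
by apply/andP; split; lra.
Qed.

End convergence.

(** * Approximate identities *)

Section fubini_bounded.
Context {d1 d2} {T1 : measurableType d1} {T2 : measurableType d2} {R : realType}.
Variables (m1 : {sigma_finite_measure set T1 -> \bar R}).
Variables (m2 : {sigma_finite_measure set T2 -> \bar R}).

Lemma fubini_bounded (a : T1 -> R) (b : T2 -> R) (c : T1 * T2 -> R) (M : R) :
  m1.-integrable setT (EFin \o a) -> m2.-integrable setT (EFin \o b) ->
  measurable_fun setT c -> (forall z, `|c z| <= M) ->
  \int[m1]_z (a z * \int[m2]_x (b x * c (z, x))) =
  \int[m2]_x (b x * \int[m1]_z (a z * c (z, x))).
Proof.
move=> ia ib mc cM.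
have ma : measurable_fun setT a by exact/measurable_EFinP/(measurable_int _ ia).
have mb : measurable_fun setT b by exact/measurable_EFinP/(measurable_int _ ib).
have mc1 z : measurable_fun setT (fun x => c (z, x)).
  by apply: (measurableT_comp mc); exact: measurable_pair1.
have mc2 x : measurable_fun setT (fun z => c (z, x)).
  by apply: (measurableT_comp mc); exact: measurable_pair2.
have mabs d' (T : measurableType d') (h : T -> R) : measurable_fun setT h ->
    measurable_fun setT (fun z => `|(h z)%:E|%E).
  by move=> mh; apply: (@measurableT_comp _ _ _ _ _ _ abse) => //; exact/measurable_EFinP.
have mab : measurable_fun setT (fun z : T1 * T2 => a z.1 * b z.2).
  apply: measurable_funM; first exact: (measurableT_comp ma measurable_fst).
  exact: (measurableT_comp mb measurable_snd).
have iab : (m1 \x m2)%E.-integrable setT (EFin \o (fun z => a z.1 * b z.2)).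
  apply/integrable12ltyP; first exact/measurable_EFinP.
  have aoo : (\int[m1]_z `|(a z)%:E| < +oo)%E by have /integrableP[] := ia.
  have boo : (\int[m2]_x `|(b x)%:E| < +oo)%E by have /integrableP[] := ib.
  have a0 : (0 <= \int[m1]_z `|(a z)%:E|)%E by exact: integral_ge0.
  have b0 : (0 <= \int[m2]_x `|(b x)%:E|)%E by exact: integral_ge0.
  rewrite (_ : (fun z => _) = (fun z => `|(a z)%:E| * \int[m2]_x `|(b x)%:E|)%E); last first.
    apply/funext => z; rewrite -ge0_integralZl//; last exact: mabs.
    by apply: eq_integral => x _ /=; rewrite -EFinM normrM.
  rewrite ge0_integralZr//; last exact: mabs.
  by rewrite lte_mul_pinfty// ge0_fin_numE.
have iF : (m1 \x m2)%E.-integrable setT (fun z => (a z.1 * b z.2 * c z)%:E).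
  exact: (integrableM_bounded iab mc cM).
have i1 z : m2.-integrable setT (fun x => (b x * c (z, x))%:E).
  exact: (integrableM_bounded ib (mc1 z) (fun x => cM (z, x))).
have i2 x : m1.-integrable setT (fun z => (a z * c (z, x))%:E).
  exact: (integrableM_bounded ia (mc2 x) (fun z => cM (z, x))).
have := Fubini iF => /= h; congr fine.
transitivity (\int[m1]_z \int[m2]_x (a z * b x * c (z, x))%:E)%E.
  apply: eq_integral => z _; rewrite EFinM /Rintegral fineK; last first.
    exact: (integrable_fin_num measurableT (i1 z)).
  rewrite -(integralZl measurableT (i1 z)); apply: eq_integral => x _.
  by rewrite -EFinM mulrA.
rewrite h; apply: eq_integral => x _; rewrite EFinM /Rintegral fineK; last first.
  exact: (integrable_fin_num measurableT (i2 x)).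
rewrite -(integralZl measurableT (i2 x)); apply: eq_integral => z _.
by rewrite -EFinM mulrCA mulrA.
Qed.

End fubini_bounded.

Section approx_identity.
Context {R : realType} {d : nat}.
Local Notation V := 'rV[R]_d.
Local Notation dx := (lebesgue_torus R d).

Lemma measurable_sub_rV2 : measurable_fun setT (fun z : V * V => z.1 - z.2).
Proof.
apply: measurable_fun_rV => i; under eq_fun do rewrite !mxE.
apply: measurable_funB.
  exact: (measurableT_comp (measurable_coord i) measurable_fst).
exact: (measurableT_comp (measurable_coord i) measurable_snd).
Qed.

Lemma measurable_add_rV2 : measurable_fun setT (fun z : V * V => z.1 + z.2).
Proof.
apply: measurable_fun_rV => i; under eq_fun do rewrite !mxE.
apply: measurable_funD.
  exact: (measurableT_comp (measurable_coord i) measurable_fst).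
exact: (measurableT_comp (measurable_coord i) measurable_snd).
Qed.

(** The lattice enters because [eta] is periodic. *)
Definition concentrated (dl : R) (eta : V -> R) :=
  forall y, eta y != 0 -> exists n, `|y + lattice n| <= dl.

Record mollifying (eta : V -> R) : Prop := {
  mlf_smooth : smooth eta;
  mlf_periodic : lattice_periodic eta;
  mlf_ge0 : forall x, 0 <= eta x;
  mlf_int : \int[dx]_x eta x = 1 }.

Definition approx_identity (eta : nat -> V -> R) := (forall k, mollifying (eta k)) /\
  forall dl : R, 0 < dl -> exists K, forall k, (K <= k)%N -> concentrated dl (eta k).

Section one_mollifier.
Variable eta : V -> R.
Hypothesis me : mollifying eta.

Let ceta : continuous eta. Proof. exact: smooth_continuous (mlf_smooth me). Qed.

Lemma mlf_int_sub x : \int[dx]_z eta (x - z) = 1.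
Proof. by rewrite Rintegral_torus_sub//; [exact: mlf_int|exact: mlf_periodic]. Qed.

Lemma mlf_int_add x : \int[dx]_z eta (z + x) = 1.
Proof. by rewrite Rintegral_torusD//; [exact: mlf_int|exact: mlf_periodic]. Qed.

Lemma mlf_integrable_sub x : dx.-integrable setT (EFin \o (fun z => eta (x - z))).
Proof.
apply: periodic_integrable; first exact: continuous_sub_rV.
exact: lattice_periodic_sub (mlf_periodic me).
Qed.

Lemma mlf_integrable_add x : dx.-integrable setT (EFin \o (fun z => eta (z + x))).
Proof.
apply: periodic_integrable; first exact: continuous_shift_rV.
exact: lattice_periodic_shift (mlf_periodic me).
Qed.

(** The mollified value at [x] is an average of values of [f] at points which are
    within [dl] of [x] up to a lattice vector. *)
Lemma conv_close (f : V -> R) x (dl tau : R) :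
  dx.-integrable setT (EFin \o f) -> lattice_periodic f -> concentrated dl eta ->
  (forall z, `|x - z| <= dl -> `|f z - f x| <= tau) -> `|convolve dx f eta x - f x| <= tau.
Proof.
move=> if_ pf ce hf.
have ie := mlf_integrable_sub x.
have i1 := conv_integrable if_ x ceta (mlf_periodic me).
have i2 : dx.-integrable setT (EFin \o (fun z => f x * eta (x - z))).
  exact: (integrableZl measurableT (f x) ie).
have i3 : dx.-integrable setT (EFin \o (fun z => tau * eta (x - z))).
  exact: (integrableZl measurableT tau ie).
have e : convolve dx f eta x - f x = \int[dx]_z ((f z - f x) * eta (x - z)).
  transitivity (\int[dx]_z (f z * eta (x - z)) - \int[dx]_z (f x * eta (x - z))).
    by rewrite (RintegralZl (f x) measurableT ie) mlf_int_sub mulr1.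
  rewrite -(RintegralB measurableT i1 i2).
  by apply: eq_Rintegral => z _; rewrite mulrBl.
have i4 : dx.-integrable setT (EFin \o (fun z => (f z - f x) * eta (x - z))).
  have := integrableB measurableT i1 i2; apply: eq_integrable => // z _.
  by rewrite /= mulrBl EFinB.
rewrite e; apply: le_trans (le_normr_Rintegral measurableT i4) _.
have <- : \int[dx]_z (tau * eta (x - z)) = tau.
  by rewrite RintegralZl// mlf_int_sub mulr1.
apply: le_Rintegral => //.
  exact: (@integrable_norm _ _ _ dx setT (fun z => (f z - f x) * eta (x - z)) i4).
move=> z _; have [->|ez] := eqVneq (eta (x - z)) 0; first by rewrite !mulr0 normr0.
rewrite normrM (ger0_norm (mlf_ge0 me _)) ler_wpM2r// ?mlf_ge0//.
have [n hn] := ce _ ez.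
rewrite -(pf (- n) z); apply: hf.
by rewrite latticeN opprD opprK addrA.
Qed.

End one_mollifier.
End approx_identity.

(** * Uniform integrability of the mollified kernel gradients *)

Section torus_bounds.
Context {R : realType} {d : nat}.
Local Notation V := 'rV[R]_d.
Implicit Types (nu : probability V R).

Lemma bounded_integrable_prob nu (f : V -> R) (M : R) : measurable_fun setT f ->
  (forall x, `|f x| <= M) -> nu.-integrable setT (EFin \o f).
Proof.
move=> mf hM; apply: measurable_bounded_integrable => //.
  by rewrite (le_lt_trans (probability_le1 _ _)) ?ltry.
exists M; split; first by rewrite num_real.
by move=> r Mr x _ /=; apply: le_trans (hM x) (ltW Mr).
Qed.

Lemma Rintegral_prob_cst nu (c : R) : \int[nu]_x (cst c x) = c.
Proof.
transitivity (c * fine (nu setT)); first exact: (Rintegral_cst nu measurableT c).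
by rewrite (@probability_setT _ _ _ nu) mulr1.
Qed.

Lemma Rintegral_prob_le nu (f : V -> R) (M : R) : measurable_fun setT f ->
  (forall x, `|f x| <= M) -> `|\int[nu]_x f x| <= M.
Proof.
move=> mf hM; have i := bounded_integrable_prob nu mf hM.
apply: le_trans (le_normr_Rintegral measurableT i) _.
rewrite -[leRHS](Rintegral_prob_cst nu); apply: le_Rintegral => //.
- exact: (@integrable_norm _ _ _ nu setT f i).
- by apply: (@bounded_integrable_prob nu _ `|M|) => // x; rewrite normr_id.
Qed.

End torus_bounds.

Section kernel_gradient.
Context {R : realType} {d : nat}.
Local Notation V := 'rV[R]_d.
Local Notation dx := (lebesgue_torus R d).
Variables (g : V -> \bar R).
Hypothesis hg : coulomb_kernel g.
Local Notation gam := (fine \o g).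

Section one_mollifier.
Variable eta : V -> R.
Hypothesis me : mollifying eta.
Let se := mlf_smooth me.
Let pe := mlf_periodic me.
Let ce : continuous eta. Proof. exact: smooth_continuous. Qed.

Variable F : V -> R.
Hypotheses (mF : measurable_fun setT F) (F1 : forall x, `|F x| <= 1).

Let iF : dx.-integrable setT (EFin \o F).
Proof. exact: bounded_integrable_prob F1. Qed.

Let K : V -> R := param_integral dx F -%R eta.

Let mth (f : V -> R) : continuous f -> forall w : V,
  measurable_fun setT (fun z : V => f (w - - z)).
Proof.
move=> cf w; apply: continuous_measurable_rV.
rewrite (_ : (fun z => _) = (fun z : V => f (z + w))); first exact: continuous_shift_rV.
by apply/funext => z; rewrite opprK addrC.
Qed.

Let tK : tame (-%R : V -> V) eta.
Proof.
move=> vs w; have [M hM] := periodic_bounded (smooth_continuous (smooth_iter_derive vs se))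
  (lattice_periodic_iter_derive vs pe).
exists M; near=> w' => z; exact: hM.
Unshelve. all: by end_near.
Qed.

Let sK : smooth K.
Proof. exact: (smooth_param_integral (rV_coords d) iF mth tK se). Qed.

Let cK : continuous K. Proof. exact: smooth_continuous sK. Qed.

Let pK : lattice_periodic K.
Proof.
move=> n x; apply: eq_Rintegral => z _; congr (_ * _).
by rewrite addrAC pe.
Qed.

Let int_eta w : \int[dx]_z eta (w - - z) = 1.
Proof.
rewrite -[RHS](mlf_int_add me w); apply: eq_Rintegral => z _.
by rewrite opprK addrC.
Qed.

Let i_eta w : dx.-integrable setT (EFin \o (fun z => eta (w - - z))).
Proof.
rewrite (_ : (fun z => _) = (fun z : V => eta (z + w))); first exact: mlf_integrable_add.
by apply/funext => z; rewrite opprK addrC.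
Qed.

Let K1 w : `|K w| <= 1.
Proof.
have := normr_RintegralM_le (i_eta w) mF F1.
rewrite mul1r (_ : (fun z => `|eta (w - - z)|) = (fun z => eta (w - - z))); last first.
  by apply/funext => z; rewrite ger0_norm// mlf_ge0.
rewrite int_eta; congr (`|_| <= _); apply: eq_Rintegral => z _; exact: mulrC.
Qed.

Let intK : \int[dx]_w `|K w| <= \int[dx]_x `|F x|.
Proof.
have iaF : dx.-integrable setT (EFin \o (fun x => `|F x|)) by exact: integrable_norm.
pose Q : V -> R := param_integral dx (fun x => `|F x|) -%R eta.
have [M hM] := periodic_bounded ce pe.
have sQ : smooth Q by exact: (smooth_param_integral (rV_coords d) iaF mth tK se).
have pQ : lattice_periodic Q.
  by move=> n x; apply: eq_Rintegral => z _; congr (_ * _); rewrite addrAC pe.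
have iQ := periodic_integrable dx (smooth_continuous sQ) pQ.
have iK := periodic_integrable dx cK pK.
have KQ w : `|K w| <= Q w.
  have iw := integrableM_bounded iF (mth ce w) (fun z => hM (w - - z)).
  apply: le_trans (le_normr_Rintegral measurableT iw) _.
  rewrite le_eqVlt; apply/orP; left; apply/eqP; apply: eq_Rintegral => z _.
  by rewrite normrM (ger0_norm (mlf_ge0 me _)).
apply: (@le_trans _ _ (\int[dx]_w Q w)).
  by apply: le_Rintegral => //; exact: (@integrable_norm _ _ _ dx setT K iK).
have i1 : dx.-integrable setT (EFin \o (cst 1 : V -> R)).
  by apply: (@bounded_integrable_prob _ _ dx _ 1) => // x; rewrite normr1.
have mc : measurable_fun setT (fun z : V * V => eta (z.1 - - z.2)).
  rewrite (_ : (fun z => _) = eta \o (fun z : V * V => z.1 + z.2)); last first.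
    by apply/funext => z /=; rewrite opprK.
  exact: (measurableT_comp (continuous_measurable_rV ce) measurable_add_rV2).
have := fubini_bounded i1 iaF mc (fun z => hM _).
rewrite (_ : (fun z : V => _) = Q); last by apply/funext => z; rewrite /= mul1r.
move=> ->; rewrite le_eqVlt; apply/orP; left; apply/eqP; apply: eq_Rintegral => z _.
rewrite -[RHS]mulr1; congr (_ * _); rewrite -[RHS](mlf_int_add me z); apply: eq_Rintegral => x _.
by rewrite /= mul1r opprK.
Qed.

Let P := convolve dx gam K.

Let igam := kernel_integrable hg.

Let P_bound (N : R) y : 0 <= N ->
  `|P y| <= N * \int[dx]_x `|F x| + \int[dx]_x `|gam x - clamp N (gam x)|.
Proof.
move=> N0; have mg := measurable_fine_kernel hg.
have mcl : measurable_fun setT (fun x => clamp N (gam x)).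
  exact: (measurableT_comp (measurable_clamp N) mg).
have iKy : dx.-integrable setT (EFin \o (fun z => K (y - z))).
  by apply: periodic_integrable; [exact: continuous_sub_rV|exact: lattice_periodic_sub].
have isub := sub_clamp_integrable N0 igam.
have mKy := measurable_sub_id cK y.
have -> : P y = \int[dx]_z (K (y - z) * clamp N (gam z)) +
    \int[dx]_z ((gam z - clamp N (gam z)) * K (y - z)).
  rewrite -RintegralD//; last 2 first.
  - exact: (integrableM_bounded iKy mcl (fun z => clamp_le _ N0)).
  - exact: (integrableM_bounded isub mKy (fun z => K1 _)).
  by apply: eq_Rintegral => z _ /=; ring.
apply: le_trans (ler_normD _ _) _; apply: lerD.
  apply: le_trans (normr_RintegralM_le iKy mcl (fun z => clamp_le _ N0)) _.
  have -> : \int[dx]_z `|K (y - z)| = \int[dx]_z `|K z|.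
    apply: (@Rintegral_torus_sub _ _ y (fun z => `|K z|)).
      move=> x; apply: (@continuous_comp _ _ _ K Num.norm); first exact: cK.
      exact: norm_continuous.
    exact: (lattice_periodic_comp Num.norm pK).
  exact: (ler_wpM2l N0 intK).
rewrite -[leRHS]mul1r.
exact: (normr_RintegralM_le isub mKy (fun z => K1 _)).
Qed.

Let P_derive i : pderiv i P 0 = \int[dx]_x (F x * pderiv i (convolve dx gam eta) x).
Proof.
transitivity (convolve dx gam (pderiv i K) 0); first exact: (@pderiv_conv _ _ dx gam igam i K 0 sK pK).
rewrite convE.
have dK w : pderiv i K w = \int[dx]_x (F x * pderiv i eta (w - - x)).
  exact: (param_integral_derive (rV_coords d) iF mth w (basis_vec i) tK se).
have cd : continuous (pderiv i eta) by exact/smooth_continuous/smooth_pderiv.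
have [M hM] := periodic_bounded cd (lattice_periodic_pderiv i pe).
have mc : measurable_fun setT (fun z : V * V => pderiv i eta (0 - z.1 - - z.2)).
  rewrite (_ : (fun z => _) = (fun x => pderiv i eta (0 - x)) \o (fun z : V * V => z.1 - z.2)).
    by apply: (measurableT_comp _ measurable_sub_rV2); exact: (measurable_sub_id cd).
  by apply/funext => z /=; rewrite opprB addrA addrAC opprK sub0r addrC.
transitivity (\int[dx]_z (gam z * \int[dx]_x (F x * pderiv i eta (0 - z - - x)))).
  by apply: eq_Rintegral => z _; congr (_ * _); exact: dK.
rewrite (fubini_bounded igam iF mc (fun z => hM _)).
apply: eq_Rintegral => x _; congr (_ * _).
rewrite (@pderiv_conv _ _ dx gam igam i eta x se pe) convE; apply: eq_Rintegral => z _ /=.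
by rewrite opprK sub0r addrC.
Qed.

(** Dual form of the gradient bound: pairing with a bounded [F] amounts to
    evaluating at the origin the gradient of a potential with right-hand side
    bounded by two.  Since that potential is small when the integral of
    [`|F|] is, the gradients are uniformly integrable. *)
Lemma kernel_gradient_test i (a N : R) : 0 < a -> 0 <= N ->
  `|\int[dx]_x (F x * pderiv i (convolve dx gam eta) x)| <=
    d%:R * (N * \int[dx]_x `|F x| + \int[dx]_x `|gam x - clamp N (gam x)|) / a + a.
Proof.
move=> a0 N0; rewrite -P_derive.
have sP : smooth P := smooth_conv igam sK pK.
have -> : forall A : R, A + a = A + 2 * a / 2 by move=> A; lra.
apply: (@gradient_estimate R d P 0 a _ 2 i sP a0) => x _; first exact: P_bound.
rewrite (@laplacian_conv_kernel _ _ g hg K x sK pK).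
apply: le_trans (ler_normB _ _) _.
have h := @Rintegral_prob_le _ _ dx K 1 (continuous_measurable_rV cK) K1.
exact: (lerD h (K1 x)).
Qed.

End one_mollifier.

End kernel_gradient.

(** * The kernel off the lattice *)

Section smooth_algebra.
Context {R : realType} {W : normedModType R}.
Implicit Types (f h : W -> R).

Lemma iter_deriveB f h vs : smooth f -> smooth h ->
  iter_derive vs (fun x => f x - h x) = (fun x => iter_derive vs f x - iter_derive vs h x).
Proof.
move=> sf sh; elim: vs => [//|v vs IH] /=; rewrite IH; apply/funext => x.
by apply: (@deriveB _ _ _ (iter_derive vs f) (iter_derive vs h)); exact/smooth_derivable/smooth_iter_derive.
Qed.

Lemma smoothB f h : smooth f -> smooth h -> smooth (fun x => f x - h x).
Proof.
move=> sf sh vs x; rewrite iter_deriveB//.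
by apply: (@differentiableB _ _ _ (iter_derive vs f) (iter_derive vs h)); [exact: sf|exact: sh].
Qed.

Lemma derive_dirZ f x (s : R) (v : W) : differentiable f x ->
  'D_(s *: v) f x = s * 'D_v f x.
Proof. by move=> df; rewrite !deriveE// linearZ. Qed.

End smooth_algebra.

Section kernel_pointwise.
Context {R : realType} {d : nat}.
Local Notation V := 'rV[R]_d.
Local Notation dx := (lebesgue_torus R d).

Lemma pderivB (f h : V -> R) i x : smooth f -> smooth h ->
  pderiv i (fun y => f y - h y) x = pderiv i f x - pderiv i h x.
Proof. by move=> sf sh; exact: (deriveB (@smooth_derivable _ _ f x (basis_vec i) sf) (@smooth_derivable _ _ h x (basis_vec i) sh)). Qed.

Lemma laplacianB (f h : V -> R) x : smooth f -> smooth h ->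
  laplacian (fun y => f y - h y) x = laplacian f x - laplacian h x.
Proof.
move=> sf sh; rewrite /laplacian -sumrB; apply: eq_bigr => i _.
rewrite (_ : pderiv i (fun y => f y - h y) = fun y => pderiv i f y - pderiv i h y); last first.
  by apply/funext => y; exact: pderivB.
by apply: pderivB; exact: smooth_derive.
Qed.

Definition lattice_set : set V := [set x | exists n, x = lattice n].

(** The translate of [x] into the fundamental cube is the closest one to the origin. *)
Lemma lattice_dist (x : V) : ~ lattice_set x ->
  exists2 r : R, 0 < r & forall n, r <= `|x + lattice n|.
Proof.
move=> xL; have [n0 hn0] := lattice_translate x.
exists `|x + lattice n0|.
  rewrite normr_gt0; apply: contra_notN xL => /eqP h.
  by exists (- n0); apply/eqP; rewrite latticeN -addr_eq0 h.
move=> n; apply: rV_norm_le => // i.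
apply: (@le_trans _ _ `|(x + lattice n) ord0 i|); last exact: rV_coord_le.
have := hn0 i; rewrite !mxE in_itv/=.
set y := x ord0 i + _; move=> /andP[y1 y2].
have -> : x ord0 i + (n ord0 i)%:~R = y + (n ord0 i - n0 ord0 i)%:~R :> R.
  by rewrite /y rmorphB/=; ring.
have [->|m0] := eqVneq (n ord0 i - n0 ord0 i) 0; first by rewrite addr0.
have h1 : 1 <= `|(n ord0 i - n0 ord0 i)%:~R| :> R.
  by rewrite -intr_norm -[1](@mulr1z R) ler_int -gtz0_ge1 normr_gt0.
have hy : `|y| <= 2^-1 by rewrite ler_norml y1 ltW.
have := ler_normB (y + (n ord0 i - n0 ord0 i)%:~R) y.
rewrite (addrC y) addrK => h3; lra.
Qed.

Lemma sup_ballE (x0 : V) (a : R) :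
  sup_ball x0 a = [set v | forall j, `[x0 ord0 j - a, x0 ord0 j + a]%classic (v ord0 j)].
Proof.
rewrite predeqE => v; split=> h j; have := h j.
  by rewrite /= in_itv/= ler_distl.
by rewrite /= in_itv/= ler_distl.
Qed.

Lemma compact_sup_ball (x0 : V) (a : R) : compact (sup_ball x0 a).
Proof.
rewrite sup_ballE.
exact: (@rV_compact R d (fun j => `[x0 ord0 j - a, x0 ord0 j + a]%classic)
  (fun=> @segment_compact R _ _)).
Qed.

Lemma sup_ball_norm (x0 x : V) (a : R) : 0 <= a -> sup_ball x0 a x -> `|x - x0| <= a.
Proof. by move=> a0 h; apply: rV_norm_le => // i; rewrite !mxE; exact: h. Qed.

Lemma line_increment_le (H : V -> R) i x (s B : R) : smooth H ->
  (forall r : R, `|r| <= `|s| -> `|pderiv i H (x + r *: basis_vec i)| <= B) ->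
  `|H (x + s *: basis_vec i) - H x| <= B * `|s|.
Proof.
move=> sH hB.
have [c c01 ->] := @mean_value_line _ _ H x (s *: basis_vec i)
  (fun r => @smooth_derivable _ _ H _ _ sH).
move: c01; rewrite in_itv/= => /andP[c0 c1].
have dH y : differentiable H y by exact: smooth_differentiable.
rewrite (derive_dirZ s (basis_vec i) (dH _)) scalerA.
rewrite normrM mulrC; apply: ler_wpM2r (normr_ge0 s) _ _ _.
apply: hB; rewrite normrM gtr0_norm// -[leRHS]mul1r.
exact: (ler_wpM2r (normr_ge0 s) (ltW c1)).
Qed.

(** Passing from [Gk] to the limit [gm] of [GL] costs in the difference quotient no
    more than the increments of [Gk - GL l] do, uniformly in [l]. *)
Lemma quotient_limit_close (Gk gm : V -> R) (GL : nat -> V -> R) (x y : V) (s B : R) :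
  s != 0 -> (forall tau : R, 0 < tau -> exists l, `|GL l x - gm x| <= tau /\
    `|GL l y - gm y| <= tau /\ `|(Gk y - GL l y) - (Gk x - GL l x)| <= B * `|s|) ->
  `|s^-1 * (Gk y - Gk x) - s^-1 * (gm y - gm x)| <= B.
Proof.
move=> s0 h; have s0' : 0 < `|s| by rewrite normr_gt0.
apply/ler_addgt0Pr => t t0.
have t'0 : 0 < t * `|s| / 2 by rewrite divr_gt0// mulr_gt0.
have [l [h1 [h2 h3]]] := h _ t'0.
have -> : s^-1 * (Gk y - Gk x) - s^-1 * (gm y - gm x) =
  s^-1 * (((Gk y - GL l y) - (Gk x - GL l x)) + ((GL l y - gm y) - (GL l x - gm x))).
  by ring.
rewrite normrM normfV ler_pdivrMl//.
apply: le_trans (ler_normD _ _) _.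
have h4 := ler_normB (GL l y - gm y) (GL l x - gm x).
apply: (le_trans (lerD h3 (le_trans h4 (lerD h2 h1)))).
by rewrite le_eqVlt; apply/orP; left; apply/eqP; field.
Qed.

Variables (g : V -> \bar R).
Hypothesis hg : coulomb_kernel g.
Local Notation gam := (fine \o g).
Variable eta : nat -> V -> R.
Hypothesis ae : approx_identity eta.

Let G k := convolve dx gam (eta k).
Let igam := kernel_integrable hg.

Lemma smooth_mollified_kernel k : smooth (G k).
Proof. exact: (smooth_conv igam (mlf_smooth (ae.1 k)) (mlf_periodic (ae.1 k))). Qed.

Lemma laplacian_mollified_kernel k x : laplacian (G k) x = 1 - eta k x.
Proof.
rewrite (@laplacian_conv_kernel _ _ g hg (eta k) x (mlf_smooth (ae.1 k)) (mlf_periodic (ae.1 k))).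
by rewrite (mlf_int (ae.1 k)).
Qed.

Lemma kernel_continuous x : ~ lattice_set x -> {for x, continuous gam}.
Proof.
move=> xL; have gx : g x \is a fin_num.
  apply/negPn/negP => h; apply: xL.
  by have [n ->] := coulomb_fin_num hg h; exists n.
have h : g y @[y --> x] --> (fine (g x))%:E.
  by rewrite fineK//; exact: (@coulomb_continuous _ _ _ hg x).
exact: (fine_cvg h).
Qed.

Section off_lattice.
Variables (x0 : V) (i : 'I_d).
Hypothesis x0L : ~ lattice_set x0.

(** Near a point off the lattice and for large indices, the mollifiers vanish, so
    that the difference of two mollified kernels is harmonic; it is uniformly small,
    and the gradient estimate makes its gradient small. *)
Lemma mollified_kernel_cauchy : exists2 dl : R, 0 < dl & forall tau : R, 0 < tau ->
  exists K, forall k, (K <= k)%N -> (`|G k x0 - gam x0| <= tau /\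
    forall x, sup_ball x0 dl x -> `|G k x - gam x| <= tau) /\
    forall l, (K <= l)%N -> forall x, sup_ball x0 dl x ->
      `|pderiv i (G k) x - pderiv i (G l) x| <= tau.
Proof.
have [r r0 hr] := lattice_dist x0L.
pose dl := r / 4.
have dl0 : 0 < dl by rewrite divr_gt0.
have ballL x : sup_ball x0 (2 * dl) x -> ~ lattice_set x.
  move=> hx [n xn]; have := hr (- n); rewrite latticeN -xn -normrN opprB.
  have := sup_ball_norm (mulr_ge0 (ler0n _ 2) (ltW dl0)) hx.
  by rewrite /dl; lra.
have [K1 hK1] := ae.2 dl dl0.
have eta0 k x : (K1 <= k)%N -> sup_ball x0 (2 * dl) x -> eta k x = 0.
  move=> Kk hx; apply/eqP/negPn/negP => /(hK1 k Kk)[n hn].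
  have h1 := sup_ball_norm (mulr_ge0 (ler0n _ 2) (ltW dl0)) hx.
  have := hr n; have -> : x0 + lattice n = (x + lattice n) - (x - x0).
    by rewrite opprB addrCA [x + lattice n]addrC addrK.
  have := ler_normB (x + lattice n) (x - x0).
  by rewrite /dl in hn h1 *; lra.
have close (tau : R) : 0 < tau -> exists K, forall k, (K <= k)%N ->
    forall x, sup_ball x0 (2 * dl) x -> `|G k x - gam x| <= tau.
  move=> tau0.
  have [e e0 he] := compact_uniform_continuity (@compact_sup_ball x0 (2 * dl))
    (fun x hx => kernel_continuous (ballL x hx)) tau0.
  have e2 : 0 < e / 2 by rewrite divr_gt0.
  have [K hK] := ae.2 _ e2.
  exists K => k Kk x hx.
  apply: (conv_close (ae.1 k) igam (kernel_periodic hg) (hK k Kk)) => z hz.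
  by apply: he => //; apply: le_lt_trans hz _; lra.
exists dl => // tau tau0.
have sub x : sup_ball x0 dl x -> sup_ball x0 (2 * dl) x.
  by move=> h j; apply: le_trans (h j) _; lra.
have [Ka hKa] := close _ tau0.
pose t2 := tau * dl / (2 * (d%:R + 1)).
have d1 : (0 : R) < d%:R + 1 by rewrite ltr_wpDl.
have t20 : 0 < t2 by rewrite divr_gt0// mulr_gt0.
have [Kb hKb] := close _ t20.
exists (maxn K1 (maxn Ka Kb)) => k; rewrite !geq_max => /and3P[k1 k2 k3].
have x0b : sup_ball x0 (2 * dl) x0.
  by move=> j; rewrite subrr normr0; lra.
split; first by split=> [|x hx]; [exact: hKa|apply: hKa => //; exact: sub].
move=> l; rewrite !geq_max => /and3P[l1 l2 l3] x hx.
have sk := smooth_mollified_kernel k; have sl := smooth_mollified_kernel l.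
have sB := smoothB sk sl.
rewrite -pderivB//.
have sub2 y : sup_ball x dl y -> sup_ball x0 (2 * dl) y.
  move=> hy j; rewrite -(subrK (x ord0 j) (y ord0 j)) -addrA.
  apply: le_trans (ler_normD _ _) _.
  have := hy j; have := hx j; lra.
have := @gradient_estimate _ _ (fun y => G k y - G l y) x dl (2 * t2) 0 i sB dl0 _ _.
move=> h; apply: (le_trans (h _ _)).
- move=> y /sub2 hy; have := hKb k k3 y hy; have := hKb l l3 y hy.
  move=> h1 h2; have -> : G k y - G l y = (G k y - gam y) - (G l y - gam y) by ring.
  by apply: le_trans (ler_normB _ _) _; lra.
- move=> y /sub2 hy; rewrite laplacianB// !laplacian_mollified_kernel.
  by rewrite !eta0// subrr normr0.
- rewrite !mul0r addr0.
  rewrite (_ : _ / dl = tau * (d%:R / (d%:R + 1))); last first.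
    by rewrite /t2; field; rewrite !gt_eqF.
  rewrite -[leRHS]mulr1; apply: ler_wpM2l; first exact: ltW.
  by rewrite ler_pdivrMr// mul1r lerDl.
Qed.

(** Local uniform convergence of the mollified kernels and of their derivatives
    yields the differentiability of the kernel itself. *)
Lemma kernel_pderiv_cvg : derivable gam x0 (basis_vec i) /\
  pderiv i (G k) x0 @[k --> \oo] --> pderiv i gam x0.
Proof.
have [dl dl0 hC] := mollified_kernel_cauchy.
have x0b : sup_ball x0 dl x0 by move=> j; rewrite subrr normr0 ltW.
have cG : cvg (pderiv i (G k) x0 @[k --> \oo]).
  apply/cauchy_cvgP/cauchyP => e e0.
  have e2 : 0 < e / 2 by rewrite divr_gt0.
  have [K hK] := hC _ e2.
  exists (pderiv i (G K) x0); exists K => // k /= Kk.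
  rewrite /ball/= distrC; have [_ h] := hK k Kk.
  by apply: le_lt_trans (h K (leqnn _) _ x0b) _; lra.
have /cvg_ex[p hp] := cG.
pose q (s : R) := s^-1 * (gam (x0 + s *: basis_vec i) - gam x0).
have qp : q s @[s --> 0^'] --> p.
  apply/cvgrPdist_le => e e0.
  have e4 : 0 < e / 4 by rewrite divr_gt0.
  have [K hK] := hC _ e4.
  have [K' _ hK'] : \forall k \near \oo, `|p - pderiv i (G k) x0| <= e / 4.
    by move/cvgrPdist_le : hp => /(_ _ e4).
  pose k := maxn K K'.
  have [kx kl] := hK k (leq_maxl _ _).
  have kp : `|p - pderiv i (G k) x0| <= e / 4 by apply: hK'; exact: leq_maxr.
  have sk := smooth_mollified_kernel k.
  have eG : (fun h : R => h^-1 *: ((G k \o shift x0) (h *: basis_vec i) - G k x0)) =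
      (fun s : R => s^-1 * (G k (x0 + s *: basis_vec i) - G k x0)).
    by apply/funext => s /=; rewrite [s *: _ + _]addrC.
  have cGk : s^-1 * (G k (x0 + s *: basis_vec i) - G k x0)
      @[s --> 0^'] --> pderiv i (G k) x0.
    have := @smooth_derivable _ _ (G k) x0 (basis_vec i) sk.
    by rewrite /pderiv /derive /derivable eG => h; exact: h.
  have /cvgrPdist_le/(_ _ e4) := cGk.
  move=> hs; near=> s.
  have s0 : s != 0 by near: s; exact: nbhs_dnbhs_neq.
  have sdl : `|s| <= dl by near: s; exact: dnbhs0_le.
  have hks : `|pderiv i (G k) x0 - s^-1 * (G k (x0 + s *: basis_vec i) - G k x0)| <= e / 4.
    by near: s.
  have hball (r : R) : `|r| <= dl -> sup_ball x0 dl (x0 + r *: basis_vec i).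
    move=> rdl j; rewrite !mxE eqxx/= [x0 _ _ + _]addrC addrK normrM.
    by case: (j == i); rewrite ?normr1 ?normr0 ?mulr1 ?mulr0// ltW.
  have hq : `|s^-1 * (G k (x0 + s *: basis_vec i) - G k x0) - q s| <= e / 4.
    apply: (@quotient_limit_close (G k) gam G) => // tau tau0.
    have [L hL] := hC _ tau0.
    pose l := maxn K L.
    have [[lx0 lx] _] := hL l (leq_maxr _ _).
    exists l; split => //; split; first exact: lx _ (hball _ sdl).
    have sl := smooth_mollified_kernel l.
    apply: (@line_increment_le (fun y => G k y - G l y) i x0 s (e / 4) (smoothB sk sl)) => r rs.
    rewrite (pderivB _ _ sk sl); apply: kl; first exact: leq_maxl.
    by apply: hball; exact: le_trans rs sdl.
  have -> : p - q s = (p - pderiv i (G k) x0) +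
     ((pderiv i (G k) x0 - s^-1 * (G k (x0 + s *: basis_vec i) - G k x0)) +
      (s^-1 * (G k (x0 + s *: basis_vec i) - G k x0) - q s)) by ring.
  apply: le_trans (ler_normD _ _) _.
  have h3 := ler_normD (pderiv i (G k) x0 - s^-1 * (G k (x0 + s *: basis_vec i) - G k x0))
      (s^-1 * (G k (x0 + s *: basis_vec i) - G k x0) - q s).
  apply: le_trans (lerD kp (le_trans h3 (lerD hks hq))) _.
  lra.
have qE : (fun h : R => h^-1 *: ((gam \o shift x0) (h *: basis_vec i) - gam x0)) = q.
  by apply/funext => s; rewrite /q /= [s *: _ + _]addrC.
split; first by rewrite /derivable qE; apply/cvg_ex; exists p.
by rewrite {2}/pderiv /derive qE (cvg_lim _ qp).
Unshelve. all: by end_near. Qed.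

End off_lattice.
End kernel_pointwise.

(** * The gradient of the kernel *)

Section lattice_null.
Context {R : realType} {d : nat}.
Local Notation V := 'rV[R]_d.
Local Notation dx := (lebesgue_torus R d).

Lemma set1_box (a : V) : [set a] = [set v | forall i, v ord0 i \in `[a ord0 i, a ord0 i]].
Proof.
rewrite predeqE => v; split=> [->|h] /=; first by move=> i; rewrite in_itv/= lexx.
by apply/rowP => i; have := h i; rewrite in_itv/= -eq_le => /eqP.
Qed.

Lemma measurable_set1_rV (a : V) : measurable [set a].
Proof. by rewrite set1_box; exact: measurable_box. Qed.

Lemma measurable_lattice_set : measurable (@lattice_set R d).
Proof.
rewrite (_ : lattice_set = \bigcup_n [set lattice n]); last first.
  by rewrite predeqE => x; split=> [[n ->]|[n _ ->]]; exists n.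
apply: countable_bigcupT_measurable; first exact: countableP.
by move=> n; exact: measurable_set1_rV.
Qed.

Hypothesis hd : (1 <= d)%N.

Lemma lebesgue_set1_rV (a : V) : lebesgue_rV d [set a] = 0%E.
Proof.
rewrite set1_box lebesgue_rV_box (bigD1 (Ordinal hd))//=.
by rewrite lebesgue_measure_itv/= lte_fin ltxx mul0e.
Qed.

Lemma lattice_set_null : dx lattice_set = 0%E.
Proof.
apply/eqP; rewrite -measure_le0 /lebesgue_torus/= /mrestr.
rewrite -(lebesgue_set1_rV 0); apply: le_measure; rewrite ?inE.
- by apply: measurableI; [exact: measurable_lattice_set|exact: measurable_unit_cube].
- exact: measurable_set1_rV.
move=> x [[n ->] h]; have c0 : unit_cube (0 + lattice 0 : V).
  by move=> i; rewrite !mxE addr0 in_itv/= oppr_le0 invr_ge0 ler0n invr_gt0 ltr0n.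
have -> : n = 0 by apply: (fundamental_cube.2 0) c0; rewrite add0r.
by apply/rowP => i; rewrite !mxE.
Qed.

Lemma Rintegral_off_lattice (f h : V -> R) : measurable_fun setT f ->
  measurable_fun setT h -> (forall x, ~ lattice_set x -> f x = h x) ->
  \int[dx]_x f x = \int[dx]_x h x.
Proof.
move=> mf mh fh; congr fine; apply: ae_eq_integral => //; try exact/measurable_EFinP.
exists lattice_set; split; [exact: measurable_lattice_set|exact: lattice_set_null|].
by move=> x /= hx; apply: contrapT => xL; apply: hx => _; rewrite fh.
Qed.

End lattice_null.

Section periodic_mollification.
Context {R : realType} {d : nat}.
Local Notation V := 'rV[R]_d.
Local Notation dx := (lebesgue_torus R d).

Lemma periodic_uniform_continuity (f : V -> R) (tau : R) : continuous f ->
  lattice_periodic f -> 0 < tau ->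
  exists2 dl : R, 0 < dl & forall x z, `|x - z| < dl -> `|f z - f x| <= tau.
Proof.
move=> cf pf tau0.
have [dl dl0 h] := compact_uniform_continuity (@compact_closed_cube R d)
  (fun x _ => cf x) tau0.
exists dl => // x z xz; have [n hn] := lattice_translate x.
rewrite -(pf n x) -(pf n z); apply: h; first exact: sub_closed_cube.
by rewrite opprD addrACA subrr addr0.
Qed.

Variable eta : nat -> V -> R.
Hypothesis ae : approx_identity eta.

Lemma mollify_close (f : V -> R) (tau : R) : continuous f -> lattice_periodic f ->
  0 < tau -> exists K, forall k, (K <= k)%N -> forall x, `|convolve dx f (eta k) x - f x| <= tau.
Proof.
move=> cf pf tau0; have [e e0 he] := periodic_uniform_continuity cf pf tau0.
have e2 : 0 < e / 2 by rewrite divr_gt0.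
have [K hK] := ae.2 _ e2; exists K => k Kk x.
apply: (conv_close (ae.1 k) (periodic_integrable dx cf pf) pf (hK k Kk)) => z hz.
by apply: he; apply: le_lt_trans hz _; lra.
Qed.

End periodic_mollification.

Section kernel_gradient_integrable.
Context {R : realType} {d : nat}.
Local Notation V := 'rV[R]_d.
Local Notation dx := (lebesgue_torus R d).
Hypothesis hd : (1 <= d)%N.
Variables (g : V -> \bar R).
Hypothesis hg : coulomb_kernel g.
Local Notation gam := (fine \o g).
Variable eta : nat -> V -> R.
Hypothesis ae : approx_identity eta.
Variable i : 'I_d.

Let G k := convolve dx gam (eta k).
Let D k := pderiv i (G k).
Let igam := kernel_integrable hg.

Let sG k : smooth (G k). Proof. exact: (smooth_mollified_kernel hg ae). Qed.
Let pG k : lattice_periodic (G k).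
Proof. exact: (lattice_periodic_conv _ _ (mlf_periodic (ae.1 k))). Qed.
Let cD k : continuous (D k).
Proof. exact/smooth_continuous/smooth_pderiv. Qed.
Let pD k : lattice_periodic (D k).
Proof. exact/lattice_periodic_pderiv. Qed.
Let mD k : measurable_fun setT (D k).
Proof. exact: (continuous_measurable_rV (@cD k)). Qed.
Let iD k : dx.-integrable setT (EFin \o D k).
Proof. exact: (periodic_integrable dx (@cD k) (@pD k)). Qed.
Let iaD k : dx.-integrable setT (EFin \o (fun x => `|D k x|)).
Proof. exact: (@integrable_norm _ _ _ dx setT (D k) (iD k)). Qed.

Let sgn k x : R := if D k x < 0 then -1 else 1.

Let msgn k : measurable_fun setT (sgn k).
Proof. by apply: measurable_fun_ifT => //; exact: measurable_fun_ltr. Qed.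

Let sgnD k x : sgn k x * D k x = `|D k x|.
Proof. by rewrite /sgn; case: ltP => h; [rewrite mulN1r ltr0_norm|rewrite mul1r ger0_norm]. Qed.

Let sgn1 k x : `|sgn k x| <= 1.
Proof. by rewrite /sgn; case: ifP => _; rewrite ?normrN normr1. Qed.

(** Duality with the sign of the gradient. *)
Lemma mollified_gradient_L1 : exists2 C : R, 0 < C & forall k, \int[dx]_x `|D k x| <= C.
Proof.
pose A := \int[dx]_x `|gam x - clamp 0 (gam x)|.
have A0 : 0 <= A by apply: Rintegral_ge0 => x _.
exists (d%:R * (0 + A) / 1 + 1); first by rewrite ltr_wpDl// divr_ge0// mulr_ge0// add0r.
move=> k; have := @kernel_gradient_test _ _ g hg (eta k) (ae.1 k) (sgn k) (msgn k) (sgn1 k) i 1 0 ltr01 (lexx _).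
rewrite mul0r; apply: le_trans; rewrite (_ : (fun x => sgn k x * _) = (fun x => `|D k x|)).
  exact: ler_norm.
by apply/funext => x; rewrite -sgnD.
Qed.

(** Duality with the sign of the gradient on the set where it exceeds [N]; by
    Chebyshev's inequality that set is small, and so is the integral of the test
    function. *)
Lemma mollified_gradient_ui (tau : R) : 0 < tau -> exists2 N : R, 0 <= N &
  forall k, \int[dx]_x `|D k x - clamp N (D k x)| <= tau.
Proof.
move=> tau0; have [C C0 hC] := mollified_gradient_L1.
pose a := tau / 2; have a0 : 0 < a by rewrite divr_gt0.
have d1 : (0 : R) < d%:R + 1 by rewrite ltr_wpDl.
(* Half of [tau] is the term [a] of the duality estimate; [t] is chosen so that its
   other term is at most [tau / 2] too. *)
pose t := tau * a / (4 * (d%:R + 1)).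
have t0 : 0 < t by rewrite divr_gt0// mulr_gt0.
have [N1 N10 hN1] := sub_clamp_small igam t0.
have N11 : 0 < N1 + 1 by rewrite ltr_wpDl.
pose ka := t / (N1 + 1); have ka0 : 0 < ka by rewrite divr_gt0.
pose N := C / ka; have N0 : 0 < N by rewrite divr_gt0.
exists N; first exact: ltW.
move=> k; pose F x := sgn k x * (if N < `|D k x| then 1 else 0).
have mF : measurable_fun setT F.
  apply: measurable_funM => //; apply: measurable_fun_ifT => //.
  by apply: measurable_fun_ltr => //; exact: measurableT_comp.
have F1 x : `|F x| <= 1.
  rewrite /F normrM -[leRHS]mulr1; apply: ler_pM => //.
  by case: ifP => _; rewrite ?normr1 ?normr0.
have iF : dx.-integrable setT (EFin \o F) := bounded_integrable_prob dx mF F1.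
have iaF := @integrable_norm _ _ _ dx setT F iF.
have FN x : `|F x| <= N^-1 * `|D k x|.
  rewrite /F; case: ltP => h; last by rewrite mulr0 normr0 mulr_ge0// invr_ge0 ltW.
  rewrite mulr1 (le_trans (sgn1 k x))// ler_pdivlMl// mulr1 ltW//.
have intF : \int[dx]_x `|F x| <= ka.
  apply: (@le_trans _ _ (N^-1 * \int[dx]_x `|D k x|)).
    rewrite -(RintegralZl N^-1 measurableT (iaD k)); apply: le_Rintegral => //.
    exact: (integrableZl measurableT N^-1 (iaD k)).
  rewrite ler_pdivrMl// (_ : N * ka = C)//.
  by rewrite /N divfK// gt_eqF.
have h := @kernel_gradient_test _ _ g hg (eta k) (ae.1 k) F mF F1 i a N1 a0 N10.
have iFD : dx.-integrable setT (EFin \o (fun x => F x * D k x)).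
  have [M hM] := periodic_bounded (@cD k) (@pD k).
  exact: (integrableM_bounded iF (mD k) hM).
apply: (@le_trans _ _ (\int[dx]_x (F x * D k x))).
  apply: le_Rintegral => //.
    exact: (@integrable_norm _ _ _ dx setT _ (sub_clamp_integrable (ltW N0) (iD k))).
  move=> x _; rewrite /F; case: ltP => hx.
    by rewrite mulr1 sgnD sub_clamp_le// ltW.
  by rewrite mulr0 mul0r clamp_id// subrr normr0.
apply: le_trans (ler_norm _) _; apply: (le_trans h).
have e1 : N1 * \int[dx]_x `|F x| <= t.
  apply: (@le_trans _ _ (N1 * ka)); first exact: ler_wpM2l.
  rewrite /ka mulrA ler_pdivrMr// mulrC; apply: ler_wpM2l; first exact: ltW.
  by rewrite lerDl.
have e2 : d%:R * (N1 * \int[dx]_x `|F x| + \int[dx]_x `|gam x - clamp N1 (gam x)|) / a <=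
    d%:R * (t + t) / a.
  rewrite ler_pdivrMr// divfK ?gt_eqF//; apply: ler_wpM2l => //; exact: lerD.
apply: (le_trans (lerD e2 (lexx a))).
have -> : d%:R * (t + t) / a = tau / 2 * (d%:R / (d%:R + 1)).
  by rewrite /t; field; rewrite !gt_eqF.
have e3 : tau / 2 * (d%:R / (d%:R + 1)) <= tau / 2 * 1.
  apply: ler_wpM2l; first by rewrite divr_ge0// ltW.
  by rewrite ler_pdivrMr// mul1r lerDl.
by apply: (le_trans (lerD e3 (lexx a))); rewrite /a; lra.
Qed.

Let c0 := pderiv i gam 0.
(** The value on the lattice makes the convergence hold everywhere. *)
Let D' k x := if x \in lattice_set then c0 else D k x.

Let mD' k : measurable_fun setT (D' k).
Proof.
apply: measurable_fun_ifT => //.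
by apply: (measurable_fun_bool true) => //=; rewrite setTI;
  have := @measurable_lattice_set R d; congr measurable;
  rewrite predeqE => x /=; split => [/mem_set|/set_mem].
Qed.

Let D'E k x : ~ lattice_set x -> D' k x = D k x.
Proof. by move=> xL; rewrite /D' memNset. Qed.

Let D'_cvg x : D' k x @[k --> \oo] --> pderiv i gam x.
Proof.
have [[n xn]|xL] := pselect (lattice_set x).
  rewrite (_ : (fun k => D' k x) = cst c0); last first.
    by apply/funext => k; rewrite /D' mem_set//; exists n.
  have -> : pderiv i gam x = c0.
    by rewrite xn -[lattice n]add0r (lattice_periodic_pderiv i (kernel_periodic hg)).
  exact: cvg_cst.
rewrite (_ : (fun k => D' k x) = (fun k => D k x)); last first.
  by apply/funext => k; rewrite D'E.
exact: (kernel_pderiv_cvg hg ae i xL).2.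
Qed.

Let vitali_D : dx.-integrable setT (EFin \o pderiv i gam) /\
  forall phi : V -> R, measurable_fun setT phi -> (exists M, forall x, `|phi x| <= M) ->
    \int[dx]_x (D' k x * phi x) @[k --> \oo] --> \int[dx]_x (pderiv i gam x * phi x).
Proof.
apply: vitali.
- by apply: (le_lt_trans (probability_le1 (dx : probability V R) measurableT)); rewrite ltry.
- move=> k; have [M hM] := periodic_bounded (@cD k) (@pD k).
  apply: (@bounded_integrable_prob _ _ dx _ (Num.max `|c0| M)) => // x.
  by rewrite /D'; case: ifP => _; rewrite le_max ?lexx// hM orbT.
- exact: D'_cvg.
- move=> tau tau0; have [N N0 hN] := mollified_gradient_ui tau0.
  exists N => // k; have <- : \int[dx]_x `|D k x - clamp N (D k x)| =
      \int[dx]_x `|D' k x - clamp N (D' k x)|; last exact: hN.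
  have mcl (f : V -> R) : measurable_fun setT f ->
      measurable_fun setT (fun x => `|f x - clamp N (f x)|).
    move=> mf; apply: measurableT_comp => //; apply: measurable_funB => //.
    exact: (measurableT_comp (measurable_clamp N) mf).
  apply: (Rintegral_off_lattice hd); [exact: mcl|exact: mcl|].
  by move=> x xL; rewrite D'E.
Qed.

Lemma kernel_gradient_integrable : dx.-integrable setT (EFin \o pderiv i gam).
Proof. exact: vitali_D.1. Qed.

(** Integration by parts and Fubini move the derivative and the mollifier to [f]. *)
Lemma mollified_gradient_conv (f : V -> R) x k : smooth f -> lattice_periodic f ->
  \int[dx]_z (D k z * f (x - z)) = convolve dx gam (fun y => convolve dx (pderiv i f) (eta k) y) x.
Proof.
move=> sf pf; have cf := smooth_continuous sf.
have sfx := smooth_sub_rV x sf.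
have sdf : smooth (pderiv i f) by exact: smooth_pderiv.
have cdf := smooth_continuous sdf.
have pdf := lattice_periodic_pderiv i pf.
have ce := smooth_continuous (mlf_smooth (ae.1 k)).
have pe := mlf_periodic (ae.1 k).
have dE z : pderiv i (fun y => f (x - y)) z = - pderiv i f (x - z).
  by apply: derive_sub_rV; exact: smooth_differentiable.
transitivity (\int[dx]_z (f (x - z) * pderiv i (G k) z)).
  by apply: eq_Rintegral => z _; rewrite mulrC.
rewrite (@Rintegral_by_parts _ _ i (fun z => f (x - z)) (G k)); last 8 first.
- exact: smooth_continuous.
- exact: lattice_periodic_sub.
- by move=> y; exact: smooth_derivable.
- exact/smooth_continuous/smooth_pderiv.
- exact: smooth_continuous.
- exact: pG.
- by move=> y; exact: smooth_derivable.
- exact: cD.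
have [M hM] := periodic_bounded ce pe.
have mc : measurable_fun setT (fun z : V * V => eta k (z.1 - z.2)).
  exact: (measurableT_comp (continuous_measurable_rV ce) measurable_sub_rV2).
have ih : dx.-integrable setT (EFin \o (fun z => pderiv i f (x - z))).
  by apply: periodic_integrable; [exact: continuous_sub_rV|exact: lattice_periodic_sub].
transitivity (\int[dx]_z (pderiv i f (x - z) * \int[dx]_y (gam y * eta k (z - y)))).
  have iG : dx.-integrable setT (EFin \o (fun z => G k z * pderiv i (fun y => f (x - y)) z)).
    apply: periodic_integrable.
      exact: (contM (smooth_continuous (@sG k)) (smooth_continuous (smooth_pderiv i sfx))).
    apply: (lattice_periodic2 *%R (@pG k)).
    exact: (lattice_periodic_pderiv i (lattice_periodic_sub x pf)).
  rewrite -mulN1r -(RintegralZl (-1) measurableT iG).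
  by apply: eq_Rintegral => z _; rewrite dE mulN1r mulrN opprK mulrC.
rewrite (fubini_bounded ih igam mc (fun z => hM _)) convE.
apply: eq_Rintegral => y _; congr (_ * _); rewrite convE.
rewrite -(@Rintegral_torus_sub _ _ x (fun z => pderiv i f (x - z) * eta k (z - y))).
- by apply: eq_Rintegral => z _ /=; rewrite opprB addrC subrK addrAC.
- by apply: contM; [exact: continuous_sub_rV|exact: continuous_shift_rV].
- apply: (lattice_periodic2 *%R); first exact: lattice_periodic_sub.
  exact: lattice_periodic_shift.
Qed.

(** The pointwise gradient of the kernel is its distributional gradient: there is
    no singular part on the lattice. *)
Lemma kernel_gradient_conv (f : V -> R) x : smooth f -> lattice_periodic f ->
  \int[dx]_z (pderiv i gam z * f (x - z)) = convolve dx gam (pderiv i f) x.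
Proof.
move=> sf pf; have cf := smooth_continuous sf.
have sdf : smooth (pderiv i f) by exact: smooth_pderiv.
have cdf := smooth_continuous sdf.
have pdf := lattice_periodic_pderiv i pf.
have cfx := @continuous_sub_rV _ _ x _ cf.
have [M hM] := periodic_bounded cf pf.
have h1 := vitali_D.2 (fun z => f (x - z)) (continuous_measurable_rV cfx)
  (ex_intro _ M (fun z => hM (x - z))).
have h2 : \int[dx]_z (D' k z * f (x - z)) @[k --> \oo] --> convolve dx gam (pderiv i f) x.
  apply/cvgrPdist_le => e e0.
  pose A := \int[dx]_x `|gam x|.
  have A0 : 0 <= A by apply: Rintegral_ge0 => y _.
  have A1 : 0 < A + 1 by rewrite ltr_wpDl.
  have t0 : 0 < e / (A + 1) by rewrite divr_gt0.
  have [K hK] := mollify_close ae cdf pdf t0.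
  exists K => // k /= Kk.
  have -> : \int[dx]_z (D' k z * f (x - z)) = \int[dx]_z (D k z * f (x - z)).
    have mfx := continuous_measurable_rV cfx.
    apply: (Rintegral_off_lattice hd); [exact: measurable_funM|exact: measurable_funM|].
    by move=> z zL; rewrite D'E.
  rewrite mollified_gradient_conv//.
  have sc : continuous (fun y => convolve dx (pderiv i f) (eta k) y).
    exact: (smooth_continuous (smooth_conv (periodic_integrable dx cdf pdf)
      (mlf_smooth (ae.1 k)) (mlf_periodic (ae.1 k)))).
  have pc : lattice_periodic (fun y => convolve dx (pderiv i f) (eta k) y).
    exact: (lattice_periodic_conv _ _ (mlf_periodic (ae.1 k))).
  have cB : continuous (fun y => pderiv i f y - convolve dx (pderiv i f) (eta k) y).
    exact: contB.
  have := @conv_bound _ _ dx gam igam _ x (e / (A + 1)) cB _.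
  rewrite convE.
  have -> : \int[dx]_z (gam z * (pderiv i f (x - z) - convolve dx (pderiv i f) (eta k) (x - z))) =
    convolve dx gam (pderiv i f) x - convolve dx gam (fun y => convolve dx (pderiv i f) (eta k) y) x.
    rewrite !convE -(RintegralB measurableT (conv_integrable igam x cdf pdf) (conv_integrable igam x sc pc)).
    by apply: eq_Rintegral => z _; rewrite mulrBr.
  move=> h; apply: le_trans (h _) _; first by move=> y; rewrite distrC; exact: hK.
  rewrite -/A mulrAC ler_pdivrMr//; apply: ler_wpM2l; first exact: ltW.
  by rewrite lerDl.
exact: (cvg_unique _ h1 h2).
Qed.

End kernel_gradient_integrable.

(** * Periodization of a mollifier *)

Section smooth_local.
Context {R : realType} {W : normedModType R}.
Implicit Types (f h : W -> R).

Lemma smooth_affine f (a c : R) (b : W) : smooth f -> smooth (fun x => c * f (a *: x + b)).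
Proof.
move=> sf.
have da x vs : differentiable (fun x => iter_derive vs f (a *: x + b)) x.
  apply: (@differentiable_comp _ _ _ _ (fun x : W => a *: x + b) (iter_derive vs f)); last exact: sf.
  apply: (@differentiableD _ _ _ (fun x : W => a *: x) (cst b)); last exact: differentiable_cst.
  by apply: (@differentiableZ _ _ _ id); exact: ex_diff.
have e vs : iter_derive vs (fun x => c * f (a *: x + b)) =
    (fun x => (c * a ^+ size vs) * iter_derive vs f (a *: x + b)).
  elim: vs => [|v vs IH] /=; first by apply/funext => x; rewrite expr0 mulr1.
  rewrite IH; apply/funext => x.
  rewrite (_ : (fun z => _) = (c * a ^+ size vs) \*: (fun z => iter_derive vs f (a *: z + b)))//.
  rewrite deriveZ; last exact/diff_derivable/da.
  have -> : 'D_v (fun z => iter_derive vs f (a *: z + b)) x =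
      'D_(a *: v) (iter_derive vs f) (a *: x + b).
    rewrite /derive; congr (lim (_ @ 0^')); apply/funext => h /=.
    by congr (_ *: (iter_derive vs f _ - _)); rewrite scalerDr !scalerA mulrC addrA.
  rewrite derive_dirZ; last exact: sf.
  by rewrite [_ *: _]mulrA exprSr mulrA.
move=> vs x; rewrite e.
apply: (@differentiableM _ _ (cst (c * a ^+ size vs)) (fun x => iter_derive vs f (a *: x + b))).
  exact: differentiable_cst.
exact: da.
Qed.

Lemma differentiable_local f h (x : W) (e : R) : 0 < e -> differentiable h x ->
  (forall z, `|z - x| < e -> f z = h z) -> differentiable f x.
Proof.
move=> e0 dh fh; rewrite (_ : f = (f - h) + h); last by rewrite subrK.
apply: differentiableD => //; apply: (@differentiable_quadratic _ _ _ _ 0).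
near=> z; rewrite !fctE mul0r (fh x) ?subrr ?normr0//.
rewrite (fh (x + z)) ?subrr ?normr0// addrC addKr.
by near: z; exact: nbhs0_lt.
Unshelve. all: by end_near. Qed.

Lemma smooth_local f : (forall x, exists h, smooth h /\
  exists2 e : R, 0 < e & forall z, `|z - x| < e -> f z = h z) -> smooth f.
Proof.
move=> hf vs x; have [h [sh [e e0 fh]]] := hf x.
suff : forall z, `|z - x| < e -> iter_derive vs f z = iter_derive vs h z.
  by move=> E; apply: (differentiable_local e0 (sh vs x) E).
elim: vs => [//|v vs IH] z zx /=.
apply: near_eq_derive; near=> y; apply: IH.
rewrite -(subrK z y) -addrA; apply: le_lt_trans (ler_normD _ _) _.
rewrite -ltrBrDr; near: y.
have e1 : 0 < e - `|z - x| by rewrite subr_gt0.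
by apply/nbhs_normP; exists (e - `|z - x|) => //= y; rewrite /= distrC.
Unshelve. all: by end_near. Qed.

End smooth_local.

Section periodization.
Context {R : realType} {d : nat}.
Local Notation V := 'rV[R]_d.
Local Notation dx := (lebesgue_torus R d).

Definition periodize (psi : V -> R) (z : V) : R :=
  \sum_(n \in [set: 'rV[int]_d]) psi (z + lattice n).

Lemma lattice_norm_lt1 (n m : 'rV[int]_d) : `|lattice n - lattice m : V| < 1 -> n = m.
Proof.
move=> h; apply/rowP => i; apply/eqP; rewrite -subr_eq0 -normr_le0 -ltzD1 add0r.
rewrite -(ltr_int R) intr_norm rmorphB/=; apply: le_lt_trans h.
by have := rV_coord_le (lattice n - lattice m : V) i; rewrite !mxE.
Qed.

Section one_profile.
Variables (psi : V -> R).
Hypothesis supp : forall x, psi x != 0 -> `|x| <= 4^-1.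

Lemma periodize_unique z n : (forall m, m != n -> psi (z + lattice m) = 0) ->
  periodize psi z = psi (z + lattice n).
Proof.
move=> h; rewrite /periodize -(fsbig_widen [set n]) ?fsbig_set1// => m [_ /= /eqP mn].
exact: h.
Qed.

(** Distinct lattice translates of a point are at distance at least one, so at most
    one of them lies in the ball of radius 3/8: the sum has locally a single term. *)
Lemma periodize_local z0 : exists n, forall z, `|z - z0| < 8^-1 ->
  forall m, m != n -> psi (z + lattice m) = 0.
Proof.
(* 1/4 + 1/8 = 3/8, and 3/8 + 3/8 < 1. *)
have key z m : `|z - z0| < 8^-1 -> psi (z + lattice m) != 0 -> `|z0 + lattice m| < 3 / 8.
  move=> zz /supp h; rewrite -(subrK z z0) -addrA.
  apply: le_lt_trans (ler_normD _ _) _; rewrite distrC; lra.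
have [[n hn]|no] := pselect (exists n, `|z0 + lattice n| < 3 / 8).
  exists n => z zz m mn; apply/eqP/negPn/negP => /(key _ _ zz) hm.
  move/eqP : mn; apply; apply: lattice_norm_lt1.
  rewrite (_ : lattice m - lattice n = (z0 + lattice m) - (z0 + lattice n)).
    by apply: le_lt_trans (ler_normB _ _) _; lra.
  by rewrite opprD addrACA subrr add0r.
exists 0 => z zz m _; apply/eqP/negPn/negP => /(key _ _ zz) hm.
by apply: no; exists m.
Qed.

Lemma periodize_at z : exists n, (forall m, m != n -> psi (z + lattice m) = 0) /\
  periodize psi z = psi (z + lattice n).
Proof.
have [n hn] := periodize_local z; exists n.
have h : `|z - z| < 8^-1 by rewrite subrr normr0 invr_gt0.
by split; [exact: hn|apply: periodize_unique; exact: hn].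
Qed.

Lemma periodize_smooth : smooth psi -> smooth (periodize psi).
Proof.
move=> sp; apply: smooth_local => z0; have [n hn] := periodize_local z0.
exists (fun z => 1 * psi (1 *: z + lattice n)); split; first exact: smooth_affine.
exists 8^-1; first by rewrite invr_gt0.
by move=> z zz; rewrite scale1r mul1r; apply: periodize_unique; exact: hn.
Qed.

Lemma periodize_periodic : lattice_periodic (periodize psi).
Proof.
move=> m z; have [n [hn ->]] := periodize_at z.
rewrite (@periodize_unique _ (n - m)) ?latticeD ?latticeN; last first.
  move=> m' hm'; rewrite -addrA -latticeD; apply: hn.
  by apply: contra_neq hm' => <-; rewrite addrC addKr.
by rewrite -addrA [lattice m + _]addrC subrK.
Qed.

Lemma periodize_cube z : unit_cube z -> periodize psi z = psi z.
Proof.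
move=> hz; rewrite (@periodize_unique _ 0).
  by congr psi; apply/rowP => i; rewrite !mxE addr0.
move=> m m0; apply/eqP/negPn/negP => /supp hm.
have [i mi] : exists i, m ord0 i != 0.
  apply/existsP; apply: contraNT m0 => /existsPn h; apply/eqP/rowP => i.
  by rewrite mxE; apply/eqP/negPn/h.
have := rV_coord_le (z + lattice m) i; rewrite !mxE; have := hz i; rewrite in_itv/=.
move=> /andP[z1 z2] hc.
have h1 : 1 <= `|(m ord0 i)%:~R| :> R.
  rewrite -intr_norm -[1](@mulr1z R) ler_int -gtz0_ge1 normr_gt0.
  exact: mi.
have hzn : `|z ord0 i| <= 2^-1 by rewrite ler_norml z1 ltW.
have := ler_normB (z ord0 i + (m ord0 i)%:~R) (z ord0 i).
rewrite [z _ _ + _]addrC addrK [_ + z _ _]addrC => h3; lra.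
Qed.

Lemma periodize_support z : periodize psi z != 0 -> exists n, psi (z + lattice n) != 0.
Proof. by have [n [_ ->]] := periodize_at z; exists n. Qed.

End one_profile.

Lemma periodize_mollifying (psi : V -> R) : (forall x, psi x != 0 -> `|x| <= 4^-1) ->
  smooth psi -> (forall x, 0 <= psi x) -> (\int[lebesgue_rV d]_x (psi x)%:E = 1)%E ->
  mollifying (periodize psi).
Proof.
move=> supp sp p0 pint; split.
- exact: periodize_smooth.
- exact: periodize_periodic.
- by move=> x; have [n [_ ->]] := periodize_at supp x.
have mp := continuous_measurable_rV (smooth_continuous (periodize_smooth supp sp)).
have mpsi := continuous_measurable_rV (smooth_continuous sp).
rewrite /Rintegral ge0_integral_torusE; last 2 first.
- exact/measurable_EFinP.
- by move=> x; rewrite lee_fin; have [n [_ ->]] := periodize_at supp x.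
have <- : fine (\int[lebesgue_rV d]_x (psi x)%:E)%E = 1 by rewrite pint.
congr fine; rewrite [LHS]integral_mkcond; apply: eq_integral => x _; rewrite patchE.
case: ifPn => [/set_mem xc|/negP xc]; first by rewrite periodize_cube.
have [->//|/supp hx] := eqVneq (psi x) 0; exfalso; apply: xc; apply/mem_set => i.
have := rV_coord_le x i; rewrite in_itv/= => h; have := le_trans h hx.
by rewrite ler_norml => /andP[h1 h2]; apply/andP; split; lra.
Qed.

Variables (phi : V -> R) (eps : nat -> R).
Hypotheses (mphi : mollifier phi) (eps0 : forall k, 0 < eps k) (eps_cvg : eps @ \oo --> 0).

Lemma mollifier_bounded_support : exists2 r : R, 0 < r & forall x, phi x != 0 -> `|x| <= r.
Proof.
have [M [_ hM]] := compact_bounded (mollifier_compact mphi).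
exists (`|M| + 1); first by rewrite ltr_wpDl.
move=> x hx; apply: hM; last exact: subset_closure.
by rewrite (le_lt_trans (ler_norm M))// ltrDl.
Qed.

Lemma smooth_rescale (e : R) : smooth (rescale phi e).
Proof.
have := @smooth_affine R V phi e^-1 (e ^- d) 0 (mollifier_smooth mphi).
by under eq_fun do rewrite addr0.
Qed.

Lemma rescale_int (e : R) : 0 < e -> (\int[lebesgue_rV d]_x (rescale phi e x)%:E = 1)%E.
Proof.
move=> e0; have ei : 0 < e^-1 by rewrite invr_gt0.
have ed : 0 < e ^+ d by rewrite exprn_gt0.
have mp := continuous_measurable_rV (smooth_continuous (mollifier_smooth mphi)).
have p0 := mollifier_ge0 mphi.
under eq_integral do rewrite /rescale EFinM.
have mz : measurable_fun setT (fun x : V => (phi (e^-1 *: x))%:E).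
  apply/measurable_EFinP; apply: (measurableT_comp mp).
  apply: measurable_fun_rV => i; under eq_fun do rewrite mxE.
  by apply: measurable_funM => //; exact: measurable_coord.
rewrite ge0_integralZl_EFin//; last 2 first.
- by move=> x _; rewrite lee_fin.
- by rewrite invr_ge0 ltW.
rewrite (@ge0_integral_lebesgue_rVZ _ _ e^-1 (fun x => (phi x)%:E))//; last first.
  exact/measurable_EFinP.
rewrite mollifier_int// mule1 -EFinM exprVn invrK mulVf//.
by rewrite gt_eqF.
Qed.

(** The shift [K0] makes the supports small enough for the periodization to have
    disjoint terms. *)
Lemma rescale_approx_identity : exists K0,
  approx_identity (fun k => periodize (rescale phi (eps (k + K0)%N))).
Proof.
have [r r0 hr] := mollifier_bounded_support.
have small (c : R) : 0 < c -> exists K, forall k, (K <= k)%N -> r * eps k <= c.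
  move=> c0; have /cvgrPdist_le/(_ (c / r)) := eps_cvg.
  case; first by rewrite divr_gt0.
  move=> K _ hK; exists K => k /hK /=; rewrite sub0r normrN gtr0_norm//.
  by rewrite ler_pdivlMr// mulrC.
have supp e x : 0 < e -> rescale phi e x != 0 -> `|x| <= r * e.
  move=> e0; rewrite /rescale mulf_eq0 negb_or => /andP[_ /hr].
  by rewrite normrZ gtr0_norm ?invr_gt0// mulrC ler_pdivrMr.
have [|K0 hK0] := small 4^-1; first by rewrite invr_gt0.
have supp4 k x : rescale phi (eps (k + K0)%N) x != 0 -> `|x| <= 4^-1.
  by move=> /(supp _ _ (eps0 _)) h; apply: le_trans h (hK0 _ (leq_addl _ _)).
exists K0; split => [k|dl dl0].
  apply: periodize_mollifying; [exact: supp4|exact: smooth_rescale| |exact: rescale_int].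
  move=> x; rewrite /rescale; apply: mulr_ge0; last exact: mollifier_ge0 mphi _.
  by rewrite invr_ge0 exprn_ge0// ltW.
have [K hK] := small dl dl0; exists K => k Kk y /(periodize_support (supp4 k))[n hn].
exists n; apply: le_trans (supp _ _ (eps0 _) hn) _.
by apply: hK; apply: leq_trans Kk (leq_addr _ _).
Qed.

End periodization.

(** * Measures with a smooth density *)

Section densities.
Context {R : realType} {d : nat}.
Local Notation V := 'rV[R]_d.
Local Notation dx := (lebesgue_torus R d).

Lemma Rintegral_density (f : V -> R) (eta : torus_prob R d) (F : V -> R) :
  is_density f eta -> measurable_fun setT F ->
  \int[eta]_x F x = \int[dx]_x (F x * f x).
Proof.
move=> [mf f0 fE] mF; congr fine.
rewrite (integral_density mf f0 fE); last exact/measurable_EFinP.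
by apply: eq_integral => x _; rewrite EFinM.
Qed.

Lemma density_int (f : V -> R) (eta : torus_prob R d) : is_density f eta ->
  \int[dx]_x f x = 1.
Proof.
move=> hf; rewrite -(Rintegral_prob_cst eta 1) (Rintegral_density hf)//.
by apply: eq_Rintegral => x _; rewrite mul1r.
Qed.

Lemma density_integrable (f : V -> R) (eta : torus_prob R d) : is_density f eta ->
  dx.-integrable setT (EFin \o f).
Proof.
move=> [mf f0 fE]; apply/integrableP; split; first exact/measurable_EFinP.
under eq_integral do rewrite /= ger0_norm//.
rewrite -fE//; apply: le_lt_trans (ltry 1); exact: (@probability_le1 _ _ _ eta).
Qed.

Section force.
Hypothesis hd : (1 <= d)%N.
Variables (g : V -> \bar R).
Hypothesis hg : coulomb_kernel g.
Local Notation gam := (fine \o g).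
Variable eta : nat -> V -> R.
Hypothesis ae : approx_identity eta.

(** The substitution [y |-> x - y] exchanges the kernel and the density, after which
    the derivative passes from the kernel to the density. *)
Lemma force_smooth_density (f : V -> R) (nu : torus_prob R d) i x :
  is_density f nu -> smooth f -> lattice_periodic f ->
  force g nu i x = pderiv i (convolve dx gam f) x.
Proof.
move=> hf sf pf; have iD := kernel_gradient_integrable hd hg ae i.
have mD : measurable_fun setT (pderiv i gam).
  by apply/measurable_EFinP; exact: (measurable_int _ iD).
have mx : measurable_fun setT (fun y : V => x - y).
  by apply: measurable_fun_rV => j; under eq_fun do rewrite !mxE; apply: measurable_funB => //; exact: measurable_coord.
rewrite (@pderiv_conv _ _ dx gam (kernel_integrable hg) i f x sf pf).
rewrite -(kernel_gradient_conv hd hg ae i x sf pf).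
rewrite /force (Rintegral_density hf); last exact: (measurableT_comp mD mx).
have mf := density_measurable hf.
rewrite /Rintegral; congr fine.
rewrite -(@integral_torus_sub _ _ x (fun z => (pderiv i gam z * f (x - z))%:E)).
- by apply: eq_integral => y _; rewrite [x - (x - y)](_ : _ = y)// opprB addrC subrK.
- by apply/measurable_EFinP; apply: measurable_funM => //; exact: (measurableT_comp mf mx).
- move=> n z; rewrite (lattice_periodic_pderiv i (kernel_periodic hg)).
  by rewrite opprD addrA -latticeN pf.
Qed.

End force.

Section mollified_measure.
Variables (mu : torus_prob R d) (eta : V -> R).
Hypothesis me : mollifying eta.

Definition mollify_measure := convolve mu (cst 1) eta.

Let i1 : mu.-integrable setT (EFin \o (cst 1 : V -> R)).
Proof. exact: finite_measure_integrable_cst. Qed.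

Lemma mollify_measureE x : mollify_measure x = \int[mu]_y eta (x - y).
Proof. by rewrite /mollify_measure convE; apply: eq_Rintegral => z _; rewrite mul1r. Qed.

Lemma smooth_mollify_measure : smooth mollify_measure.
Proof. exact: (smooth_conv i1 (mlf_smooth me) (mlf_periodic me)). Qed.

Lemma periodic_mollify_measure : lattice_periodic mollify_measure.
Proof. exact: lattice_periodic_conv (mlf_periodic me). Qed.

Variable m : V -> R.
Hypothesis hm : is_density m mu.

Let ce := smooth_continuous (mlf_smooth me).

Let mollify_density x : mollify_measure x = \int[dx]_y (eta (x - y) * m y).
Proof.
rewrite mollify_measureE (Rintegral_density hm)//.
exact: (continuous_measurable_rV (@continuous_sub_rV R d x eta (@ce))).
Qed.

Let iem x : dx.-integrable setT (fun y => (eta (x - y) * m y)%:E).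
Proof.
have [M hM] := periodic_bounded (@ce) (mlf_periodic me).
have := integrableM_bounded (density_integrable hm)
  (continuous_measurable_rV (@continuous_sub_rV R d x eta (@ce))) (fun y => hM (x - y)).
by apply: eq_integrable => // y _; rewrite mulrC.
Qed.

Lemma mollify_measure_ge (l : R) x : 0 <= l -> (\forall y \ae dx, l <= m y) -> l <= mollify_measure x.
Proof.
move=> l0 lm; rewrite mollify_density -[l]mulr1 -(mlf_int_sub me x).
have i2 := mlf_integrable_sub me x.
rewrite -(RintegralZl l measurableT i2) -lee_fin.
rewrite /Rintegral !fineK; last 2 first.
- exact: (integrable_fin_num measurableT (iem x)).
- exact: (integrable_fin_num measurableT (integrableZl measurableT l i2)).
apply: (ae_ge0_le_integral measurableT _ (measurable_int _ (integrableZl measurableT l i2)) _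
  (measurable_int _ (iem x))).
- by move=> y _; rewrite -EFinM lee_fin mulr_ge0// (mlf_ge0 me).
- by move=> y _; rewrite lee_fin mulr_ge0// ?(mlf_ge0 me)// (density_ge0 hm).
apply: filterS lm => y ly _; rewrite lee_fin mulrC.
by apply: ler_wpM2l => //; exact: (mlf_ge0 me).
Qed.

Lemma mollify_measure_le (M : R) x : 0 <= M -> (\forall y \ae dx, m y <= M) -> mollify_measure x <= M.
Proof.
move=> M0 lm; rewrite mollify_density -[M]mulr1 -(mlf_int_sub me x).
have i2 := mlf_integrable_sub me x.
rewrite -(RintegralZl M measurableT i2) -lee_fin.
rewrite /Rintegral !fineK; last 2 first.
- exact: (integrable_fin_num measurableT (integrableZl measurableT M i2)).
- exact: (integrable_fin_num measurableT (iem x)).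
apply: (ae_ge0_le_integral measurableT _ (measurable_int _ (iem x)) _
  (measurable_int _ (integrableZl measurableT M i2))).
- by move=> y _; rewrite lee_fin mulr_ge0// ?(mlf_ge0 me)// (density_ge0 hm).
- by move=> y _; rewrite -EFinM lee_fin mulr_ge0// (mlf_ge0 me).
apply: filterS lm => y ly _; rewrite lee_fin [leRHS]mulrC.
by apply: ler_wpM2l => //; exact: (mlf_ge0 me).
Qed.

End mollified_measure.

Lemma mollifying_opp (eta : V -> R) : mollifying eta -> mollifying (fun x => eta (- x)).
Proof.
move=> me; have e x : eta (- x) = eta (0 - x) by rewrite sub0r.
split.
- by rewrite (_ : (fun x => _) = (fun x => eta (0 - x))); [apply: smooth_sub_rV; exact: mlf_smooth me|exact/funext].
- by move=> n x; rewrite opprD -latticeN (mlf_periodic me).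
- by move=> x; exact: mlf_ge0 me _.
- rewrite (_ : (fun x => _) = (fun x => eta (0 - x))); last exact/funext.
  exact: mlf_int_sub.
Qed.

Lemma approx_identity_opp (eta : nat -> V -> R) : approx_identity eta ->
  approx_identity (fun k x => eta k (- x)).
Proof.
move=> [me ce]; split=> [k|dl dl0]; first exact: mollifying_opp.
have [K hK] := ce _ dl0; exists K => k Kk y /(hK k Kk)[n hn].
by exists (- n); rewrite -normrN opprD latticeN opprK.
Qed.

(** By Fubini, mollifying the measure is mollifying the test function with the
    reflected mollifier. *)
Lemma mollify_measure_cvg (mu : torus_prob R d) (eta : nat -> V -> R) (f : V -> R) :
  approx_identity eta -> continuous f -> lattice_periodic f ->
  \int[dx]_x (f x * mollify_measure mu (eta k) x) @[k --> \oo] --> \int[mu]_x f x.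
Proof.
move=> ae cf pf; apply/cvgrPdist_le => e e0.
have [K hK] := mollify_close (approx_identity_opp ae) cf pf e0.
exists K => // k /= Kk.
have ifx := periodic_integrable dx cf pf.
have i1 : mu.-integrable setT (EFin \o (cst 1 : V -> R)).
  exact: finite_measure_integrable_cst.
have ck := smooth_continuous (mlf_smooth (ae.1 k)).
have mk : measurable_fun setT (fun z : V * V => eta k (z.1 - z.2)).
  exact: (measurableT_comp (continuous_measurable_rV ck) (@measurable_sub_rV2 R d)).
have [M hM] := periodic_bounded ck (mlf_periodic (ae.1 k)).
have -> : \int[dx]_x (f x * mollify_measure mu (eta k) x) =
    \int[mu]_y convolve dx f (fun x => eta k (- x)) y.
  rewrite (@fubini_bounded _ _ _ _ _ dx mu f (cst 1) _ M ifx i1 mk (fun z => hM _)).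
  apply: eq_Rintegral => y _; rewrite mul1r convE; apply: eq_Rintegral => z _.
  by rewrite opprB.
have sk := mlf_smooth (mollifying_opp (ae.1 k)).
have pk := mlf_periodic (mollifying_opp (ae.1 k)).
have i2 := periodic_integrable mu cf pf.
have i3 : mu.-integrable setT (EFin \o convolve dx f (fun x => eta k (- x))).
  apply: periodic_integrable; last exact: lattice_periodic_conv.
  exact/smooth_continuous/(smooth_conv ifx sk pk).
rewrite -(RintegralB measurableT i2 i3).
apply: Rintegral_prob_le; last by move=> x; rewrite distrC; exact: hK.
apply: measurable_funB; apply/measurable_EFinP; [exact: (measurable_int _ i2)|exact: (measurable_int _ i3)].
Qed.

End densities.

(** * Differentiating integrals in time *)

Section quadratic_remainder.
Context {R : realType}.

Lemma sqr_normr (s : R) : s ^+ 2 = `|s| ^+ 2.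
Proof. by rewrite real_normK ?num_real. Qed.

Lemma is_derive_quadratic_remainder (F : R -> R) (t a C : R) :
  (forall s, `|s| <= 1 -> `|F (t + s) - F t - s * a| <= C * s ^+ 2) -> is_derive t 1 F a.
Proof.
move=> hF.
have key : h^-1 *: ((F \o shift t) (h *: 1) - F t) @[h --> 0^'] --> a.
  apply/cvgrPdist_le => e e0; near=> h.
  have h0 : h != 0 by near: h; exact: nbhs_dnbhs_neq.
  have h1 : `|h| <= 1 by near: h; exact: dnbhs0_le.
  have C1 : 0 < `|C| + 1 by rewrite ltr_wpDl.
  have he : `|h| <= e / (`|C| + 1) by near: h; apply: dnbhs0_le; rewrite divr_gt0.
  rewrite /= [h%:A]mulr1 [h + t]addrC.
  have -> : a - h^-1 *: (F (t + h) - F t) = - (h^-1 * (F (t + h) - F t - h * a)).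
    by rewrite [_ *: _]/(h^-1 * _) mulrBr mulKf// opprB.
  rewrite normrN normrM normfV ler_pdivrMl ?normr_gt0//.
  apply: (le_trans (hF h h1)); apply: (@le_trans _ _ ((`|C| + 1) * h ^+ 2)).
    by apply: ler_wpM2r; [exact: sqr_ge0|rewrite ler_wpDr// ler_norm].
  rewrite sqr_normr expr2 mulrCA; apply: ler_wpM2l => //.
  by rewrite mulrC -ler_pdivlMr.
split; first by apply/cvg_ex; exists a.
exact: cvg_lim key.
Unshelve. all: by end_near. Qed.

End quadratic_remainder.

Section periodic_algebra.
Context {R : realType} {d : nat}.
Local Notation V := 'rV[R]_d.
Implicit Types (f h : V -> R).

(** The test functions of narrow convergence on the torus. *)
Definition torus_continuous f := continuous f /\ lattice_periodic f.

Lemma tcont_cst (c : R) : torus_continuous (fun=> c).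
Proof. by split=> // x; exact: cst_continuous. Qed.

Lemma tcontD f h : torus_continuous f -> torus_continuous h ->
  torus_continuous (fun x => f x + h x).
Proof. by move=> [cf pf] [ch ph]; split; [exact: contD|exact: (lattice_periodic2 +%R)]. Qed.

Lemma tcontN f : torus_continuous f -> torus_continuous (fun x => - f x).
Proof. by move=> [cf pf]; split; [exact: contN|exact: (lattice_periodic_comp -%R)]. Qed.

Lemma tcontB f h : torus_continuous f -> torus_continuous h ->
  torus_continuous (fun x => f x - h x).
Proof. by move=> hf hh; exact: (tcontD hf (tcontN hh)). Qed.

Lemma tcontM f h : torus_continuous f -> torus_continuous h ->
  torus_continuous (fun x => f x * h x).
Proof. by move=> [cf pf] [ch ph]; split; [exact: contM|exact: (lattice_periodic2 *%R)]. Qed.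

Lemma tcont_comp (op : R -> R) f : continuous op -> torus_continuous f ->
  torus_continuous (fun x => op (f x)).
Proof.
move=> co [cf pf]; split; last exact: (lattice_periodic_comp op).
by move=> x; apply: continuous_comp; [exact: cf|exact: co].
Qed.

Lemma tcont_sum (I : Type) (r : seq I) (f : I -> V -> R) :
  (forall i, torus_continuous (f i)) -> torus_continuous (fun x => \sum_(i <- r) f i x).
Proof.
move=> hf; split; first by apply: cont_sum => i _; exact: (hf i).1.
by move=> n x; apply: eq_bigr => i _; rewrite (hf i).2.
Qed.

Lemma tcont_smooth f : smooth f -> lattice_periodic f -> torus_continuous f.
Proof. by move=> sf pf; split => //; exact: smooth_continuous. Qed.

Lemma tcont_bounded f : torus_continuous f -> exists2 M : R, 0 <= M & forall x, `|f x| <= M.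
Proof.
move=> [cf pf]; have [M hM] := periodic_bounded cf pf.
by exists M => //; apply: le_trans (hM 0).
Qed.

Section integral.
Variable nu : probability V R.

Lemma tcont_integrable f : torus_continuous f -> nu.-integrable setT (EFin \o f).
Proof. by move=> [cf pf]; exact: (periodic_integrable nu cf pf). Qed.

Lemma tcont_RintegralB f h : torus_continuous f -> torus_continuous h ->
  \int[nu]_x (f x - h x) = \int[nu]_x f x - \int[nu]_x h x.
Proof. by move=> hf hh; exact: (RintegralB measurableT (tcont_integrable hf) (tcont_integrable hh)). Qed.

Lemma tcont_RintegralD f h : torus_continuous f -> torus_continuous h ->
  \int[nu]_x (f x + h x) = \int[nu]_x f x + \int[nu]_x h x.
Proof. by move=> hf hh; exact: (RintegralD measurableT (tcont_integrable hf) (tcont_integrable hh)). Qed.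

Lemma tcont_RintegralZ c f : torus_continuous f ->
  \int[nu]_x (c * f x) = c * \int[nu]_x f x.
Proof. by move=> hf; exact: (RintegralZl c measurableT (tcont_integrable hf)). Qed.

Lemma tcont_RintegralN f : torus_continuous f -> \int[nu]_x (- f x) = - \int[nu]_x f x.
Proof.
move=> hf; rewrite -mulN1r -tcont_RintegralZ//.
by apply: eq_Rintegral => x _; rewrite mulN1r.
Qed.

Lemma tcont_Rintegral_sum (I : Type) (r : seq I) (f : I -> V -> R) :
  (forall i, torus_continuous (f i)) ->
  \int[nu]_x (\sum_(i <- r) f i x) = \sum_(i <- r) \int[nu]_x f i x.
Proof.
move=> hf; elim: r => [|i r IH].
  rewrite big_nil -[RHS](Rintegral_prob_cst nu 0).
  by apply: eq_Rintegral => x _; rewrite big_nil.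
rewrite big_cons -IH -tcont_RintegralD//; last exact: tcont_sum.
by apply: eq_Rintegral => x _; rewrite big_cons.
Qed.

Lemma tcont_le_Rintegral f h : torus_continuous f -> torus_continuous h ->
  (forall x, f x <= h x) -> \int[nu]_x f x <= \int[nu]_x h x.
Proof.
move=> hf hh fh.
by apply: (le_Rintegral measurableT (tcont_integrable hf) (tcont_integrable hh)) => x _.
Qed.

Lemma tcont_Rintegral_norm f (M : R) : torus_continuous f -> (forall x, `|f x| <= M) ->
  `|\int[nu]_x f x| <= M.
Proof. by move=> [cf _]; exact: Rintegral_prob_le (continuous_measurable_rV cf). Qed.

End integral.

End periodic_algebra.

Section time_derivative.
Context {R : realType} {d : nat}.
Local Notation V := 'rV[R]_d.
Local Notation dx := (lebesgue_torus R d).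
Implicit Types (q : R * V -> R).

Lemma smooth_snd (f : V -> R) : smooth f -> smooth (fun z : R * V => f z.2).
Proof.
move=> sf; have e vs : iter_derive vs (fun z : R * V => f z.2) =
    (fun z => iter_derive [seq v.2 | v <- vs] f z.2).
  elim: vs => [//|v vs IH] /=; rewrite IH; apply/funext => z.
  by rewrite /derive; congr (lim (_ @ 0^')).
move=> vs z; rewrite e.
apply: (@differentiable_comp _ _ _ _ (@snd R V) (iter_derive _ f)); last exact: sf.
by apply: linear_differentiable => y; exact: cvg_snd.
Qed.

Lemma time_deriv_snd (f : V -> R) (z : R * V) : time_deriv (fun z : R * V => f z.2) z = 0.
Proof.
rewrite /time_deriv /derive; apply: cvg_lim => //.
rewrite (_ : (fun h => _) = cst 0); first exact: cvg_cst.
by apply/funext => h /=; rewrite scaler0 add0r subrr scaler0.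
Qed.

Lemma tcont_slice q t : smooth q -> space_periodic q -> torus_continuous (fun x => q (t, x)).
Proof. by move=> sq pq; apply: tcont_smooth => //; exact: smooth_slice. Qed.

Lemma smooth_time_deriv q : smooth q -> smooth (time_deriv q).
Proof. exact: smooth_derive. Qed.

Lemma space_periodic_time_deriv q : space_periodic q -> space_periodic (time_deriv q).
Proof. exact: space_periodic_derive. Qed.

Lemma time_taylor q t : smooth q -> space_periodic q ->
  exists2 C : R, 0 <= C & forall s x, `|s| <= 1 ->
    `|q (t + s, x) - q (t, x) - s * time_deriv q (t, x)| <= C * s ^+ 2.
Proof.
move=> sq pq; pose e : R * V := (1, 0).
have sqt := smooth_time_deriv sq.
have [||M hM] := @periodic_time_bounded _ _ (time_deriv (time_deriv q)) (t - 1) (t + 1).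
- exact/smooth_continuous/smooth_time_deriv.
- exact/space_periodic_time_deriv/space_periodic_time_deriv.
have M0 : 0 <= M.
  by apply: le_trans (hM t 0 _) => //; rewrite in_itv/= gerBl ler01 lerDl ler01.
exists M => // s x s1.
have dv z : 'D_(s *: e) q z = s * time_deriv q z.
  exact/derive_dirZ/smooth_differentiable.
have ddv z : 'D_(s *: e) ('D_(s *: e) q) z = s ^+ 2 * time_deriv (time_deriv q) z.
  rewrite (_ : 'D_(s *: e) q = s \*: time_deriv q); last exact/funext.
  rewrite deriveZ; last exact: (@smooth_derivable _ _ _ z _ sqt).
  rewrite derive_dirZ; last exact: smooth_differentiable.
  by rewrite expr2 -mulrA.
have pe r : (t, x) + r *: e = (t + r, x).
  apply: injective_projections => /=; first by rewrite [_ *: _]mulr1.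
  by rewrite scaler0 addr0.
rewrite -pe -dv mulrC; apply: second_order_bound => // r r01.
rewrite ddv normrM ger0_norm ?sqr_ge0//; apply: ler_wpM2l; first exact: sqr_ge0.
rewrite scalerA pe; apply: hM; rewrite in_itv/= -ler_distlC opprD addNKr normrN.
rewrite normrM; move: r01; rewrite in_itv/= => /andP[r0 r1].
by rewrite mulr_ile1// ger0_norm.
Qed.

(** The Taylor remainder of [q] in time is quadratic uniformly in space, so that the
    derivative can be taken under the integral as soon as [Psi] has a quadratic
    remainder itself.  This covers functions which are not twice differentiable. *)
Lemma time_integral_is_derive q (f : V -> R) (Psi psi : R -> R) (K t : R) :
  smooth q -> space_periodic q -> torus_continuous f ->
  continuous Psi -> continuous psi -> 0 <= K ->
  (forall a b, `|Psi b - Psi a - psi a * (b - a)| <= K * (b - a) ^+ 2) ->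
  is_derive t 1 (fun s => \int[dx]_x (f x * Psi (q (s, x))))
    (\int[dx]_x (f x * (psi (q (t, x)) * time_deriv q (t, x)))).
Proof.
move=> sq pq tf cPsi cpsi K0 hK.
have [C C0 hC] := time_taylor t sq pq.
have tq s := tcont_slice s sq pq.
have tqt : torus_continuous (fun x => time_deriv q (t, x)).
  by apply: tcont_slice; [exact: smooth_time_deriv|exact: space_periodic_time_deriv].
have [C1 C10 hC1] := tcont_bounded tqt.
have tpsi := tcont_comp cpsi (tq t).
have [C2 C20 hC2] := tcont_bounded tpsi.
have [C3 C30 hC3] := tcont_bounded tf.
have tF s := tcontM tf (tcont_comp cPsi (tq s)).
have tG := tcontM tf (tcontM tpsi tqt).
apply: (@is_derive_quadratic_remainder _ _ _ _ (C3 * (K * (C1 + C) ^+ 2 + C2 * C))) => s s1.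
rewrite -(tcont_RintegralB dx (tF _) (tF _)) -(tcont_RintegralZ dx s tG).
rewrite -(tcont_RintegralB dx (tcontB (tF _) (tF _)) (tcontM (tcont_cst s) tG)).
apply: tcont_Rintegral_norm.
  by apply: tcontB; [apply: tcontB|exact: (tcontM (tcont_cst s) tG)].
move=> x; set a := q (t, x); set b := q (t + s, x); set p := time_deriv q (t, x).
have h1 : `|b - a| <= (C1 + C) * `|s|.
  rewrite -(subrK (s * p) (b - a)); apply: le_trans (ler_normD _ _) _.
  rewrite addrC mulrDl; apply: lerD.
    by rewrite normrM mulrC ler_wpM2r// hC1.
  apply: le_trans (hC s x s1) _; apply: ler_wpM2l => //.
  by rewrite sqr_normr expr2 ler_piMl.
have -> : f x * Psi b - f x * Psi a - s * (f x * (psi a * p)) =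
    f x * ((Psi b - Psi a - psi a * (b - a)) + psi a * (b - a - s * p)) by ring.
rewrite normrM -mulrA; apply: ler_pM => //.
rewrite mulrDl; apply: le_trans (ler_normD _ _) _; apply: lerD.
  apply: le_trans (hK a b) _; rewrite -mulrA; apply: ler_wpM2l => //.
  by rewrite [(b - a) ^+ 2]sqr_normr [s ^+ 2]sqr_normr -exprMn lerXn2r ?nnegrE ?mulr_ge0 ?addr_ge0.
by rewrite normrM -mulrA; apply: ler_pM; [| |exact: hC2|exact: (hC s x s1)].
Qed.

End time_derivative.

(** * Integration by parts and the squared deficit *)

Section torus_C1.
Context {R : realType} {d : nat}.
Local Notation V := 'rV[R]_d.
Local Notation dx := (lebesgue_torus R d).
Implicit Types (f h : V -> R).

(** The squared deficit of a smooth density is no more than once differentiable. *)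
Definition torus_C1 f := torus_continuous f /\
  forall i, (forall x, derivable f x (basis_vec i)) /\ continuous (pderiv i f).

Lemma C1_smooth f : smooth f -> lattice_periodic f -> torus_C1 f.
Proof.
move=> sf pf; split; first exact: tcont_smooth.
move=> i; split=> [x|]; first exact: (@smooth_derivable _ _ f x _ sf).
exact/smooth_continuous/smooth_pderiv.
Qed.

Lemma tcont_pderiv f i : torus_C1 f -> torus_continuous (pderiv i f).
Proof. by move=> [[_ pf] df]; split; [exact: (df i).2|exact: lattice_periodic_pderiv]. Qed.

Lemma C1M f h : torus_C1 f -> torus_C1 h -> torus_C1 (fun x => f x * h x).
Proof.
move=> cf ch; split; first exact: tcontM cf.1 ch.1.
move=> i; split=> [x|].
  by apply: derivableM; [exact: (cf.2 i).1|exact: (ch.2 i).1].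
rewrite (_ : pderiv i _ = (fun x => f x * pderiv i h x + h x * pderiv i f x)); last first.
  by apply/funext => x; apply: pderivM; [exact: (cf.2 i).1|exact: (ch.2 i).1].
exact: (tcontD (tcontM cf.1 (tcont_pderiv i ch)) (tcontM ch.1 (tcont_pderiv i cf))).1.
Qed.

Lemma C1_by_parts f h i : torus_C1 f -> torus_C1 h ->
  \int[dx]_x (f x * pderiv i h x) = - \int[dx]_x (h x * pderiv i f x).
Proof.
move=> cf ch; apply: Rintegral_by_parts.
- exact: cf.1.1.
- exact: cf.1.2.
- exact: (cf.2 i).1.
- exact: (cf.2 i).2.
- exact: ch.1.1.
- exact: ch.1.2.
- exact: (ch.2 i).1.
- exact: (ch.2 i).2.
Qed.

Lemma C1_integral_pderiv0 f i : torus_C1 f -> \int[dx]_x pderiv i f x = 0.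
Proof.
move=> cf; apply: Rintegral_pderiv0.
- exact: cf.1.1.
- exact: cf.1.2.
- exact: (cf.2 i).1.
- exact: (cf.2 i).2.
Qed.

Lemma C1_pderiv f i : smooth f -> lattice_periodic f -> torus_C1 (pderiv i f).
Proof. by move=> sf pf; apply: C1_smooth; [exact: smooth_pderiv|exact: lattice_periodic_pderiv]. Qed.

Lemma green f h : torus_C1 f -> smooth h -> lattice_periodic h ->
  \int[dx]_x (f x * laplacian h x) = - \sum_i \int[dx]_x (pderiv i f x * pderiv i h x).
Proof.
move=> cf sh ph; transitivity (\int[dx]_x (\sum_i f x * pderiv i (pderiv i h) x)).
  by apply: eq_Rintegral => x _; rewrite mulr_sumr.
rewrite tcont_Rintegral_sum; last first.
  by move=> i; apply: tcontM cf.1 (tcont_pderiv _ _); exact: C1_pderiv.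
rewrite -sumrN; apply: eq_bigr => i _.
transitivity (- \int[dx]_x (pderiv i h x * pderiv i f x)).
  exact: (@C1_by_parts f (pderiv i h) i cf (C1_pderiv i sh ph)).
by apply: (congr1 -%R); apply: eq_Rintegral => x _; rewrite mulrC.
Qed.

Lemma pderiv_comp (op op' : R -> R) f i x : (forall r : R, is_derive r 1 op (op' r)) ->
  derivable f x (basis_vec i) ->
  derivable (fun y => op (f y)) x (basis_vec i) /\
  pderiv i (fun y => op (f y)) x = op' (f x) * pderiv i f x.
Proof.
move=> dop df; set b := basis_vec i.
have x0 : x + (0 : R) *: b = x by rewrite scale0r addr0.
have d1 : is_derive (0 : R) 1 (fun r => f (x + r *: b)) (pderiv i f x).
  by rewrite -[in pderiv i f x]x0; apply: (@is_derive_line R V f x b 0); rewrite x0.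
have d2 : is_derive (0 : R) 1 (op \o (fun r => f (x + r *: b))) (op' (f x) * pderiv i f x).
  by apply: is_derive1_comp; rewrite x0.
have e : (fun h : R => h^-1 *: (((fun y => op (f y)) \o shift x) (h *: b) - op (f x))) =
    (fun h : R => h^-1 *: (((op \o (fun r => f (x + r *: b))) \o shift 0) (h *: 1) -
       (op \o (fun r => f (x + r *: b))) 0)).
  apply/funext => h /=; rewrite x0 addr0 [h%:A]mulr1.
  by rewrite [h *: b + x]addrC.
case: d2 => [dd de]; split; first by rewrite /derivable e.
by rewrite -de /pderiv /derive e.
Qed.

Lemma C1_comp (op op' : R -> R) f : (forall r : R, is_derive r 1 op (op' r)) ->
  continuous op -> continuous op' -> torus_C1 f -> torus_C1 (fun x => op (f x)).
Proof.
move=> dop cop cop' cf; split; first exact: tcont_comp cf.1.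
move=> i; split=> [x|]; first by have [] := pderiv_comp dop ((cf.2 i).1 x).
rewrite (_ : pderiv i _ = (fun x => op' (f x) * pderiv i f x)); last first.
  by apply/funext => x; have [] := pderiv_comp dop ((cf.2 i).1 x).
exact: (tcontM (tcont_comp cop' cf.1) (tcont_pderiv i cf)).1.
Qed.

Lemma pderiv_at_max (f : V -> R) i (x : V) : torus_C1 f -> (forall y, f y <= f x) -> pderiv i f x = 0.
Proof.
move=> cf fx; pose b : V := basis_vec i.
have x0 : x + (0 : R) *: b = x by rewrite scale0r addr0.
have d1 : is_derive (0 : R) 1 (fun r => f (x + r *: b)) (pderiv i f x).
  by have := @is_derive_line R V f x b 0; rewrite x0 => H; apply: H; exact: (cf.2 i).1.
have d2 : is_derive (0 : R) 1 ((fun r => f (x + r *: b)) \o -%R) (pderiv i f x * -1).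
  by apply: is_derive1_comp; rewrite oppr0.
apply/eqP; rewrite eq_le; apply/andP; split; rewrite leNgt; apply/negP => hlt.
  have [e e0 he] := derive_gt0_right d1 hlt.
  have := he (e / 2); rewrite divr_gt0// gtr_pMr// invf_lt1// ltr1n => /(_ isT isT).
  by rewrite x0 ltNge fx.
have hlt' : 0 < pderiv i f x * -1 by rewrite mulrN1 oppr_gt0.
have [e e0 he] := derive_gt0_right d2 hlt'.
have := he (e / 2); rewrite divr_gt0// gtr_pMr// invf_lt1// ltr1n => /(_ isT isT).
by rewrite /= oppr0 x0 ltNge fx.
Qed.

End torus_C1.

Section deficit.
Context {R : realType}.
Variable lam : R.

Definition pos (r : R) := Num.max r 0.

(** A density may vanish initially, so that it has no positive lower bound; what
    decays is the integral of this convex function, which vanishes above [lam] and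
    has a Lipschitz derivative. *)
Definition deficit (r : R) := pos (lam - r) ^+ 2.

Definition deficit' (r : R) := - 2 * pos (lam - r).

Lemma posP (r : R) : (0 <= r /\ pos r = r) \/ (r <= 0 /\ pos r = 0).
Proof.
by rewrite /pos; case: (leP r 0) => h; [right|left]; split => //; rewrite ltW.
Qed.

Lemma continuous_pos : continuous pos.
Proof. by move=> r; apply: continuous_max; [exact: cvg_id|exact: cst_continuous]. Qed.

Lemma continuous_deficit' : continuous deficit'.
Proof.
apply: contZ => r; apply: (@continuous_comp _ _ _ (fun r => lam - r) pos).
  by apply: (@contB _ _ (cst lam) id) => // x; [exact: cst_continuous|exact: cvg_id].
exact: continuous_pos.
Qed.

Lemma deficit_remainder (a b : R) :
  `|deficit b - deficit a - deficit' a * (b - a)| <= 1 * (b - a) ^+ 2.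
Proof.
rewrite /deficit /deficit' mul1r ler_norml.
have -> : lam - b = (lam - a) - (b - a) by rewrite opprB addrA subrK.
move: (lam - a) (b - a) => p q.
have sq := sqr_ge0 (p - q); have sq' := sqr_ge0 q.
have [[ha ->]|[ha ->]] := posP p; have [[hb ->]|[hb ->]] := posP (p - q).
- by rewrite (_ : _ - _ - _ = q ^+ 2) ?lexx ?andbT; [lra|ring].
- have h1 : 0 <= p * (q - p) by rewrite mulr_ge0//; lra.
  have h2 := sqr_ge0 p.
  by move: sq sq' h1 h2; rewrite !expr2 => *; apply/andP; split; lra.
- have h1 : 0 <= (- p) * (p - q) by rewrite mulr_ge0//; lra.
  have h2 := sqr_ge0 p.
  by move: sq sq' h1 h2; rewrite !expr2 => *; apply/andP; split; lra.
- by move: sq sq'; rewrite !expr2 => *; apply/andP; split; lra.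
Qed.

Lemma deficit_is_derive (r : R) : is_derive r 1 deficit (deficit' r).
Proof.
apply: (@is_derive_quadratic_remainder _ _ _ _ 1) => s _.
by have := deficit_remainder r (r + s); rewrite [r + s]addrC addrK mulrC [s + r]addrC.
Qed.

Lemma continuous_deficit : continuous deficit.
Proof.
move=> r; apply/differentiable_continuous/derivable1_diffP.
by have [] := deficit_is_derive r.
Qed.

Lemma deficit_ge0 r : 0 <= deficit r. Proof. exact: sqr_ge0. Qed.

Lemma deficit_le r : 0 <= r -> 0 < lam -> deficit r <= lam ^+ 2.
Proof.
by move=> r0 l0; rewrite /deficit; have [[h ->]|[h ->]] := posP (lam - r); nra.
Qed.

(** Below [lam] both factors have a sign, and [m - r >= lam - r]; above, everything
    vanishes. *)
Lemma deficit_decay r m : 0 <= r -> 0 < lam -> lam <= m ->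
  (deficit r - r * deficit' r) * (r - m) <= - lam * deficit r.
Proof.
move=> r0 l0 lm; rewrite /deficit /deficit'.
have [[h ->]|[h ->]] := posP (lam - r); last by nra.
have -> : ((lam - r) ^+ 2 - r * (- 2 * (lam - r))) * (r - m) =
  ((lam - r) * (lam + r)) * (r - m) by ring.
have h1 : 0 <= (lam - r) * (lam + r) by rewrite mulr_ge0// addr_ge0// ltW.
apply: (@le_trans _ _ ((lam - r) * (lam + r) * (r - lam))).
  by apply: ler_wpM2l => //; rewrite lerB.
have : 0 <= (lam - r) ^+ 2 * r by rewrite mulr_ge0// sqr_ge0.
rewrite expr2; lra.
Qed.

(** For [r = lam - p] with [p >= 0], the difference of both sides is
    [(lam - p) ^ 2 / (2 lam)]. *)
Lemma deficit_lower r : 0 < lam -> lam / 2 - deficit r / (2 * lam) <= r.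
Proof.
move=> l0; have l2 : 0 < 2 * lam by rewrite mulr_gt0.
rewrite lerBlDl -lerBlDr ler_pdivlMr// /deficit.
have [[h ->]|[h ->]] := posP (lam - r); last first.
  by apply: (@le_trans _ _ 0); [nra|rewrite expr2 mul0r].
have := sqr_ge0 r; rewrite !expr2; lra.
Qed.

End deficit.

(** * Smooth solutions and their upper bound *)

Section flow.
Context {R : realType} {d : nat}.
Local Notation V := 'rV[R]_d.
Local Notation dx := (lebesgue_torus R d).
Variable g : V -> \bar R.
Implicit Types (u : R * V -> R) (m : V -> R).

Definition excess u m (z : R * V) : R := u z - m z.2.

(** The velocity field is minus the gradient of this function. *)
Definition flow_potential u m : R * V -> R := tconv dx (fine \o g) (excess u m).

Definition flow_grad u m (i : 'I_d) (t : R) : V -> R :=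
  pderiv i (fun y => flow_potential u m (t, y)).

Record regular_flow u m (lam M : R) : Prop := {
  rf_smooth : smooth u;
  rf_periodic : space_periodic u;
  rf_target_smooth : smooth m;
  rf_target_periodic : lattice_periodic m;
  rf_ge0 : forall t x, 0 < t -> 0 <= u (t, x);
  rf_int : forall t, 0 < t -> \int[dx]_x u (t, x) = 1;
  rf_target_int : \int[dx]_x m x = 1;
  rf_target_gt0 : 0 < lam;
  rf_target_ge : forall x, lam <= m x;
  rf_target_le : forall x, m x <= M;
  rf_eq : forall t x, 0 < t -> time_deriv u (t, x) =
    \sum_i pderiv i (fun y => u (t, y) * flow_grad u m i t y) x }.

Hypothesis hg : coulomb_kernel g.
Local Notation gam := (fine \o g).
Variables (u : R * V -> R) (m : V -> R) (lam M : R).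
Hypothesis rf : regular_flow u m lam M.
Local Notation w := (excess u m).
Local Notation h := (flow_potential u m).
Local Notation v := (flow_grad u m).

Lemma smooth_excess : smooth w.
Proof.
exact: (@smoothB _ _ u (fun z => m z.2) (rf_smooth rf) (smooth_snd (rf_target_smooth rf))).
Qed.

Lemma periodic_excess : space_periodic w.
Proof. by move=> t n x; rewrite /excess/= (rf_periodic rf) (rf_target_periodic rf). Qed.

Lemma smooth_potential : smooth h.
Proof. exact: (smooth_tconv (kernel_integrable hg) smooth_excess periodic_excess). Qed.

Lemma potentialE t x : h (t, x) = convolve dx gam (fun y => w (t, y)) x.
Proof. exact: tconvE. Qed.

Lemma periodic_potential : space_periodic h.
Proof.
move=> t n x; rewrite !potentialE; apply: lattice_periodic_conv; exact: periodic_excess.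
Qed.

Lemma tcont_density t : torus_continuous (fun x => u (t, x)).
Proof. exact: (tcont_slice t (rf_smooth rf) (rf_periodic rf)). Qed.

Lemma tcont_target : torus_continuous m.
Proof. exact: (tcont_smooth (rf_target_smooth rf) (rf_target_periodic rf)). Qed.

Lemma tcont_excess t : torus_continuous (fun x => w (t, x)).
Proof. exact: (tcont_slice t smooth_excess periodic_excess). Qed.

Lemma tcont_potential t : torus_continuous (fun x => h (t, x)).
Proof. exact: (tcont_slice t smooth_potential periodic_potential). Qed.

Lemma C1_density t : torus_C1 (fun x => u (t, x)).
Proof. exact: (C1_smooth (smooth_slice t (rf_smooth rf)) (rf_periodic rf t)). Qed.

Lemma C1_potential t : torus_C1 (fun x => h (t, x)).
Proof. exact: (C1_smooth (smooth_slice t smooth_potential) (periodic_potential t)). Qed.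

Lemma C1_grad i t : torus_C1 (v i t).
Proof. exact: (C1_pderiv i (smooth_slice t smooth_potential) (periodic_potential t)). Qed.

Lemma C1_flux i t : torus_C1 (fun x => u (t, x) * v i t x).
Proof. exact: (C1M (C1_density t) (C1_grad i t)). Qed.

Lemma tcont_time_deriv t : torus_continuous (fun x => time_deriv u (t, x)).
Proof.
exact: (tcont_slice t (smooth_time_deriv (rf_smooth rf)) (space_periodic_time_deriv (rf_periodic rf))).
Qed.

Lemma time_deriv_excess z : time_deriv w z = time_deriv u z.
Proof.
have h1 := @smooth_derivable _ _ u z (1, 0) (rf_smooth rf).
have h2 := @smooth_derivable _ _ (fun z : R * V => m z.2) z (1, 0) (smooth_snd (rf_target_smooth rf)).
have h3 := time_deriv_snd m z; rewrite /time_deriv in h3.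
by rewrite /time_deriv (deriveB h1 h2) h3 subr0.
Qed.

Lemma integral_excess t : 0 < t -> \int[dx]_x w (t, x) = 0.
Proof.
move=> t0; rewrite [LHS](tcont_RintegralB dx (tcont_density t) tcont_target).
by rewrite (rf_int rf)// (rf_target_int rf) subrr.
Qed.

Lemma laplacian_potential t x : 0 < t -> laplacian (fun y => h (t, y)) x = - w (t, x).
Proof.
move=> t0; rewrite (_ : (fun y => h (t, y)) = convolve dx gam (fun y => w (t, y))); last first.
  by apply/funext => y; exact: potentialE.
rewrite laplacian_conv_kernel//; last 2 first.
- exact: smooth_slice smooth_excess.
- exact: periodic_excess.
by rewrite integral_excess// sub0r.
Qed.

(** The divergence of the velocity is the excess, since the Laplacian of the
    potential is its opposite. *)
Lemma time_deriv_density t x : 0 < t -> time_deriv u (t, x) =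
  \sum_i pderiv i (fun y => u (t, y)) x * v i t x - u (t, x) * w (t, x).
Proof.
move=> t0; rewrite (rf_eq rf)//.
transitivity (\sum_i (pderiv i (fun y => u (t, y)) x * v i t x +
    u (t, x) * pderiv i (v i t) x)).
  apply: eq_bigr => i _; rewrite [LHS](pderivM (((C1_density t).2 i).1 x) (((C1_grad i t).2 i).1 x)).
  by rewrite addrC [v i t x * _]mulrC.
rewrite big_split/= -mulr_sumr.
by have := laplacian_potential x t0; rewrite /laplacian => ->; rewrite mulrN.
Qed.

Lemma time_deriv_test (f : V -> R) t : 0 < t -> torus_C1 f ->
  \int[dx]_x (f x * time_deriv u (t, x)) =
  - \sum_i \int[dx]_x (u (t, x) * v i t x * pderiv i f x).
Proof.
move=> t0 cf; transitivity (\int[dx]_x (\sum_i f x * pderiv i (fun y => u (t, y) * v i t y) x)).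
  by apply: eq_Rintegral => x _; rewrite (rf_eq rf)// mulr_sumr.
rewrite tcont_Rintegral_sum; last first.
  by move=> i; apply: tcontM cf.1 (tcont_pderiv _ _); exact: C1_flux.
rewrite -sumrN; apply: eq_bigr => i _.
exact: (C1_by_parts i cf (C1_flux i t)).
Qed.

Lemma integral_time_deriv t : 0 < t -> \int[dx]_x time_deriv u (t, x) = 0.
Proof.
move=> t0; transitivity (\int[dx]_x (\sum_i pderiv i (fun y => u (t, y) * v i t y) x)).
  by apply: eq_Rintegral => x _; rewrite (rf_eq rf).
rewrite tcont_Rintegral_sum; last by move=> i; exact: tcont_pderiv (C1_flux i t).
by rewrite big1// => i _; apply: C1_integral_pderiv0; exact: C1_flux.
Qed.

(** At a spatial maximum the equation reduces to [u' = - u (u - m)], whose solutions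
    come down from infinity at the rate [1 / t] above the level [M].  The comparison
    is made at a maximum of [r (u (r, z) - M)] over the times [r] in [[0, t]] and the
    points [z] of the torus. *)
Lemma density_le t x : 0 < t -> u (t, x) <= M + t^-1.
Proof.
move=> t0; pose Q (z : R * V) := z.1 * (u z - M).
have cQ : continuous Q.
  apply: contM; first by move=> z; exact: cvg_fst.
  apply: contB; first exact: smooth_continuous (rf_smooth rf).
  by move=> z; exact: cst_continuous.
have cK : compact (`[0, t]%classic `*` @closed_cube R d).
  by apply: compact_setX; [exact: segment_compact|exact: compact_closed_cube].
have [n hn] := lattice_translate x.
have K0 : (`[0, t]%classic `*` @closed_cube R d) (t, x + lattice n).
  by split => /=; [rewrite in_itv/= lexx ltW|exact: sub_closed_cube].
have ne : (`[0, t]%classic `*` @closed_cube R d) !=set0 by exists (t, x + lattice n).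
have [[s y] /set_mem[/= s_in y_in] smax] := compact_EVT_max ne cK (continuous_subspaceT cQ).
have Qmax r z : 0 <= r -> r <= t -> Q (r, z) <= Q (s, y).
  move=> r0 rt; have [n' hn'] := lattice_translate z.
  have -> : Q (r, z) = Q (r, z + lattice n') by rewrite /Q/= (rf_periodic rf).
  apply: smax; apply/mem_set; split => /=; first by rewrite in_itv/= r0.
  exact: sub_closed_cube.
move: s_in; rewrite in_itv/= => /andP[s0 st].
have M0 : 0 <= M.
  by apply: le_trans (rf_target_le rf 0); apply: le_trans (rf_target_ge rf 0); exact/ltW/(rf_target_gt0 rf).
(* Since [Q (t, x) <= Q (s, y)], this gives [t (u (t, x) - M) <= 1]. *)
suff Q1 : Q (s, y) <= 1.
  have := le_trans (Qmax t x (ltW t0) (lexx t)) Q1; rewrite /Q/= => h1.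
  by rewrite -lerBlDl -[t^-1]mulr1 ler_pdivlMl.
rewrite leNgt; apply/negP => Q1.
have sp : 0 < s by rewrite lt_neqAle s0 andbT; apply/eqP => s00; move: Q1; rewrite /Q/= -s00 mul0r ltr10.
have uM : 0 < u (s, y) - M by rewrite -(pmulr_rgt0 _ sp); apply: lt_trans Q1.
have u_max z : u (s, z) <= u (s, y).
  by have := Qmax s z s0 st; rewrite /Q/= ler_pM2l// lerD2r.
have dt : time_deriv u (s, y) = - (u (s, y) * w (s, y)).
  rewrite time_deriv_density// big1 ?sub0r// => i _.
  by rewrite (pderiv_at_max i (C1_density s) u_max) mul0r.
have d1 : is_derive (s : R) 1 (fun r => u (r, y)) (time_deriv u (s, y)).
  have pe (r : R) : u (r, y) = u ((0, y) + r *: (1, 0)).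
    by congr u; apply: injective_projections => /=; rewrite ?scaler0 ?addr0// add0r [_ *: _]mulr1.
  rewrite (_ : (fun r => u (r, y)) = (fun r => u ((0, y) + r *: (1, 0)))); last exact/funext.
  have es : (0, y) + s *: (1, 0) = (s, y) :> R * V.
    by apply: injective_projections => /=; rewrite ?scaler0 ?addr0// add0r [_ *: _]mulr1.
  rewrite /time_deriv -es; apply: is_derive_line.
  by rewrite es; exact: (@smooth_derivable _ _ u _ _ (rf_smooth rf)).
have d2 : is_derive (s : R) 1 (fun r => Q (r, y)) (s * time_deriv u (s, y) + (u (s, y) - M)).
  rewrite (_ : (fun r => Q (r, y)) = id * ((fun r => u (r, y)) - cst M)); last exact/funext.
  apply: is_derive_eq; rewrite !fctE subr0 [_ *: 1]mulr1.
  by [].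
(* The maximum may be at the final time, so that only past times are compared: at
   [(s, y)] the time derivative of [Q] would be negative. *)
have d3 : is_derive (0 : R) 1 ((fun r => Q (r, y)) \o (fun r => s - r))
    ((s * time_deriv u (s, y) + (u (s, y) - M)) * -1).
  apply: is_derive1_comp; first by rewrite subr0.
  rewrite (_ : (fun r => s - r) = cst s - id); last exact/funext.
  by apply: is_derive_eq; rewrite sub0r.
have dle : 0 < (s * time_deriv u (s, y) + (u (s, y) - M)) * -1.
  rewrite dt mulrN1 oppr_gt0 mulrN.
  have h1 : u (s, y) - M <= w (s, y) by rewrite lerB// (rf_target_le rf).
  have h2 : 1 < s * u (s, y).
    by apply: lt_le_trans Q1 _; rewrite /Q/= ler_pM2l// gerBl.
  rewrite addrC subr_lt0 mulrA.
  by apply: lt_le_trans (_ : s * u (s, y) * (u (s, y) - M) <= _); [rewrite ltr_pMl|rewrite ler_wpM2l// ltW// (lt_trans _ h2)].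
have [e e0 he] := derive_gt0_right d3 dle.
pose r := Num.min (e / 2) s.
have r0 : 0 < r by rewrite lt_min sp divr_gt0.
have re : r < e by rewrite gt_min gtr_pMr// invf_lt1// ltr1n.
have := he r r0 re; rewrite /= add0r subr0 ltNge Qmax//.
- by rewrite subr_ge0 ge_min lexx orbT.
- by apply: le_trans st; rewrite gerBl ltW.
Qed.

End flow.

(** * Time derivatives of the energy and of the deficit *)

Section flow_estimates.
Context {R : realType} {d : nat}.
Local Notation V := 'rV[R]_d.
Local Notation dx := (lebesgue_torus R d).
Variable g : V -> \bar R.
Hypothesis hg : coulomb_kernel g.
Local Notation gam := (fine \o g).

Lemma integral_polarization (a b : V -> R) : torus_continuous a -> torus_continuous b ->
  2^-1 * \int[dx]_x (a x * b x) = 4^-1 * (\int[dx]_x (a x * a x) + \int[dx]_x (b x * b x) -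
    \int[dx]_x ((a x - b x) * (a x - b x))).
Proof.
move=> ta tb; have tab := tcontB ta tb.
rewrite -(tcont_RintegralD dx (tcontM ta ta) (tcontM tb tb)).
rewrite -(tcont_RintegralB dx (tcontD (tcontM ta ta) (tcontM tb tb)) (tcontM tab tab)).
rewrite -(tcont_RintegralZ dx _ (tcontM ta tb)).
rewrite -(tcont_RintegralZ dx _ (tcontB (tcontD (tcontM ta ta) (tcontM tb tb)) (tcontM tab tab))).
by apply: eq_Rintegral => x _; field.
Qed.

Lemma integral_polarization_derive (a b a' b' q' : V -> R) :
  torus_continuous a -> torus_continuous b -> torus_continuous a' -> torus_continuous b' ->
  (forall x, q' x = a' x - b' x) -> \int[dx]_x (b x * a' x) = \int[dx]_x (a x * b' x) ->
  4^-1 * (\int[dx]_x (2 * a x * a' x) + \int[dx]_x (2 * b x * b' x) -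
    \int[dx]_x (2 * (a x - b x) * q' x)) = \int[dx]_x (a x * b' x).
Proof.
move=> ta tb ta' tb' q'E sym.
have t2 f : torus_continuous f -> torus_continuous (fun x : V => 2 * f x).
  by move=> tf; exact: (tcontM (tcont_cst 2) tf).
have i1 := tcontM (t2 _ ta) ta'; have i2 := tcontM (t2 _ tb) tb'.
have i3 := tcontM (t2 _ (tcontB ta tb)) (tcontB ta' tb').
have j1 := tcontM ta tb'; have j2 := tcontM tb ta'.
have -> : \int[dx]_x (2 * (a x - b x) * q' x) = \int[dx]_x (2 * (a x - b x) * (a' x - b' x)).
  by apply: eq_Rintegral => x _; rewrite q'E.
rewrite -(tcont_RintegralD dx i1 i2) -(tcont_RintegralB dx (tcontD i1 i2) i3).
have -> : \int[dx]_x (a x * b' x) = 2^-1 * (\int[dx]_x (a x * b' x) + \int[dx]_x (b x * a' x)).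
  by rewrite sym; field.
rewrite -(tcont_RintegralD dx j1 j2) -(tcont_RintegralZ dx _ (tcontD j1 j2)).
rewrite -(tcont_RintegralZ dx _ (tcontB (tcontD i1 i2) i3)).
by apply: eq_Rintegral => x _; field.
Qed.

Section estimates.
Variables (u : R * V -> R) (m : V -> R) (lam M : R).
Hypothesis rf : regular_flow g u m lam M.
Local Notation w := (excess u m).
Local Notation h := (flow_potential g u m).
Local Notation v := (flow_grad g u m).
Implicit Types (t : R).

Definition flow_deficit (t : R) := \int[dx]_x deficit lam (u (t, x)).
Definition flow_energy (t : R) := 2^-1 * \int[dx]_x (h (t, x) * w (t, x)).

Let tu t := tcont_density rf t.
Let tw t := tcont_excess rf t.
Let th t := tcont_potential hg rf t.

Lemma flow_deficit_is_derive t : is_derive t 1 flow_deficit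
  (\int[dx]_x (deficit' lam (u (t, x)) * time_deriv u (t, x))).
Proof.
have := @time_integral_is_derive R d u (fun=> 1) (deficit lam) (deficit' lam) 1 t
  (rf_smooth rf) (rf_periodic rf) (tcont_cst 1) (@continuous_deficit R lam)
  (@continuous_deficit' R lam) ler01 (@deficit_remainder R lam).
rewrite (_ : (fun s => _) = flow_deficit); last first.
  by apply/funext => s; apply: eq_Rintegral => x _; rewrite mul1r.
rewrite (_ : (\int[dx]_x _) =
  \int[dx]_x (deficit' lam (u (t, x)) * time_deriv u (t, x)))//.
by apply: eq_Rintegral => x _; rewrite mul1r.
Qed.

(** After an integration by parts the transport term becomes a multiple of the
    excess as well, and the inequality holds pointwise. *)
Lemma flow_deficit_decay t : 0 < t ->
  \int[dx]_x (deficit' lam (u (t, x)) * time_deriv u (t, x)) <= - lam * flow_deficit t.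
Proof.
move=> t0; pose F x := deficit lam (u (t, x)).
have cF : torus_C1 F.
  exact: (C1_comp (@deficit_is_derive R lam) (@continuous_deficit R lam)
    (@continuous_deficit' R lam) (C1_density rf t)).
have dF i x : pderiv i F x = deficit' lam (u (t, x)) * pderiv i (fun y => u (t, y)) x.
  exact: (pderiv_comp (@deficit_is_derive R lam) (((C1_density rf t).2 i).1 x)).2.
have td := tcont_comp (@continuous_deficit' R lam) (tu t).
have tFv i : torus_continuous (fun x => pderiv i F x * v i t x).
  exact: (tcontM (tcont_pderiv i cF) (C1_grad hg rf i t).1).
have tudw : torus_continuous (fun x => u (t, x) * deficit' lam (u (t, x)) * w (t, x)).
  exact: (tcontM (tcontM (tu t) td) (tw t)).
have tFw : torus_continuous (fun x => F x * w (t, x)) by exact: (tcontM cF.1 (tw t)).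
have eFw : \int[dx]_x (\sum_i pderiv i F x * v i t x) = \int[dx]_x (F x * w (t, x)).
  rewrite (tcont_Rintegral_sum dx _ tFv).
  have := green cF (smooth_slice t (smooth_potential hg rf)) (periodic_potential rf t).
  move/(congr1 -%R); rewrite opprK => <-.
  rewrite -(tcont_RintegralN dx); last first.
    apply: tcontM cF.1 _.
    split; first exact/continuous_laplacian/smooth_slice/(smooth_potential hg rf).
    exact: (lattice_periodic_laplacian (periodic_potential rf t)).
  by apply: eq_Rintegral => x _; rewrite (laplacian_potential hg rf)// mulrN opprK.
have -> : \int[dx]_x (deficit' lam (u (t, x)) * time_deriv u (t, x)) =
    \int[dx]_x ((\sum_i pderiv i F x * v i t x) -
      u (t, x) * deficit' lam (u (t, x)) * w (t, x)).
  apply: eq_Rintegral => x _; rewrite (time_deriv_density hg rf)// mulrBr mulr_sumr.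
  congr (_ - _); last by rewrite mulrA [u _ * _]mulrC.
  by apply: eq_bigr => i _; rewrite dF mulrA.
rewrite (tcont_RintegralB dx (tcont_sum _ tFv) tudw) eFw -(tcont_RintegralB dx tFw tudw).
rewrite /flow_deficit -(tcont_RintegralZ dx (- lam) cF.1).
apply: (tcont_le_Rintegral dx (tcontB tFw tudw) (tcontM (tcont_cst _) cF.1)) => x.
rewrite -mulrBl.
apply: deficit_decay; [exact: (rf_ge0 rf)|exact: (rf_target_gt0 rf)|exact: (rf_target_ge rf)].
Qed.

Let sth : smooth (time_deriv h).
Proof. exact: smooth_time_deriv (smooth_potential hg rf). Qed.
Let pth : space_periodic (time_deriv h).
Proof. exact: space_periodic_time_deriv (periodic_potential rf). Qed.

Lemma laplacian_time_deriv_potential t x : 0 < t ->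
  laplacian (fun y => time_deriv h (t, y)) x = - time_deriv u (t, x).
Proof.
move=> t0; have sw := smooth_excess rf; have pw := periodic_excess rf.
have -> : (fun y => time_deriv h (t, y)) = convolve dx gam (fun y => time_deriv w (t, y)).
  apply/funext => y; rewrite -tconvE.
  exact: (time_deriv_tconv (kernel_integrable hg) (t, y) sw pw).
rewrite laplacian_conv_kernel//; last 2 first.
- exact/smooth_slice/smooth_time_deriv.
- exact: space_periodic_time_deriv.
rewrite (time_deriv_excess rf) -[RHS]sub0r; congr (_ - _).
rewrite -[RHS](integral_time_deriv hg rf t0).
by apply: eq_Rintegral => y _; rewrite (time_deriv_excess rf).
Qed.

(** By Green's formula both sides are the integral of the product of the gradients of
    [h] and of its time derivative. *)
Lemma potential_symmetry t : 0 < t ->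
  \int[dx]_x (w (t, x) * time_deriv h (t, x)) = \int[dx]_x (h (t, x) * time_deriv u (t, x)).
Proof.
move=> t0; have cth := C1_smooth (smooth_slice t sth) (pth t).
have ch := C1_potential hg rf t.
have e1 := green cth (smooth_slice t (smooth_potential hg rf)) (periodic_potential rf t).
have e2 := green ch (smooth_slice t sth) (pth t).
have tht : torus_continuous (fun x => time_deriv h (t, x)) := cth.1.
have e3 : \int[dx]_x (time_deriv h (t, x) * laplacian (fun y => h (t, y)) x) =
    - \int[dx]_x (w (t, x) * time_deriv h (t, x)).
  rewrite -(tcont_RintegralN dx (tcontM (tw t) tht)); apply: eq_Rintegral => x _.
  by rewrite (laplacian_potential hg rf)// mulrN mulrC.
have e4 : \int[dx]_x (h (t, x) * laplacian (fun y => time_deriv h (t, y)) x) =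
    - \int[dx]_x (h (t, x) * time_deriv u (t, x)).
  rewrite -(tcont_RintegralN dx (tcontM (th t) (tcont_time_deriv rf t))).
  by apply: eq_Rintegral => x _; rewrite laplacian_time_deriv_potential// mulrN.
have e5 : - (\sum_i \int[dx]_x (pderiv i (fun y => time_deriv h (t, y)) x * v i t x)) =
    - (\sum_i \int[dx]_x (v i t x * pderiv i (fun y => time_deriv h (t, y)) x)).
  by apply: (congr1 -%R); apply: eq_bigr => i _; apply: eq_Rintegral => x _; rewrite mulrC.
exact: (oppr_inj (etrans (esym e3) (etrans (etrans e1 (etrans e5 (esym e2))) e4))).
Qed.

Lemma square_integral_is_derive (q : R * V -> R) t : smooth q -> space_periodic q ->
  is_derive t 1 (fun s => \int[dx]_x (q (s, x) * q (s, x)))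
    (\int[dx]_x (2 * q (t, x) * time_deriv q (t, x))).
Proof.
move=> sq pq; have c1 : continuous (fun r : R => r * r) by apply: contM => r; exact: cvg_id.
have c2 : continuous (fun r : R => 2 * r) by apply: contZ => r; exact: cvg_id.
have hK (a b : R) : `|b * b - a * a - 2 * a * (b - a)| <= 1 * (b - a) ^+ 2.
  by rewrite mul1r (_ : _ - _ - _ = (b - a) ^+ 2); [rewrite ger0_norm ?sqr_ge0|ring].
have := @time_integral_is_derive R d q (fun=> 1) _ _ 1 t sq pq (tcont_cst 1) c1 c2 ler01 hK.
rewrite (_ : (fun s => _) = (fun s => \int[dx]_x (q (s, x) * q (s, x)))); last first.
  by apply/funext => s; apply: eq_Rintegral => x _; rewrite mul1r.
rewrite (_ : (\int[dx]_x _) = \int[dx]_x (2 * q (t, x) * time_deriv q (t, x)))//.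
by apply: eq_Rintegral => x _; rewrite mul1r.
Qed.

(** Polarization reduces the derivative of the quadratic form to that of integrals
    of squares; the two halves agree by symmetry of the potential operator. *)
Lemma flow_energy_is_derive t : 0 < t ->
  is_derive t 1 flow_energy (\int[dx]_x (h (t, x) * time_deriv u (t, x))).
Proof.
move=> t0; have sh := smooth_potential hg rf; have sw := smooth_excess rf.
have ph := periodic_potential rf; have pw := periodic_excess rf.
pose q z := h z - w z.
have sq : smooth q by exact: (smoothB sh sw).
have pq : space_periodic q by move=> r n x; rewrite /q ph pw.
have tq r : torus_continuous (fun x => q (r, x)) := tcont_slice r sq pq.
have tht : torus_continuous (fun x => time_deriv h (t, x)) := tcont_slice t sth pth.
have tut := tcont_time_deriv rf t.
have t2 := @tcont_cst R d 2.
have eE : flow_energy = 4^-1 \*: ((fun r => \int[dx]_x (h (r, x) * h (r, x))) +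
    (fun r => \int[dx]_x (w (r, x) * w (r, x))) - (fun r => \int[dx]_x (q (r, x) * q (r, x)))).
  by apply/funext => r; exact: (integral_polarization (th r) (tw r)).
have eq' x : time_deriv q (t, x) = time_deriv h (t, x) - time_deriv w (t, x).
  apply: deriveB; first exact: (@smooth_derivable _ _ h _ _ sh).
  exact: (@smooth_derivable _ _ w _ _ sw).
have dH := square_integral_is_derive t sh ph.
have dW := square_integral_is_derive t sw pw.
have dQ := square_integral_is_derive t sq pq.
have twt : torus_continuous (fun x => time_deriv w (t, x)).
  exact: (tcont_slice t (smooth_time_deriv sw) (space_periodic_time_deriv pw)).
have sym : \int[dx]_x (w (t, x) * time_deriv h (t, x)) =
    \int[dx]_x (h (t, x) * time_deriv w (t, x)).
  rewrite (potential_symmetry t0); apply: eq_Rintegral => x _.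
  by rewrite (time_deriv_excess rf).
have -> : \int[dx]_x (h (t, x) * time_deriv u (t, x)) =
    \int[dx]_x (h (t, x) * time_deriv w (t, x)).
  by apply: eq_Rintegral => x _; rewrite (time_deriv_excess rf).
rewrite eE; apply: is_derive_eq.
exact: (integral_polarization_derive (th t) (tw t) tht twt eq' sym).
Qed.

End estimates.
End flow_estimates.

(** * Exponential decay for smooth solutions *)

Section flow_decay.
Context {R : realType} {d : nat}.
Local Notation V := 'rV[R]_d.
Local Notation dx := (lebesgue_torus R d).
Variable g : V -> \bar R.
Hypothesis hg : coulomb_kernel g.
Local Notation gam := (fine \o g).
Implicit Types (t s B : R).

(** The gradient estimate on a cube of half side one, for an excess bounded by [B]. *)
Definition grad_bound B : R := d%:R * (B * \int[dx]_x `|gam x|) + B / 2.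

(** The coefficient of the deficit in the dissipation inequality. *)
Definition deficit_coeff B (lam : R) : R := d%:R * grad_bound B ^+ 2 / (2 * lam).

(** A bound on the Lyapunov functional [E + K D] at the initial time, where
    [K = deficit_coeff / (lam - gamma)]. *)
Definition decay_cst B (lam gamma : R) : R :=
  2^-1 * (d%:R * grad_bound B ^+ 2) + deficit_coeff B lam / (lam - gamma) * lam ^+ 2.

Section one_flow.
Variables (u : R * V -> R) (m : V -> R) (lam M : R).
Hypothesis rf : regular_flow g u m lam M.
Local Notation w := (excess u m).
Local Notation h := (flow_potential g u m).
Local Notation v := (flow_grad g u m).
Local Notation D := (flow_deficit u lam).
Local Notation E := (flow_energy g u m).

Lemma target_bound_ge0 : 0 <= M.
Proof.
by apply: le_trans (rf_target_le rf 0); apply: le_trans (rf_target_ge rf 0); exact/ltW/(rf_target_gt0 rf).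
Qed.

Lemma density_le_from s t x : 0 < s -> s <= t -> u (t, x) <= M + s^-1.
Proof.
move=> s0 st; have t0 := lt_le_trans s0 st.
apply: le_trans (density_le hg rf x t0) _.
by rewrite lerD2l lef_pV2.
Qed.

Lemma excess_le s t x : 0 < s -> s <= t -> `|w (t, x)| <= M + s^-1.
Proof.
move=> s0 st; have t0 := lt_le_trans s0 st.
have h1 := density_le_from x s0 st; have h2 := rf_ge0 rf x t0.
have h3 := rf_target_le rf x; have h4 := rf_target_ge rf x.
have h5 := rf_target_gt0 rf.
have h6 : 0 < s^-1 by rewrite invr_gt0.
by rewrite /excess/= ler_norml; apply/andP; split; lra.
Qed.

Lemma grad_le s t i x : 0 < s -> s <= t -> `|v i t x| <= grad_bound (M + s^-1).
Proof.
move=> s0 st; have t0 := lt_le_trans s0 st.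
have := @gradient_estimate R d (fun y => h (t, y)) x 1 ((M + s^-1) * \int[dx]_x `|gam x|)
  (M + s^-1) i (smooth_slice t (smooth_potential hg rf)) ltr01.
rewrite divr1 mulr1; apply=> y _.
  rewrite potentialE; apply: (conv_bound (kernel_integrable hg)).
    exact: (tcont_excess rf t).1.
  by move=> z; exact: excess_le.
by rewrite (laplacian_potential hg rf)// normrN; exact: excess_le.
Qed.

Let tv i t : torus_continuous (v i t) := (C1_grad hg rf i t).1.
Let tvv i t : torus_continuous (fun x => v i t x * v i t x) := tcontM (tv i t) (tv i t).
Let tu t : torus_continuous (fun x => u (t, x)) := tcont_density rf t.

Lemma flow_energyE t : 0 < t -> E t = 2^-1 * \sum_i \int[dx]_x (v i t x * v i t x).
Proof.
move=> t0; apply: (congr1 ( *%R 2^-1)).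
have e := green (C1_potential hg rf t) (smooth_slice t (smooth_potential hg rf)) (periodic_potential rf t).
have tl : torus_continuous (fun x => h (t, x) * w (t, x)) :=
  tcontM (tcont_potential hg rf t) (tcont_excess rf t).
have e2 : \int[dx]_x (h (t, x) * laplacian (fun y => h (t, y)) x) =
    - \int[dx]_x (h (t, x) * w (t, x)).
  rewrite -(tcont_RintegralN dx tl); apply: eq_Rintegral => x _.
  by rewrite (laplacian_potential hg rf)// mulrN.
exact: (oppr_inj (etrans (esym e2) e)).
Qed.

Lemma flow_energy_ge0 t : 0 < t -> 0 <= E t.
Proof.
move=> t0; rewrite flow_energyE// mulr_ge0// sumr_ge0// => i _.
by apply: Rintegral_ge0 => x _; rewrite -expr2 sqr_ge0.
Qed.

Lemma grad_bound_ge0 s t (i : 'I_d) : 0 < s -> s <= t -> 0 <= grad_bound (M + s^-1).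
Proof. by move=> s0 st; exact: le_trans (grad_le i 0 s0 st). Qed.

Lemma grad_sqr_le s t i x : 0 < s -> s <= t -> v i t x * v i t x <= grad_bound (M + s^-1) ^+ 2.
Proof.
move=> s0 st; rewrite -expr2 sqr_normr.
rewrite lerXn2r ?nnegrE//; [exact: (grad_bound_ge0 i s0 st)|exact: grad_le].
Qed.

Lemma flow_energy_le s t : 0 < s -> s <= t -> E t <= 2^-1 * (d%:R * grad_bound (M + s^-1) ^+ 2).
Proof.
move=> s0 st; have t0 := lt_le_trans s0 st; rewrite flow_energyE//.
apply: ler_wpM2l => //.
have -> : d%:R * grad_bound (M + s^-1) ^+ 2 = \sum_(i < d) grad_bound (M + s^-1) ^+ 2.
  by rewrite sumr_const card_ord mulr_natl.
apply: ler_sum => i _; rewrite -(Rintegral_prob_cst dx (grad_bound (M + s^-1) ^+ 2)).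
by apply: (tcont_le_Rintegral dx (tvv i t) (tcont_cst _)) => x; exact: grad_sqr_le.
Qed.

Let tD t : torus_continuous (fun x => deficit lam (u (t, x))) :=
  tcont_comp (@continuous_deficit R lam) (tu t).

Lemma flow_deficit_ge0 t : 0 <= D t.
Proof. by apply: Rintegral_ge0 => x _; exact: deficit_ge0. Qed.

Lemma flow_deficit_le t : 0 < t -> D t <= lam ^+ 2.
Proof.
move=> t0; rewrite -(Rintegral_prob_cst dx (lam ^+ 2)).
apply: (tcont_le_Rintegral dx (tD t) (tcont_cst _)) => x.
by apply: deficit_le; [exact: (rf_ge0 rf x t0)|exact: rf_target_gt0 rf].
Qed.

(** The energy is dissipated at the rate [2 u]; where [u] is below [lam / 2] the loss
    is paid for by the deficit, the gradient being bounded. *)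
Lemma flow_energy_dissipation s t : 0 < s -> s <= t ->
  \int[dx]_x (h (t, x) * time_deriv u (t, x)) <=
  - lam * E t + deficit_coeff (M + s^-1) lam * D t.
Proof.
move=> s0 st; have t0 := lt_le_trans s0 st; have l0 := rf_target_gt0 rf.
set G := grad_bound (M + s^-1).
rewrite (time_deriv_test hg rf t0 (C1_potential hg rf t)) flow_energyE//.
have -> : - lam * (2^-1 * \sum_i \int[dx]_x (v i t x * v i t x)) +
    deficit_coeff (M + s^-1) lam * D t =
    - \sum_i (lam / 2 * \int[dx]_x (v i t x * v i t x) - G ^+ 2 / (2 * lam) * D t).
  rewrite big_split/= -mulr_sumr sumrN sumr_const card_ord -mulr_natl.
  by rewrite /deficit_coeff -/G; move: (D t) (\sum_i _) => a b; field; rewrite gt_eqF.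
rewrite lerN2; apply: ler_sum => i _.
rewrite -(tcont_RintegralZ dx _ (tvv i t)) -(tcont_RintegralZ dx _ (tD t)).
have i1 := tcontM (tcont_cst (lam / 2)) (tvv i t).
have i2 := tcontM (tcont_cst (G ^+ 2 / (2 * lam))) (tD t).
rewrite -(tcont_RintegralB dx i1 i2).
apply: (tcont_le_Rintegral dx (tcontB i1 i2) (tcontM (tcontM (tu t) (tv i t)) (tv i t))) => x.
have h1 := deficit_lower (u (t, x)) l0.
have h2 := grad_sqr_le i x s0 st.
have h3 : 0 <= v i t x * v i t x by rewrite -expr2 sqr_ge0.
have h4 : 0 <= deficit lam (u (t, x)) / (2 * lam) by rewrite divr_ge0 ?deficit_ge0// mulr_ge0// ltW.
rewrite -[leRHS]mulrA; apply: (@le_trans _ _ ((lam / 2 - deficit lam (u (t, x)) / (2 * lam)) * (v i t x * v i t x))); last first.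
  by rewrite ler_wpM2r.
have e : G ^+ 2 / (2 * lam) * deficit lam (u (t, x)) = deficit lam (u (t, x)) / (2 * lam) * G ^+ 2.
  by rewrite mulrC [G ^+ 2 / _]mulrC mulrA.
by rewrite mulrBl lerB// e ler_wpM2l.
Qed.

(** The deficit decays at the rate [lam > gamma], and with the weight [K] the surplus
    of its decay absorbs the error in the dissipation of the energy. *)
Lemma flow_decay (gamma : R) s t : gamma < lam -> 0 < s -> s <= t ->
  E t <= decay_cst (M + s^-1) lam gamma * expR (- gamma * (t - s)).
Proof.
move=> gl s0 st.
pose A := deficit_coeff (M + s^-1) lam; pose K := A / (lam - gamma).
have A0 : 0 <= A.
  have l0 := ltW (rf_target_gt0 rf).
  by apply: divr_ge0; apply: mulr_ge0 => //; exact: sqr_ge0.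
have lg : 0 < lam - gamma by rewrite subr_gt0.
have K0 : 0 <= K by rewrite divr_ge0// ltW.
have KA : K * (lam - gamma) = A by rewrite divfK// gt_eqF.
pose L : R -> R := (E + K \*: D) * (fun r => expR (gamma * r)).
pose E' r := \int[dx]_x (h (r, x) * time_deriv u (r, x)).
pose D' r := \int[dx]_x (deficit' lam (u (r, x)) * time_deriv u (r, x)).
have dexp (r : R) : is_derive r 1 (fun r => expR (gamma * r)) (expR (gamma * r) * gamma).
  apply: (@is_derive1_comp _ expR (fun r => gamma * r)).
  rewrite (_ : (fun r => gamma * r) = gamma \*: id); last exact/funext.
  by apply: is_derive_eq; rewrite [_ *: _]mulr1.
have dL (r : R) : 0 < r -> is_derive r 1 L ((E r + K * D r) * (expR (gamma * r) * gamma) +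
    expR (gamma * r) * (E' r + K * D' r)).
  move=> r0; have dE := flow_energy_is_derive hg rf r0.
  have dD := flow_deficit_is_derive rf r.
  exact: is_deriveM.
have dL0 (r : R) : s <= r -> (E r + K * D r) * (expR (gamma * r) * gamma) +
    expR (gamma * r) * (E' r + K * D' r) <= 0.
  move=> sr; have r0 := lt_le_trans s0 sr.
  have h1 : E' r <= - lam * E r + A * D r := flow_energy_dissipation s0 sr.
  have h2 : D' r <= - lam * D r := flow_deficit_decay hg rf r0.
  have h3 := flow_energy_ge0 r0; have h4 := flow_deficit_ge0 r.
  have h5 := ler_wpM2l K0 h2.
  have h6 : 0 <= (lam - gamma) * E r by rewrite mulr_ge0// ltW.
  rewrite mulrCA -mulrDr pmulr_rle0 ?expR_gt0//.
  by move: h1 h5 h6 KA; move: (E r) (D r) (E' r) (D' r) => e1 e2 e3 e4; nra.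
have cL : {within `[s, t], continuous L}.
  apply: derivable_within_continuous => r; rewrite in_itv/= => /andP[sr _].
  by have [] := dL r (lt_le_trans s0 sr).
have Lts : L t <= L s.
  apply: (@ler0_derive1_nincr R L s t _ _ cL) => // r; rewrite in_itv/= => /andP[sr _].
    by have [] := dL r (lt_trans s0 sr).
  have [_ dLr] := dL r (lt_trans s0 sr).
  by rewrite derive1E dLr; exact: dL0 (ltW sr).
have e0 : 0 < expR (gamma * t) by exact: expR_gt0.
have Et : E t * expR (gamma * t) <= L t.
  rewrite /L !fctE ler_wpM2r ?expR_ge0// lerDl.
  by rewrite mulr_ge0// flow_deficit_ge0.
have Ls : L s <= decay_cst (M + s^-1) lam gamma * expR (gamma * s).
  rewrite /L !fctE ler_wpM2r ?expR_ge0// /decay_cst -/A -/K lerD//.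
    exact: flow_energy_le.
  by rewrite ler_wpM2l// flow_deficit_le.
have -> : expR (- gamma * (t - s)) = expR (gamma * s) / expR (gamma * t).
  by rewrite -expRN -expRD; congr expR; ring.
by rewrite mulrA ler_pdivlMr//; exact: le_trans Et (le_trans Lts Ls).
Qed.

End one_flow.
End flow_decay.

(** * From classical solutions to smooth flows *)

Section smooth_solution_flow.
Context {R : realType} {d : nat}.
Local Notation V := 'rV[R]_d.
Local Notation dx := (lebesgue_torus R d).
Hypothesis hd : (1 <= d)%N.
Variable g : V -> \bar R.
Hypothesis hg : coulomb_kernel g.
Local Notation gam := (fine \o g).
Implicit Types (t s : R).

Lemma convolveB (f k : V -> R) x : smooth f -> lattice_periodic f ->
  smooth k -> lattice_periodic k ->
  convolve dx gam (fun y => f y - k y) x = convolve dx gam f x - convolve dx gam k x.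
Proof.
move=> sf pf sk pk; have ig := kernel_integrable hg.
have i1 := conv_integrable ig x (smooth_continuous sf) pf.
have i2 := conv_integrable ig x (smooth_continuous sk) pk.
rewrite !convE -(RintegralB measurableT i1 i2).
by apply: eq_Rintegral => z _; rewrite mulrBr.
Qed.

Lemma smooth_solution_flow (eta : nat -> V -> R) (mu : torus_prob R d) (u : R * V -> R)
    (rho : R -> torus_prob R d) (m : V -> R) (lam M : R) :
  approx_identity eta -> smooth_solution g mu u rho -> is_density m mu ->
  smooth m -> lattice_periodic m -> 0 < lam -> (forall x, lam <= m x) ->
  (forall x, m x <= M) -> regular_flow g u m lam M.
Proof.
move=> ae [su pu du eq_u] dm sm pm l0 ml mM.
split=> //.
- by move=> t x t0; exact: (density_ge0 (du t (ltW t0)) x).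
- by move=> t t0; exact: density_int (du t (ltW t0)).
- exact: density_int dm.
move=> t x t0; have sut := smooth_slice t su; have put := pu t.
have ig := kernel_integrable hg.
have hE : (fun y => flow_potential g u m (t, y)) =
    (fun y => convolve dx gam (fun z => u (t, z)) y - convolve dx gam m y).
  apply/funext => y; rewrite /flow_potential tconvE.
  exact: (convolveB y sut put sm pm).
have vE i y : velocity g mu (rho t) i y = - flow_grad g u m i t y.
  rewrite /velocity (force_smooth_density hd hg ae i y (du t (ltW t0)) sut put).
  rewrite (force_smooth_density hd hg ae i y dm sm pm) /flow_grad hE.
  by rewrite (pderivB i y (smooth_conv ig sut put) (smooth_conv ig sm pm)).
have sh : smooth (fun y => flow_potential g u m (t, y)).
  by rewrite hE; exact: (smoothB (smooth_conv ig sut put) (smooth_conv ig sm pm)).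
have dflux i y : derivable (fun z => u (t, z) * flow_grad g u m i t z) y (basis_vec i).
  apply: derivableM; first exact: (@smooth_derivable _ _ _ y _ sut).
  exact: (@smooth_derivable _ _ _ y _ (smooth_pderiv i sh)).
apply/eqP; rewrite -subr_eq0 -sumrN; apply/eqP; rewrite -[RHS](eq_u t x t0).
congr (_ + _); apply: eq_bigr => i _.
have -> : (fun y => u (t, y) * velocity g mu (rho t) i y) =
    - (fun z => u (t, z) * flow_grad g u m i t z).
  by apply/funext => y; rewrite vE mulrN.
by rewrite /pderiv deriveN.
Qed.

(** The flux is bounded in [L^1]: the density has mass one and the velocity is
    bounded, by a constant depending only on [g], [M] and [s]. *)
Lemma flow_test_lipschitz (u : R * V -> R) (m : V -> R) (lam M : R) (f : V -> R) (C s t1 t2 : R) :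
  regular_flow g u m lam M -> smooth f -> lattice_periodic f ->
  (forall i x, `|pderiv i f x| <= C) -> 0 < s -> s <= t1 -> t1 <= t2 ->
  `|\int[dx]_x (f x * u (t2, x)) - \int[dx]_x (f x * u (t1, x))| <=
    d%:R * (grad_bound g (M + s^-1) * C) * (t2 - t1).
Proof.
move=> rf sf pf hC s0 st1 t12; have cf := C1_smooth sf pf.
have c1 : continuous (fun r : R => r) by move=> r; exact: cvg_id.
have c2 : continuous (fun _ : R => 1 : R) by move=> r; exact: cst_continuous.
have hK (a b : R) : `|b - a - 1 * (b - a)| <= 0 * (b - a) ^+ 2.
  by rewrite mul1r subrr normr0 mul0r.
pose G := grad_bound g (M + s^-1).
have dF (t : R) := time_integral_is_derive t (rf_smooth rf) (rf_periodic rf) cf.1 c1 c2 (lexx 0) hK.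
have bF (t : R) : s <= t -> `|\int[dx]_x (f x * (1 * time_deriv u (t, x)))| <= d%:R * (G * C).
  move=> st; have t0 := lt_le_trans s0 st.
  have -> : \int[dx]_x (f x * (1 * time_deriv u (t, x))) =
      - \sum_i \int[dx]_x (u (t, x) * flow_grad g u m i t x * pderiv i f x).
    rewrite -(time_deriv_test hg rf t0 cf); apply: eq_Rintegral => x _.
    by rewrite mul1r.
  rewrite normrN; apply: le_trans (ler_norm_sum _ _ _) _.
  have -> : d%:R * (G * C) = \sum_(i < d) G * C by rewrite sumr_const card_ord mulr_natl.
  apply: ler_sum => i _; have tu := tcont_density rf t.
  have tF := tcontM (tcontM tu (C1_grad hg rf i t).1) (tcont_pderiv i cf).
  have tB := tcontM tu (tcont_cst (G * C)).
  have iB : \int[dx]_x (u (t, x) * (G * C)) = G * C.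
    rewrite -[RHS]mulr1 -(rf_int rf t0) -(tcont_RintegralZ dx _ tu).
    by apply: eq_Rintegral => x _; rewrite mulrC.
  have key x : `|u (t, x) * flow_grad g u m i t x * pderiv i f x| <= u (t, x) * (G * C).
    have u0 := rf_ge0 rf x t0; rewrite normrM normrM (ger0_norm u0) -mulrA.
    by apply: ler_wpM2l => //; apply: ler_pM => //; exact: (grad_le hg rf).
  rewrite ler_norml -iB -(tcont_RintegralN dx tB); apply/andP; split.
    apply: (tcont_le_Rintegral dx (tcontN tB) tF) => x.
    by have := key x; rewrite ler_norml => /andP[].
  apply: (tcont_le_Rintegral dx tF tB) => x.
  by have := key x; rewrite ler_norml => /andP[].
have cF : {within `[t1, t2], continuous (fun t => \int[dx]_x (f x * u (t, x)))}.
  by apply: derivable_within_continuous => r _; have [] := dF r.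
have [r] := MVT_segment t12 (fun r _ => dF r) cF.
rewrite in_itv/= => /andP[r1 r2] ->; rewrite normrM [`|t2 - t1|]ger0_norm ?subr_ge0//.
by apply: ler_wpM2r; [rewrite subr_ge0|apply: bF; exact: le_trans r1].
Qed.

End smooth_solution_flow.

(** * Measures dominated by Lebesgue measure *)

Section extended_truncation.
Context {R : realType}.
Implicit Types (N : R) (y : \bar R).

Definition etrunc N y : R := match y with r%:E => clamp N r | +oo%E => N | -oo%E => - N end.

Lemma etrunc_le N y : 0 <= N -> `|etrunc N y| <= N.
Proof.
by case: y => [r| |] N0 /=; [exact: clamp_le|rewrite ger0_norm|rewrite normrN ger0_norm].
Qed.

Lemma clamp_ge N r : 0 <= N -> N <= r -> clamp N r = N.
Proof. by move=> N0 Nr; rewrite /clamp min_r// max_r// (le_trans _ N0)// oppr_le0. Qed.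

Lemma clamp_leN N r : 0 <= N -> r <= - N -> clamp N r = - N.
Proof.
move=> N0 Nr; rewrite /clamp min_l ?max_l//; apply: le_trans Nr _.
by rewrite (le_trans _ N0)// oppr_le0.
Qed.

Lemma continuous_etrunc N : 0 <= N -> continuous (etrunc N).
Proof.
move=> N0 [r| |].
- by move=> A hA; apply/nbhs_EFin; exact: (@continuous_clamp R N r A hA).
- have key z : (N%:E < z)%E -> etrunc N z = N.
    by case: z => [r| |]//=; rewrite lte_fin => /ltW; exact: clamp_ge.
  move=> A /nbhs_singleton AN.
  by apply: filterS (ereal_nbhs_pinfty_gt (num_real N)) => y /key /= ->.
- have key z : (z < (- N)%:E)%E -> etrunc N z = - N.
    by case: z => [r| |]//=; rewrite lte_fin => /ltW; exact: clamp_leN.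
  move=> A /nbhs_singleton AN.
  by apply: filterS (ereal_nbhs_ninfty_lt (num_real (- N))) => y /key /= ->.
Qed.

Lemma etrunc_ge0 N y : 0 <= N -> (0 <= y)%E -> 0 <= etrunc N y.
Proof.
case: y => [r| |] N0 //=; rewrite lee_fin => r0.
by rewrite /clamp le_max le_min r0 N0 orbT.
Qed.

Lemma etrunc_le_id N y : 0 <= N -> (0 <= y)%E -> ((etrunc N y)%:E <= y)%E.
Proof.
case: y => [r| |] N0 //=; rewrite ?leey// !lee_fin => r0.
by rewrite /clamp ge_max ge_min lexx andbT (le_trans _ r0)// oppr_le0.
Qed.

Lemma etrunc_cvg y : (etrunc n%:R y)%:E @[n --> \oo] --> y.
Proof.
case: y => [r| |] /=.
- apply: cvg_near_cst; near=> n; rewrite clamp_id//.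
  by near: n; exact: nbhs_infty_ger.
- by apply/cvgeyPge => A; near=> n; rewrite lee_fin; near: n; exact: nbhs_infty_ger.
- apply/cvgeNyPle => A; near=> n; rewrite lee_fin lerNl.
  by near: n; exact: nbhs_infty_ger.
Unshelve. all: by end_near. Qed.

End extended_truncation.

Lemma uniformly_continuous (R : realType) (W : normedModType R) (f : W -> R) :
  (forall e : R, 0 < e -> exists2 dl : R, 0 < dl &
    forall x z, `|x - z| < dl -> `|f x - f z| <= e) -> continuous f.
Proof.
move=> uf x; apply/cvgrPdist_le => e e0; have [dl dl0 hdl] := uf e e0.
by apply/nbhs_normP; exists dl => //= z xz; exact: hdl.
Qed.

Section dominated.
Context {R : realType} {d : nat}.
Local Notation V := 'rV[R]_d.
Local Notation dx := (lebesgue_torus R d).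
Implicit Types (al be : probability V R).

(** Testing against continuous functions suffices: it passes to narrow limits, and
    extends to the extended-real kernel by truncation. *)
Definition dominated (B : R) al := forall f : V -> R, torus_continuous f ->
  (forall x, 0 <= f x) -> \int[al]_x f x <= B * \int[dx]_x f x.

Lemma tcont_integralE (nu : probability V R) (f : V -> R) : torus_continuous f ->
  (\int[nu]_x (f x)%:E)%E = (\int[nu]_x f x)%:E.
Proof.
by move=> tf; rewrite /Rintegral fineK//; exact: (integrable_fin_num measurableT (tcont_integrable nu tf)).
Qed.

Lemma tcont_etrunc N (F : V -> \bar R) : 0 <= N -> continuous F -> lattice_periodic F ->
  torus_continuous (fun x => etrunc N (F x)).
Proof.
move=> N0 cF pF; split; last by move=> n x; rewrite pF.
by move=> x; apply: continuous_comp; [exact: cF|exact: continuous_etrunc].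
Qed.

Lemma continuous_emeasurable (F : V -> \bar R) : continuous F -> lattice_periodic F ->
  measurable_fun setT F.
Proof.
move=> cF pF.
apply: (@emeasurable_fun_cvg _ _ _ setT (fun k x => (etrunc k%:R (F x))%:E)).
  move=> k; apply/measurable_EFinP.
  exact: (continuous_measurable_rV (tcont_etrunc (ler0n R k) cF pF).1).
by move=> x _; exact: (@etrunc_cvg R (F x)).
Qed.

(** Truncations of [F] are admissible test functions; Fatou's lemma removes them. *)
Lemma dominated_integral B al (F : V -> \bar R) : 0 <= B -> dominated B al ->
  continuous F -> lattice_periodic F -> (forall x, 0 <= F x)%E ->
  (\int[al]_x F x <= B%:E * \int[dx]_x F x)%E.
Proof.
move=> B0 dom cF pF F0; have tF k := tcont_etrunc (ler0n R k) cF pF.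
have F0k k x : 0 <= etrunc k%:R (F x) by apply: etrunc_ge0.
apply: (@fatou_bound _ _ _ al (fun k x => etrunc k%:R (F x))).
- by move=> k; exact: continuous_measurable_rV (tF k).1.
- exact: F0k.
- by move=> x; exact: (@etrunc_cvg R (F x)).
move=> k; rewrite tcont_integralE//.
apply: (@le_trans _ _ (B%:E * (\int[dx]_x etrunc k%:R (F x))%:E)%E).
  by rewrite -EFinM lee_fin; exact: dom.
rewrite -tcont_integralE//; apply: lee_wpmul2l; first by rewrite lee_fin.
apply: ge0_le_integral => //.
- by move=> x _; rewrite lee_fin.
- by apply/measurable_EFinP; exact: continuous_measurable_rV (tF k).1.
- exact: continuous_emeasurable.
- by move=> x _; exact: etrunc_le_id.
Qed.

Lemma density_dominated (f : V -> R) (nu : torus_prob R d) (B : R) : is_density f nu ->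
  torus_continuous f -> (forall x, f x <= B) -> dominated B nu.
Proof.
move=> hf tf fB h th h0.
rewrite (Rintegral_density hf); last exact: continuous_measurable_rV th.1.
rewrite -(tcont_RintegralZ dx B th).
apply: (tcont_le_Rintegral dx (tcontM th tf) (tcontM (tcont_cst B) th)) => x.
by rewrite mulrC; apply: ler_wpM2r.
Qed.

Lemma dominated_limit (al_ : nat -> probability V R) al (B : R) :
  (\forall j \near \oo, dominated B (al_ j)) ->
  (forall f, torus_continuous f -> \int[al_ j]_x f x @[j --> \oo] --> \int[al]_x f x) ->
  dominated B al.
Proof.
move=> dom cv f tf f0; have c := cv f tf.
rewrite -(cvg_lim (@Rhausdorff R) c); apply: limr_le; first by apply/cvg_ex; exists (\int[al]_x f x).
by apply: filterS dom => j; apply.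
Qed.

Lemma tcont_convolve (nu : probability V R) (f : V -> R) : torus_continuous f ->
  torus_continuous (fun x => \int[nu]_y f (x - y)).
Proof.
move=> [cf pf]; have tf x : torus_continuous (fun y => f (x - y)).
  by split; [exact: continuous_sub_rV|exact: lattice_periodic_sub].
suff c : continuous (fun x : V => \int[nu]_y f (x - y)).
  by split => // n x; apply: eq_Rintegral => y _; rewrite addrAC pf.
apply: uniformly_continuous => e e0.
have [dl dl0 hdl] := periodic_uniform_continuity cf pf e0; exists dl => // x z xz.
rewrite -(tcont_RintegralB nu (tf x) (tf z)).
apply: (tcont_Rintegral_norm nu (tcontB (tf x) (tf z))) => y.
rewrite distrC; apply: hdl; rewrite (_ : x - y - (z - y) = x - z)//.
by rewrite opprB addrA subrK.
Qed.

Section kernel.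
Variable g : V -> \bar R.
Hypothesis hg : coulomb_kernel g.
Local Notation gam := (fine \o g).

Definition kernel_tail N (x : V) : \bar R := `|g x - (etrunc N (g x))%:E|%E.

Lemma kernel_tail_periodic N : lattice_periodic (kernel_tail N).
Proof. by move=> n x; rewrite /kernel_tail (coulomb_periodic hg). Qed.

Lemma kernel_tail_continuous N : 0 <= N -> continuous (kernel_tail N).
Proof.
move=> N0 x; have h := (tcont_etrunc N0 (coulomb_continuous hg) (coulomb_periodic hg)).1 x.
have c2 : (fun z => (etrunc N (g z))%:E) @ nbhs x --> (etrunc N (g x))%:E.
  by move=> A hA; exact: (h _ hA).
have c1 : g @ nbhs x --> g x by exact: (coulomb_continuous hg).
have ad : (g x +? - (etrunc N (g x))%:E)%E by exact: fin_num_adde_defl.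
have c3 := @cvgeB _ _ (nbhs_filter x) _ _ _ _ _ ad c1 c2.
apply: (@continuous_comp _ _ _ (fun z => (g z - (etrunc N (g z))%:E)%E) abse); first exact: c3.
exact: abse_continuous.
Qed.

Lemma kernel_tail_small (tau : R) : 0 < tau ->
  exists2 N : R, 0 <= N & (\int[dx]_x kernel_tail N x <= tau%:E)%E.
Proof.
move=> tau0; have igam := kernel_integrable hg.
have [N N0 hN] := sub_clamp_small igam tau0; exists N => //.
have isub := sub_clamp_integrable N0 igam.
have mi : measurable_fun setT (fun x => gam x - clamp N (gam x)).
  by apply/measurable_EFinP; exact: (measurable_int _ isub).
have -> : (\int[dx]_x kernel_tail N x = \int[dx]_x (`|gam x - clamp N (gam x)|)%:E)%E.
  apply: ae_eq_integral => //.
  - apply: continuous_emeasurable; [exact: kernel_tail_continuous|exact: kernel_tail_periodic].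
  - by apply/measurable_EFinP; apply: (measurableT_comp _ mi).
  have := integrable_ae measurableT (coulomb_integrable hg).
  apply: filterS => x /(_ I) gx _; rewrite /kernel_tail /=.
  by move: gx; case: (g x).
move: hN; rewrite -lee_fin /Rintegral fineK//; exact: integral_norm_fin_num isub.
Qed.

Section one_measure.
Variables (al : torus_prob R d) (B : R).
Hypotheses (B0 : 0 <= B) (dom : dominated B al).

Let dom_sub (F : V -> \bar R) (x : V) : continuous F -> lattice_periodic F ->
  (forall y, 0 <= F y)%E -> (\int[al]_y F (x - y)%R <= B%:E * \int[dx]_y F y)%E.
Proof.
move=> cF pF F0; have mF := continuous_emeasurable cF pF.
rewrite -(@integral_torus_sub _ _ x F mF pF).
apply: (dominated_integral B0 dom (F := fun y => F (x - y))).
- have cs : continuous (fun y : V => x - y).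
    by move=> y; apply: (@continuousB _ _ _ (cst x) id); [exact: cst_continuous|exact: cvg_id].
  by move=> y A hA; exact: (cs y _ (cF (x - y) _ hA)).
- exact: lattice_periodic_sub.
- by move=> y.
Qed.

Let msub (x : V) : measurable_fun setT (fun y : V => x - y).
Proof.
by apply: measurable_fun_rV => j; under eq_fun do rewrite !mxE;
  apply: measurable_funB => //; exact: measurable_coord.
Qed.

Lemma potential_integrable x : al.-integrable setT (fun y => g (x - y)).
Proof.
have mg := measurable_int _ (coulomb_integrable hg).
apply/integrableP; split; first exact: (measurableT_comp mg (msub x)).
have cg : continuous (fun z : V => `|g z|%E).
  move=> y; apply: (@continuous_comp _ _ _ g abse); [exact: (coulomb_continuous hg)|].
  exact: abse_continuous.
have pg : lattice_periodic (fun z => `|g z|%E) by move=> n z; rewrite (coulomb_periodic hg).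
apply: le_lt_trans (dom_sub x cg pg (fun y => abse_ge0 _)) _.
have [_ fg] := integrableP _ _ _ (coulomb_integrable hg).
by rewrite lte_mul_pinfty// lee_fin.
Qed.

Lemma potential_fin x : potential g al x \is a fin_num.
Proof. exact: (integrable_fin_num measurableT (potential_integrable x)). Qed.

Definition trunc_potential N (nu : probability V R) x := \int[nu]_y etrunc N (g (x - y)).

(** Domination replaces the tail of the kernel, integrated against [al], by its
    integral over the torus, which does not depend on [x]. *)
Lemma potential_trunc_close N (t : R) x : 0 <= N -> (\int[dx]_x kernel_tail N x <= t%:E)%E ->
  `|fine (potential g al x) - trunc_potential N al x| <= B * t.
Proof.
move=> N0 ht; have tg := tcont_etrunc N0 (coulomb_continuous hg) (coulomb_periodic hg).
have tgx : torus_continuous (fun y => etrunc N (g (x - y))).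
  split; [exact: (@continuous_sub_rV R d x (fun z => etrunc N (g z)) tg.1)|exact: (@lattice_periodic_sub R d _ (fun z => etrunc N (g z)) x tg.2)].
have i1 := potential_integrable x; have i2 := tcont_integrable al tgx.
have i3 := integrableB measurableT i1 i2.
rewrite -lee_fin -abse_EFin EFinB fineK ?potential_fin// -(tcont_integralE al tgx).
rewrite -[X in `|X|%E](integralB measurableT i1 i2).
apply: le_trans (le_abse_integral _ measurableT (measurable_int _ i3)) _.
apply: le_trans (dom_sub x (kernel_tail_continuous N0) (@kernel_tail_periodic N) (fun y => abse_ge0 _)) _.
by rewrite EFinM; apply: lee_wpmul2l; rewrite ?lee_fin.
Qed.

Lemma tcont_trunc_potential N (nu : probability V R) : 0 <= N ->
  torus_continuous (trunc_potential N nu).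
Proof.
move=> N0; apply: (@tcont_convolve nu (fun z => etrunc N (g z))).
exact: (tcont_etrunc N0 (coulomb_continuous hg) (coulomb_periodic hg)).
Qed.

(** The potential is a uniform limit of continuous truncated potentials. *)
Lemma tcont_fine_potential : torus_continuous (fun x => fine (potential g al x)).
Proof.
suff c : continuous (fun x : V => fine (potential g al x)).
  split => // n x; congr fine; apply: eq_integral => y _.
  by rewrite addrAC (coulomb_periodic hg).
apply: uniformly_continuous => e e0.
have t0 : 0 < e / (4 * (B + 1)) by rewrite divr_gt0// mulr_gt0// ltr_wpDl.
have [N N0 hN] := kernel_tail_small t0.
have Be : B * (e / (4 * (B + 1))) <= e / 4.
  rewrite mulrA ler_pdivrMr ?mulr_gt0 ?ltr_wpDl//.
  rewrite [e / 4 * _]mulrA divfK// mulrC; apply: ler_wpM2l; first exact: ltW.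
  by rewrite lerDl.
have e4 : 0 < e / 4 by rewrite divr_gt0.
have [ct pt] := tcont_trunc_potential al N0.
have [dl dl0 hdl] := periodic_uniform_continuity ct pt e4; exists dl => // x z xz.
have h1 := le_trans (potential_trunc_close x N0 hN) Be.
have h2 := le_trans (potential_trunc_close z N0 hN) Be.
move: (hdl x z xz) h1 h2; rewrite !ler_norml => /andP[a1 a2] /andP[b1 b2] /andP[c1 c2].
by apply/andP; split; lra.
Qed.

End one_measure.
End kernel.
End dominated.

(** * The discrepancy under narrow limits *)

Section mmd.
Context {R : realType} {d : nat}.
Local Notation V := 'rV[R]_d.
Local Notation dx := (lebesgue_torus R d).
Variable g : V -> \bar R.
Hypothesis hg : coulomb_kernel g.
Local Notation gam := (fine \o g).
Local Notation pot := (fun al x => fine (potential g al x)).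
Local Notation tpot := (trunc_potential g).
Implicit Types (al be : torus_prob R d).

Lemma sub_close (p q p' q' e : R) : `|p - p'| <= e -> `|q - q'| <= e ->
  `|(p - q) - (p' - q')| <= 2 * e.
Proof.
by rewrite !ler_norml => /andP[? ?] /andP[? ?]; apply/andP; split; lra.
Qed.

Lemma dist_le_bounds (p q e : R) : `|p - q| <= e -> q <= p + e /\ p <= q + e.
Proof. by rewrite ler_norml => /andP[? ?]; split; lra. Qed.

Lemma half_sub_close (p q p' q' e : R) : `|p - p'| <= e -> `|q - q'| <= e ->
  `|2^-1 * (p - q) - 2^-1 * (p' - q')| <= e.
Proof.
by rewrite !ler_norml => /andP[? ?] /andP[? ?]; apply/andP; split; lra.
Qed.

Lemma mmd2E al be (B : R) : 0 <= B -> dominated B al -> dominated B be ->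
  mmd2 g al be = (2^-1 * (\int[al]_x (pot al x - pot be x) -
    \int[be]_x (pot al x - pot be x)))%:E.
Proof.
move=> B0 da db; rewrite /mmd2.
have th := tcontB (tcont_fine_potential hg B0 da) (tcont_fine_potential hg B0 db).
have hE : (fun x => (potential g al x - potential g be x)%E) =
    (fun x => (pot al x - pot be x)%:E).
  apply/funext => x; rewrite EFinB !fineK//.
    exact: (potential_fin hg B0 db).
  exact: (potential_fin hg B0 da).
by rewrite hE !tcont_integralE.
Qed.

Lemma mmd2_trunc_close al be (B t N : R) : 0 <= B -> dominated B al -> dominated B be ->
  0 <= N -> (\int[dx]_x kernel_tail g N x <= t%:E)%E ->
  `|2^-1 * (\int[al]_x (pot al x - pot be x) - \int[be]_x (pot al x - pot be x)) -
    2^-1 * (\int[al]_x (tpot N al x - tpot N be x) - \int[be]_x (tpot N al x - tpot N be x))|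
  <= 2 * (B * t).
Proof.
move=> B0 da db N0 ht.
have t1 := tcontB (tcont_fine_potential hg B0 da) (tcont_fine_potential hg B0 db).
have t2 := tcontB (tcont_trunc_potential hg al N0) (tcont_trunc_potential hg be N0).
have key x : `|(pot al x - pot be x) - (tpot N al x - tpot N be x)| <= 2 * (B * t).
  exact: (sub_close (potential_trunc_close hg B0 da x N0 ht) (potential_trunc_close hg B0 db x N0 ht)).
have i1 := tcont_Rintegral_norm al (tcontB t1 t2) key.
have i2 := tcont_Rintegral_norm be (tcontB t1 t2) key.
rewrite (tcont_RintegralB al t1 t2) in i1; rewrite (tcont_RintegralB be t1 t2) in i2.
exact: half_sub_close.
Qed.

(** The truncated potentials of [be_ j] converge boundedly, hence in [L^1] of the
    torus, and domination makes this convergence effective against [al_ j]. *)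
Lemma trunc_potential_pair_cvg (al_ be_ : nat -> torus_prob R d) al be (B N : R) :
  (forall j, dominated B (al_ j)) -> 0 <= N ->
  (forall f, torus_continuous f -> \int[al_ j]_x f x @[j --> \oo] --> \int[al]_x f x) ->
  (forall f, torus_continuous f -> \int[be_ j]_x f x @[j --> \oo] --> \int[be]_x f x) ->
  \int[al_ j]_x tpot N (be_ j) x @[j --> \oo] --> \int[al]_x tpot N be x.
Proof.
move=> dom N0 ca cb.
have tP nu := tcont_trunc_potential hg (nu : torus_prob R d) N0.
have tg := tcont_etrunc N0 (coulomb_continuous hg) (coulomb_periodic hg).
pose f_ j x := `|tpot N (be_ j) x - tpot N be x|.
have tf j : torus_continuous (f_ j).
  exact: (tcont_comp (@norm_continuous R R) (tcontB (tP (be_ j)) (tP be))).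
have PN nu x : `|tpot N (nu : torus_prob R d) x| <= N.
  apply: tcont_Rintegral_norm; last by move=> y; exact: etrunc_le.
  split; first exact: (@continuous_sub_rV R d x (fun z => etrunc N (g z)) tg.1).
  exact: (@lattice_periodic_sub R d _ (fun z => etrunc N (g z)) x tg.2).
have f_le j x : `|f_ j x| <= N + N.
  rewrite normr_id; apply: le_trans (ler_normB _ _) _.
  by apply: lerD; exact: PN.
have f_cvg x : f_ j x @[j --> \oo] --> (0 : R).
  rewrite -[X in _ --> X](@normr0 _ R) -(subrr (tpot N be x)); apply: cvg_norm.
  apply: cvgB; last exact: cvg_cst.
  apply: cb; split; first exact: (@continuous_sub_rV R d x (fun z => etrunc N (g z)) tg.1).
  exact: (@lattice_periodic_sub R d _ (fun z => etrunc N (g z)) x tg.2).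
have [||||_ hv] := @vitali _ _ _ dx f_ (fun=> 0).
- exact: (le_lt_trans (probability_le1 (dx : probability V R) measurableT) (ltry 1)).
- by move=> j; exact: tcont_integrable.
- exact: f_cvg.
- move=> tau tau0; exists (N + N) => [|j]; first by rewrite addr_ge0.
  have -> : \int[dx]_x `|f_ j x - clamp (N + N) (f_ j x)| = \int[dx]_x (cst 0 x : R).
    by apply: eq_Rintegral => x _; rewrite clamp_id ?subrr ?normr0.
  by rewrite Rintegral_prob_cst ltW.
have f0 : \int[dx]_x f_ j x @[j --> \oo] --> (0 : R).
  have h1 : exists M : R, forall x : V, `|cst 1 x| <= M by exists 1 => x; rewrite normr1.
  have := hv (cst 1) (measurable_cst _) h1.
  have -> : \int[dx]_x (0 * cst 1 x) = 0 :> R.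
    rewrite -[RHS](Rintegral_prob_cst dx 0); apply: eq_Rintegral => x _.
    by rewrite mul0r.
  rewrite (_ : (fun k => \int[dx]_x (f_ k x * cst 1 x)) = (fun k => \int[dx]_x f_ k x))//.
  by apply/funext => k; apply: eq_Rintegral => x _; rewrite mulr1.
have d0 : \int[al_ j]_x (tpot N (be_ j) x - tpot N be x) @[j --> \oo] --> (0 : R).
  apply/norm_cvg0P; apply: (@squeeze_cvgr _ _ _ _ (fun=> 0) (fun j => B * \int[dx]_x f_ j x)).
  - near=> j; rewrite normr_ge0/=.
    have tD := tcontB (tP (be_ j)) (tP be).
    apply: (le_trans _ (dom j (f_ j) (tf j) (fun x => normr_ge0 _))).
    exact: (le_normr_Rintegral measurableT (tcont_integrable (al_ j) tD)).
  - exact: cvg_cst.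
  - by rewrite -[X in _ --> X](mulr0 B); exact: (cvgM (cvg_cst B) f0).
rewrite (_ : (fun j => \int[al_ j]_x tpot N (be_ j) x) = (fun j =>
  \int[al_ j]_x (tpot N (be_ j) x - tpot N be x) + \int[al_ j]_x tpot N be x)).
  by rewrite -[X in _ --> X]add0r; exact: (cvgD d0 (ca _ (tP be))).
by apply/funext => j; rewrite (tcont_RintegralB (al_ j) (tP (be_ j)) (tP be)) subrK.
Unshelve. all: by end_near. Qed.

(** Uniformly in the measures, truncating the kernel changes the discrepancy by
    little, and for the truncated kernel it is narrowly continuous. *)
Lemma mmd2_limit_le (al_ be_ : nat -> torus_prob R d) al be (B c : R) : 0 <= B ->
  (forall j, dominated B (al_ j)) -> (forall j, dominated B (be_ j)) ->
  (forall f, torus_continuous f -> \int[al_ j]_x f x @[j --> \oo] --> \int[al]_x f x) ->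
  (forall f, torus_continuous f -> \int[be_ j]_x f x @[j --> \oo] --> \int[be]_x f x) ->
  (forall j, (mmd2 g (al_ j) (be_ j) <= c%:E)%E) -> (mmd2 g al be <= c%:E)%E.
Proof.
move=> B0 da db ca cb hc.
have dal : dominated B al by apply: (dominated_limit _ ca); exact: nearW.
have dbe : dominated B be by apply: (dominated_limit _ cb); exact: nearW.
rewrite (mmd2E B0 dal dbe) lee_fin; apply/ler_addgt0Pr => e e0.
have t0 : 0 < e / (4 * (B + 1)) by rewrite divr_gt0// mulr_gt0// ltr_wpDl.
have [N N0 hN] := kernel_tail_small hg t0.
have Be : 2 * (B * (e / (4 * (B + 1)))) <= e / 2.
  rewrite !mulrA ler_pdivrMr ?mulr_gt0 ?ltr_wpDl//.
  have -> : e / 2 * (4 * (B + 1)) = 2 * B * e + 2 * e by field.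
  by rewrite lerDl mulr_ge0// ltW.
have tP nu := tcont_trunc_potential hg (nu : torus_prob R d) N0.
pose T (a b : torus_prob R d) : R := 2^-1 * (\int[a]_x (tpot N a x - tpot N b x) -
  \int[b]_x (tpot N a x - tpot N b x)).
have TE (a b : torus_prob R d) : T a b = 2^-1 * ((\int[a]_x tpot N a x - \int[a]_x tpot N b x) -
    (\int[b]_x tpot N a x - \int[b]_x tpot N b x)).
  by rewrite /T (tcont_RintegralB a (tP a) (tP b)) (tcont_RintegralB b (tP a) (tP b)).
have cT : T (al_ j) (be_ j) @[j --> \oo] --> T al be.
  under eq_fun do rewrite TE; rewrite TE.
  apply: cvgM; first exact: cvg_cst.
  apply: cvgB; apply: cvgB.
  - exact: (trunc_potential_pair_cvg da N0 ca ca).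
  - exact: (trunc_potential_pair_cvg da N0 ca cb).
  - exact: (trunc_potential_pair_cvg db N0 cb ca).
  - exact: (trunc_potential_pair_cvg db N0 cb cb).
have Tj j : T (al_ j) (be_ j) <= c + e / 2.
  have := hc j; rewrite (mmd2E B0 (da j) (db j)) lee_fin => h1.
  have [h2 _] := dist_le_bounds (le_trans (mmd2_trunc_close B0 (da j) (db j) N0 hN) Be).
  by apply: (le_trans h2); rewrite lerD2r.
have Tl : T al be <= c + e / 2.
  rewrite -(cvg_lim (@Rhausdorff R) cT); apply: limr_le; first by apply/cvg_ex; exists (T al be).
  exact: nearW.
have [_ h3] := dist_le_bounds (le_trans (mmd2_trunc_close B0 dal dbe N0 hN) Be).
apply: (le_trans h3); apply: (le_trans (lerD Tl (lexx _))).
by have -> : c + e = (c + e / 2) + e / 2; [field|exact: lexx].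
Qed.

Lemma potential_density (f : V -> R) al x : is_density f al -> smooth f ->
  lattice_periodic f -> potential g al x = (convolve dx gam f x)%:E.
Proof.
move=> hf sf pf; have [mf f0 fE] := hf; have ig := kernel_integrable hg.
have mg := measurable_int _ (coulomb_integrable hg).
have mx : measurable_fun setT (fun y : V => x - y).
  by apply: measurable_fun_rV => j; under eq_fun do rewrite !mxE;
    apply: measurable_funB => //; exact: measurable_coord.
have i1 := conv_integrable ig x (smooth_continuous sf) pf.
rewrite /potential (integral_density mf f0 fE (measurableT_comp mg mx)).
rewrite convE /Rintegral fineK; last exact: (integrable_fin_num measurableT i1).
rewrite -(kernel_fine_integral hg (measurableT_comp mf mx)).
rewrite -(@integral_torus_sub _ _ x (fun z => (g z * (f (x - z)%R)%:E)%E)).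
- by apply: eq_integral => y _; rewrite [(x - (x - y))%R](_ : _ = y)// opprB addrC subrK.
- by apply: emeasurable_funM => //; apply/measurable_EFinP; exact: (measurableT_comp mf mx).
- by move=> n z; rewrite (coulomb_periodic hg) opprD addrA -latticeN pf.
Qed.

Lemma mmd2_flow_energy al be (u : R * V -> R) (m : V -> R) (lam M s t : R) :
  regular_flow g u m lam M -> is_density (fun x => u (t, x)) al -> is_density m be ->
  0 < s -> s <= t ->
  [/\ 0 <= M + s^-1, dominated (M + s^-1) al, dominated (M + s^-1) be &
      mmd2 g al be = (flow_energy g u m t)%:E].
Proof.
move=> rf hu hm s0 st; have B0 : 0 <= M + s^-1.
  by rewrite addr_ge0 ?(target_bound_ge0 rf)// invr_ge0 ltW.
have tu := tcont_density rf t; have tm := tcont_target rf.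
have du : dominated (M + s^-1) al.
  by apply: (density_dominated hu tu) => x; exact: (density_le_from hg rf).
have dm : dominated (M + s^-1) be.
  apply: (density_dominated hm tm) => x; apply: le_trans (rf_target_le rf x) _.
  by rewrite lerDl invr_ge0 ltW.
split=> //; rewrite (mmd2E B0 du dm) /flow_energy; congr (_ * _)%:E.
have sut := smooth_slice t (rf_smooth rf); have put := rf_periodic rf t.
have sm := rf_target_smooth rf; have pm := rf_target_periodic rf.
have th := tcont_potential hg rf t.
have hE x : pot al x - pot be x = flow_potential g u m (t, x).
  rewrite (potential_density x hu sut put) (potential_density x hm sm pm)/=.
  by rewrite /flow_potential tconvE -(convolveB hg x sut put sm pm).
have e1 (nu : torus_prob R d) (f : V -> R) : is_density f nu ->
    \int[nu]_x (pot al x - pot be x) = \int[dx]_x (flow_potential g u m (t, x) * f x).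
  move=> hf; rewrite -(Rintegral_density hf (continuous_measurable_rV th.1)).
  by apply: eq_Rintegral => x _; exact: hE.
rewrite (e1 _ _ hu) (e1 _ _ hm) -(tcont_RintegralB dx (tcontM th tu) (tcontM th tm)).
by apply: eq_Rintegral => x _; rewrite -mulrBr.
Qed.

End mmd.

(** * Averages over space-time strips *)

Lemma nonexpansive_continuous (R : realType) (W W' : normedModType R) (f : W -> W') :
  (forall x z, `|f x - f z| <= `|x - z|) -> continuous f.
Proof.
move=> hf x; apply/cvgrPdist_lt => e e0.
by apply/nbhs_normP; exists e => //= y; exact: le_lt_trans.
Qed.

Section time_space.
Context {R : realType} {d : nat}.
Local Notation V := 'rV[R]_d.
Local Notation dx := (lebesgue_torus R d).
Local Notation dt := (@lebesgue_measure R).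

Lemma continuous_uncons_rV : continuous (@uncons_rV R d).
Proof.
apply: nonexpansive_continuous => x y; rewrite [leLHS]/Num.norm/= ge_max; apply/andP; split.
  by have := rV_coord_le (x - y) ord0; rewrite !mxE.
by apply: rV_norm_le => // i; have := rV_coord_le (x - y) (lift ord0 i); rewrite !mxE.
Qed.

(** The product sigma-algebra on space-time is Borel: through [cons_rV] space-time is
    a space of row vectors. *)
Lemma continuous_measurable_time (u : R * V -> R) : continuous u ->
  measurable_fun setT (u : measurableTypeR R * V -> R).
Proof.
move=> cu.
have -> : u = (u \o @uncons_rV R d) \o @cons_rV R d by apply/funext => z /=; rewrite cons_rVK.
apply: measurableT_comp; last exact: measurable_cons_rV.
apply: continuous_measurable_rV => x.
by apply: continuous_comp; [exact: continuous_uncons_rV|exact: cu].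
Qed.

Local Notation strip a b := ((`[a, b]%classic : set (measurableTypeR R)) `*` [set: V]).

Lemma strip_measure (a b : R) : a <= b -> (dt \x dx)%E (strip a b) = (b - a)%:E.
Proof.
move=> ab; rewrite product_measure1E; [|exact: measurable_itv|exact: measurableT].
rewrite [X in (_ * X)%E](_ : _ = 1%E); last exact: (@probability_setT _ _ _ (dx : probability V R)).
rewrite mule1; transitivity (dt `[a, b]%classic); first by [].
rewrite lebesgue_measure_itv/= lte_fin.
by case: ltgtP ab => // -> _; rewrite subrr.
Qed.

Lemma strip_average (q : measurableTypeR R * V -> R) (a b c e : R) : a <= b -> 0 <= e ->
  measurable_fun setT q ->
  (exists C : R, {ae (dt \x dx)%E, forall z, strip a b z -> `|q z| <= C}) ->
  {ae dt, forall t : R, t \in `[a, b] -> `|\int[dx]_x q (t, x) - c| <= e} ->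
  `|\int[(dt \x dx)%E]_(z in strip a b) q z - (b - a) * c| <= (b - a) * e.
Proof.
move=> ab e0 mq [C0 hC0] hc.
pose C := `|C0|; have C1 : 0 <= C by rewrite normr_ge0.
have hC : {ae (dt \x dx)%E, forall z, strip a b z -> `|q z| <= C}.
  by apply: filterS hC0 => z h /h; move/le_trans; apply; exact: ler_norm.
have mI : measurable (`[a, b]%classic : set (measurableTypeR R)) by exact: measurable_itv.
have mD : measurable (strip a b) by exact: measurableX.
have mqE : measurable_fun (strip a b) (EFin \o q).
  by apply: measurable_funTS; exact/measurable_EFinP.
have iD : (dt \x dx)%E.-integrable (strip a b) (EFin \o q).
  apply/integrableP; split => //.
  apply: (@le_lt_trans _ _ (\int[(dt \x dx)%E]_(z in strip a b) (cst C%:E z))%E); last first.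
    by rewrite integral_cst//= strip_measure// -EFinM ltry.
  by apply: ae_ge0_le_integral => //; exact: measurableT_comp.
have iP : (dt \x dx)%E.-integrable setT ((EFin \o q) \_ (strip a b)).
  exact: (integrable_mkcond _ mD).1 iD.
pose Q t := (\int[dx]_x (q (t, x))%:E)%E.
have FE : (fun t => \int[dx]_x ((EFin \o q) \_ (strip a b)) (t, x))%E = Q \_ `[a, b].
  apply/funext => t; rewrite patchE; case: ifPn => [|] tab.
    apply: eq_integral => x _; rewrite patchE ifT//.
    by apply/mem_set; split => //; exact: set_mem.
  rewrite -[RHS](integral0 dx setT); apply: eq_integral => x _; rewrite patchE ifF//.
  by apply/negP => /set_mem[/= h _]; move/negP: tab; apply; exact/mem_set.
have iQ : dt.-integrable `[a, b] Q.
  by apply: (integrable_mkcond _ mI).2; rewrite -FE; exact: (integrable_fubini_F iP).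
have eQ : (\int[(dt \x dx)%E]_(z in strip a b) (q z)%:E = \int[dt]_(t in `[a, b]) Q t)%E.
  rewrite [LHS]integral_mkcond [RHS]integral_mkcond -FE.
  exact/esym/(integral12_prod_meas1 iP).
have dab : dt `[a, b]%classic = (b - a)%:E.
  rewrite lebesgue_measure_itv/= lte_fin.
  by case: ltgtP ab => // -> _; rewrite subrr.
have ci r : (\int[dt]_(t in `[a, b]) (cst r%:E t) = ((b - a) * r)%:E)%E.
  rewrite (integral_cst _ mI); transitivity (r%:E * (b - a)%:E)%E.
    by apply: (congr1 (mule r%:E)); exact: dab.
  by rewrite -EFinM mulrC.
have ic : dt.-integrable `[a, b] (cst c%:E).
  apply/integrableP; split; first exact: measurable_cst.
  rewrite (_ : (fun x => _) = cst `|c|%:E); last by apply/funext.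
  by rewrite ci ltry.
have Qfin := integrable_fin_num mI iQ.
have -> : \int[(dt \x dx)%E]_(z in strip a b) q z - (b - a) * c =
    fine (\int[dt]_(t in `[a, b]) (Q t - cst c%:E t))%E.
  rewrite (integralB mI iQ ic) ci fineB//=; congr (fine _ - _); exact: eQ.
have iQc := integrableB mI iQ ic.
rewrite -lee_fin -abse_EFin fineK; last exact: (integrable_fin_num mI iQc).
apply: le_trans (le_abse_integral _ mI (measurable_int _ iQc)) _.
rewrite -ci; apply: ae_ge0_le_integral => //.
- exact: measurableT_comp (measurable_int _ iQc).
- have h1 := integrable_ae mI iQ.
  move: h1 hc; apply: filterS2 => t Qt ht tab; have Qf := Qt tab.
  by have := ht tab; rewrite -lee_fin -abse_EFin EFinB /Rintegral fineK.
Qed.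

End time_space.

(** * Convergence at each time *)

Lemma ae_imply disp (T : measurableType disp) (R : realType)
    (mu : {measure set T -> \bar R}) (P Q : T -> Prop) :
  (forall x, P x -> Q x) -> {ae mu, forall x, P x} -> {ae mu, forall x, Q x}.
Proof. by move=> PQ; apply: filterS. Qed.

Section narrow.
Context {R : realType} {d : nat}.
Local Notation V := 'rV[R]_d.
Local Notation dx := (lebesgue_torus R d).
Local Notation dt := (@lebesgue_measure R).

Lemma narrow_from_smooth (eta : nat -> V -> R) (al_ : nat -> probability V R)
    (al : probability V R) : approx_identity eta ->
  (forall f : V -> R, smooth f -> lattice_periodic f ->
     \int[al_ j]_x f x @[j --> \oo] --> \int[al]_x f x) ->
  forall f, torus_continuous f -> \int[al_ j]_x f x @[j --> \oo] --> \int[al]_x f x.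
Proof.
move=> ae hs f tf; apply/cvgrPdist_le => e e0.
have e3 : 0 < e / 3 by rewrite divr_gt0.
have [K hK] := mollify_close ae tf.1 tf.2 e3.
pose fK := convolve dx f (eta K).
have sf : smooth fK.
  exact: (smooth_conv (tcont_integrable dx tf) (mlf_smooth (ae.1 K)) (mlf_periodic (ae.1 K))).
have pf : lattice_periodic fK by exact: lattice_periodic_conv (mlf_periodic (ae.1 K)).
have tK := tcont_smooth sf pf.
have close (nu : probability V R) : `|\int[nu]_x fK x - \int[nu]_x f x| <= e / 3.
  rewrite -(tcont_RintegralB nu tK tf).
  by apply: (tcont_Rintegral_norm nu (tcontB tK tf)) => x; exact: hK.
have /cvgrPdist_le/(_ _ e3) := hs fK sf pf; apply: filterS => j hj.
move: hj (close al) (close (al_ j)).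
move: (\int[al]_x fK x) (\int[al_ j]_x fK x) (\int[al]_x f x) (\int[al_ j]_x f x) => p q r s.
by rewrite !ler_norml => /andP[? ?] /andP[? ?] /andP[? ?]; apply/andP; split; lra.
Qed.

Lemma weak_star_shift (u_ : nat -> R * V -> R) (rho : R -> torus_prob R d) (J : nat) :
  weak_star_limit u_ rho -> weak_star_limit (fun j => u_ (j + J)%N) rho.
Proof.
move=> [r [mr dr hr]]; exists r; split=> // tau T tau0 tT D.
have [hM hpsi] := hr tau T tau0 tT; split => // psi ipsi.
have := hpsi psi ipsi.
by rewrite -(@cvg_shiftn J _ (fun j => \int[(dt \x dx)%E]_(z in D) (psi z * u_ j z))).
Qed.

Lemma narrow_right_continuity (rho : R -> torus_prob R d) (f : V -> R) (t e : R) :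
  narrowly_continuous rho -> torus_continuous f -> 0 < t -> 0 < e ->
  exists2 dl : R, 0 < dl & forall r : R, t <= r -> r <= t + dl ->
    `|\int[rho r]_x f x - \int[rho t]_x f x| <= e.
Proof.
move=> nc [cf pf] t0 e0; have c := nc f cf pf.
have co : {within `]0, +oo[, continuous (fun t => \int[rho t]_x f x)}.
  by apply: continuous_subspaceW c => x /=; rewrite !in_itv/= !andbT; exact: ltW.
have ct : {for t, continuous (fun t => \int[rho t]_x f x)}.
  move: co; rewrite continuous_open_subspace; last exact: interval_open.
  by apply; rewrite inE/= in_itv/= t0.
have /cvgrPdist_le/(_ _ e0)/nbhs_ballP[dl /= dl0 hdl] := ct.
exists (dl / 2); first by rewrite divr_gt0.
move=> r tr rt; rewrite distrC; apply: hdl; rewrite /ball/= ltr_distlC.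
by apply/andP; split; lra.
Qed.

Variable g : V -> \bar R.
Hypothesis hg : coulomb_kernel g.

(** The moments of the approximations are Lipschitz in time uniformly in the index,
    so that convergence of their averages over short time intervals, which is what
    weak-* convergence gives, is convergence at each time. *)
Lemma flow_cvg_at_time (u_ : nat -> R * V -> R) (m_ : nat -> V -> R) (lam M : R)
    (rho : R -> torus_prob R d) (f : V -> R) (t : R) :
  (forall j, regular_flow g (u_ j) (m_ j) lam M) -> weak_star_limit u_ rho ->
  narrowly_continuous rho -> smooth f -> lattice_periodic f -> 0 < t ->
  \int[dx]_x (f x * u_ j (t, x)) @[j --> \oo] --> \int[rho t]_x f x.
Proof.
move=> rf [r [mr dr hr]] nc sf pf t0; have tf := tcont_smooth sf pf.
have [C C0 hC] : exists2 C : R, 0 <= C & forall i x, `|pderiv i f x| <= C.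
  have /choice[c hc] (i : 'I_d) : exists c : R, 0 <= c /\ forall x, `|pderiv i f x| <= c.
    by have [c c0 hc] := tcont_bounded (tcont_pderiv i (C1_smooth sf pf)); exists c.
  exists (\sum_i c i) => [|i x]; first by apply: sumr_ge0 => i _; exact: (hc i).1.
  apply: le_trans ((hc i).2 x) _; rewrite (bigD1 i)//= lerDl.
  by apply: sumr_ge0 => k _; exact: (hc k).1.
have [Cf Cf0 hCf] := tcont_bounded tf.
pose L := `|d%:R * (grad_bound g (M + t^-1) * C)|; have L0 : 0 <= L by rewrite normr_ge0.
apply/cvgrPdist_le => e e0; pose ep := e / 3.
have ep0 : 0 < ep by rewrite divr_gt0.
have [dl dl0 hdl] := narrow_right_continuity nc tf t0 ep0.
have L1 : 0 < L + 1 by rewrite ltr_wpDl.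
(* On a time interval of length [h] neither the limit nor the approximations move by
   more than [ep]. *)
pose h := Num.min dl (ep / (L + 1)).
have h0 : 0 < h by rewrite lt_min dl0 divr_gt0.
have hdl' : h <= dl by rewrite ge_min lexx.
have hL : L * h <= ep.
  apply: (@le_trans _ _ ((L + 1) * h)); first by rewrite ler_pM2r// lerDl.
  by rewrite mulrC -ler_pdivlMr// ge_min lexx orbT.
have ab : t <= t + h by rewrite lerDl ltW.
have bh : t + h - t = h by rewrite addrAC subrr add0r.
have mfz : measurable_fun setT (fun z : measurableTypeR R * V => f z.2).
  exact: (measurableT_comp (continuous_measurable_rV tf.1) measurable_snd).
have tth : t < t + h by rewrite ltrDl.
have [[Mr hMr] hpsi] := hr t (t + h) t0 tth.
pose S := (`[t, t + h]%classic : set (measurableTypeR R)) `*` [set: V].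
have part1 j : `|\int[(dt \x dx)%E]_(z in S) (f z.2 * u_ j z) -
    h * \int[dx]_x (f x * u_ j (t, x))| <= h * ep.
  rewrite -bh; apply: (@strip_average R d (fun z => f z.2 * u_ j z) t (t + h) _ ep ab (ltW ep0)).
  - apply: measurable_funM => //.
    exact: (continuous_measurable_time (smooth_continuous (rf_smooth (rf j)))).
  - exists (Cf * (M + t^-1)); apply: aeW => -[s x] [/=]; rewrite in_itv/= => /andP[ts _] _.
    rewrite normrM; apply: ler_pM => //.
    rewrite ger0_norm; first exact: (density_le_from hg (rf j) x t0 ts).
    exact: (rf_ge0 (rf j) x (lt_le_trans t0 ts)).
  apply: aeW => s; rewrite in_itv/= => /andP[ts sh].
  apply: le_trans (flow_test_lipschitz hg (rf j) sf pf hC t0 (lexx t) ts) _.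
  apply: (@le_trans _ _ (L * (s - t))).
    by rewrite ler_wpM2r ?subr_ge0// ler_norm.
  by apply: le_trans hL; rewrite ler_wpM2l// lerBlDl.
have part2 : `|\int[(dt \x dx)%E]_(z in S) (f z.2 * r z) - h * \int[rho t]_x f x| <= h * ep.
  rewrite -bh; apply: (@strip_average R d (fun z => f z.2 * r z) t (t + h) _ ep ab (ltW ep0)).
  - exact: measurable_funM.
  - exists (Cf * Mr); move: hMr; apply: ae_imply => z hz /hz hz'; rewrite normrM.
    exact: ler_pM.
  move: dr; apply: ae_imply => s hs; rewrite in_itv/= => /andP[ts sh].
  rewrite -(Rintegral_density (hs (lt_le_trans t0 ts)) (continuous_measurable_rV tf.1)).
  by apply: hdl => //; apply: le_trans sh _; rewrite lerD2l.
have ipsi : (dt \x dx)%E.-integrable S (EFin \o (fun z => f z.2)).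
  apply: measurable_bounded_integrable.
  - by apply: measurableX => //; exact: measurable_itv.
  - by rewrite [X in (X < _)%E](strip_measure ab) ltry.
  - exact: measurable_funTS.
  - exists Cf; split; first by rewrite num_real.
    by move=> N CN z _ /=; apply: le_trans (hCf _) (ltW CN).
have hep : 0 < h * ep by rewrite mulr_gt0.
have /cvgrPdist_le/(_ _ hep) := hpsi (fun z => f z.2) ipsi.
apply: filterS => j hj.
rewrite -(ler_pM2l h0) -[X in X * _](gtr0_norm h0) -normrM mulrBr.
move: hj (part1 j) part2.
rewrite (_ : h * e = 3 * (h * ep)); last by rewrite /ep; field.
move: (h * ep) (h * \int[rho t]_x f x) (h * \int[dx]_x _).
move: (\int[(dt \x dx)%E]_(z in _) _) (\int[(dt \x dx)%E]_(z in _) _) => p q w x y.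
rewrite !ler_norml => /andP[? ?] /andP[? ?] /andP[? ?]; apply/andP; split; lra.
Qed.

End narrow.

(** * The decay estimate *)

Section assembly.
Context {R : realType} {d : nat}.
Local Notation V := 'rV[R]_d.
Local Notation dx := (lebesgue_torus R d).

Lemma Loo_bound (m : V -> R) : ('N[dx]_+oo[EFin \o m] < +oo)%E ->
  exists2 M : R, 0 <= M & \forall x \ae dx, m x <= M.
Proof.
rewrite unlock; have -> : (0 < dx [set: V])%E.
  rewrite [ltRHS](_ : _ = 1%E) ?lte01//; exact: (@probability_setT _ _ _ (dx : probability V R)).
set N := ess_sup _ _ => Noo; exists `|fine N| => //.
have := @ess_sup_ge _ _ _ dx (abse \o (EFin \o m)).
apply: ae_imply => x; rewrite -/N /= => h.
have Nf : N \is a fin_num.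
  by rewrite ge0_fin_numE//; apply: le_trans h; rewrite lee_fin.
apply: le_trans (ler_norm _) _; apply: le_trans (ler_norm _).
by rewrite -lee_fin fineK.
Qed.

Lemma ess_inf_bound (m : V -> R) (lam : R) : ess_inf dx (EFin \o m) = lam%:E ->
  \forall x \ae dx, lam <= m x.
Proof.
move=> hl; have := @ess_inf_le _ _ _ dx (EFin \o m).
by apply: ae_imply => x; rewrite hl /= lee_fin.
Qed.

Lemma increasing_ge_id (sigma : nat -> nat) : {homo sigma : j k / (j < k)%N} ->
  forall j, (j <= sigma j)%N.
Proof.
move=> hs; elim=> [//|j IH]; apply: leq_ltn_trans IH _; exact: hs.
Qed.

End assembly.

Theorem theorem1p7 (R : realType) (d : nat) (hd : (1 <= d)%N)
    (g : 'rV[R]_d -> \bar R) (hg : coulomb_kernel g)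
    (rho0 mu : torus_prob R d)
    (m : 'rV[R]_d -> R) (hm : is_density m mu)
    (hm_bounded : ('N[lebesgue_torus R d]_+oo[EFin \o m] < +oo)%E)
    (lambda : R) (hlambda : ess_inf (lebesgue_torus R d) (EFin \o m) = lambda%:E)
    (lambda_gt0 : 0 < lambda)
    (rho : R -> torus_prob R d) (hrho : constructed_solution g rho0 mu rho) :
  forall gamma : R, 0 < gamma -> gamma < 2 * lambda / 3 ->
  forall s : R, 0 < s ->
  exists C : R, forall t : R, s <= t ->
    (mmd2 g (rho t) mu <= (C * expR (- gamma * (t - s)))%:E)%E.
Proof.
move=> gamma gamma0 gamma_lt s s0.
have [_ nc _ [phi [eps [mu_ [rho_ [u [sigma [mphi [eps0 _ epsc] hk hs ws]]]]]]]] := hrho.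
have gl : gamma < lambda by lra.
have [M M0 mM] := Loo_bound hm_bounded.
have lm := ess_inf_bound hlambda.
have [K0 ae] := rescale_approx_identity mphi eps0 epsc.
pose eta k := periodize (rescale phi (eps (k + K0)%N)).
(* Since [sigma i >= i], these indices are all at least [K0]. *)
pose k_ j := sigma (j + K0)%N.
have k_ge j : (j + K0 <= k_ j)%N by exact: increasing_ge_id.
pose m_ j := mollify_measure mu (eta (k_ j - K0)%N).
have etaE j : eta (k_ j - K0)%N = periodize (rescale phi (eps (k_ j))).
  by rewrite /eta subnK// (leq_trans _ (k_ge j))// leq_addl.
have m_E j : periodic_conv mu (rescale phi (eps (k_ j))) = m_ j.
  by apply/funext => x; rewrite /m_ mollify_measureE etaE.
have dm_ j : is_density (m_ j) (mu_ (k_ j)).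
  by rewrite -m_E; have [] := hk (k_ j).
have sol j : smooth_solution g (mu_ (k_ j)) (u (k_ j)) (rho_ (k_ j)).
  by have [] := hk (k_ j).
have me j : mollifying (eta (k_ j - K0)%N) := ae.1 _.
have rf j : regular_flow g (u (k_ j)) (m_ j) lambda M.
  apply: (smooth_solution_flow hd hg ae (sol j) (dm_ j)).
  - exact: smooth_mollify_measure (me j).
  - exact: periodic_mollify_measure (me j).
  - exact: lambda_gt0.
  - by move=> x; apply: (mollify_measure_ge (me j) hm x (ltW lambda_gt0) lm).
  - by move=> x; apply: (mollify_measure_le (me j) hm x M0 mM).
exists (decay_cst g (M + s^-1) lambda gamma) => t st.
have t0 := lt_le_trans s0 st.
have du j : is_density (fun x => u (k_ j) (t, x)) (rho_ (k_ j) t).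
  exact: smooth_solution_density (sol j) t (ltW t0).
have hE j := mmd2_flow_energy hg (rf j) (du j) (dm_ j) s0 st.
have B0 : 0 <= M + s^-1 by have [] := hE 0%N.
apply: (@mmd2_limit_le R d g hg (fun j => rho_ (k_ j) t) (fun j => mu_ (k_ j)) _ _ (M + s^-1)) => //.
- by move=> j; have [] := hE j.
- by move=> j; have [] := hE j.
- apply: (narrow_from_smooth ae) => f sf pf.
  have := flow_cvg_at_time hg rf (weak_star_shift K0 ws) nc sf pf t0.
  apply: cvg_trans; apply: near_eq_cvg; apply: nearW => j.
  by rewrite (Rintegral_density (du j) (continuous_measurable_rV (smooth_continuous sf))).
- move=> f [cf pf].
  have h := mollify_measure_cvg (mu := mu) ae cf pf.
  have kc : (k_ j - K0)%N @[j --> \oo] --> \oo.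
    move=> A [N _ hA]; exists N => // j /= Nj; apply: hA => /=.
    by apply: leq_trans Nj _; rewrite leq_subRL ?(leq_trans _ (k_ge j)) ?leq_addl// addnC.
  have := cvg_comp _ _ kc h; apply: cvg_trans; apply: near_eq_cvg; apply: nearW => j.
  by rewrite /= (Rintegral_density (dm_ j) (continuous_measurable_rV cf)).
- move=> j; have [_ _ _ ->] := hE j; rewrite lee_fin.
  exact: (flow_decay hg (rf j) gl s0 st).
Qed.
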